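(* Let $d\ge 2$ be an integer and let $w:[0,1)\to(0,+\infty)$ be a weight function. Here harmonic approximability refers to the unit ball $B_d$ of $\mathbb{R}^d$. (i) If $w$ is harmonically approximable, then $w$ is equivalent to a log-convex weight function. (ii) If $d$ is even, then $w$ is harmonically approximable if and only if $w$ is equivalent to a log-convex weight function. (iii) If $d$ is odd and $w$ is doubling, then $w$ is harmonically approximable.
   Context: A weight function is a non-decreasing, continuous, unbounded function $w:[0,1)\to(0,+\infty)$. Let $B_d$ be the open unit ball of $\mathbb{R}^d$; $w$ is extended to a radial weight on $B_d$ by $w(x)=w(|x|)$, $x\in B_d$. For functions $u,v$ with values $\ge 0$ on a common domain ($B_d$ or $[0,1)$), write $u\asymp v$ and say that $u$ and $v$ are equivalent if there are constants $C_1,C_2>0$ such that $C_1u\le v\le C_2u$ at every point of the domain. $h(B_d)$ denotes the space of real-valued harmonic functions on $B_d$. A weight function $w$ is called harmonically approximable (on $B_d$) if there exists a finite family $\{f_1,\dots,f_J\}\subset h(B_d)$ such that $|f_1(x)|+\dots+|f_J(x)|\asymp w(|x|)$, $x\in B_d$. A weight function $w$ is doubling if there exists a constant $A>1$ such that $w(1-s/2)\le A\,w(1-s)$ for all $0<s\le 1$. A weight function $w$ is log-convex if $\log w(r)$ is a convex function of $\log r$, $0<r<1$. *)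

(* Defs.v *)
From HB Require Import structures.
From mathcomp Require Import all_boot all_order all_algebra.
From mathcomp Require Import all_classical all_reals all_analysis.

Set Implicit Arguments.
Unset Strict Implicit.
Unset Printing Implicit Defensive.

Import Order.TTheory GRing.Theory Num.Theory.
Import numFieldNormedType.Exports.

Local Open Scope classical_set_scope.
Local Open Scope ring_scope.

(* Functions on [0, 1) (resp. on the unit ball) are represented by total
   functions; every definition below only involves their values on [0, 1)
   (resp. on the ball). *)

Definition is_weight (R : realType) (w : R -> R) : Prop :=
  [/\ forall r, 0 <= r -> r < 1 -> 0 < w r,
      forall r s, 0 <= r -> r <= s -> s < 1 -> w r <= w s,
      {within `[0, 1[, continuous w}
    & ~ has_ubound (w @` `[0, 1[)].

Definition equiv_on (R : realType) (T : Type) (D : set T) (u v : T -> R) : Prop :=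
  exists C1 C2 : R, [/\ 0 < C1, 0 < C2
    & forall x, D x -> C1 * u x <= v x /\ v x <= C2 * u x].

(* The library norm on row vectors is the sup norm. *)
Definition enorm (R : realType) (d : nat) (x : 'rV[R]_d) : R :=
  Num.sqrt (\sum_(i < d) x 0 i ^+ 2).

Definition uball (R : realType) (d : nat) : set 'rV[R]_d :=
  [set x | enorm x < 1].

Definition pderiv (R : realType) (d : nat) (i : 'I_d) (f : 'rV[R]_d -> R^o) :
    'rV[R]_d -> R^o :=
  fun x => 'D_(delta_mx 0 i) f x.

Definition C2_on (R : realType) (d : nat) (U : set 'rV[R]_d)
    (f : 'rV[R]_d -> R^o) : Prop :=
  forall x, U x ->
    {for x, continuous f} /\
    forall i : 'I_d,
      [/\ derivable f x (delta_mx 0 i),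
          {for x, continuous (pderiv i f)}
        & forall j : 'I_d,
            derivable (pderiv i f) x (delta_mx 0 j) /\
            {for x, continuous (pderiv j (pderiv i f))}].

Definition harmonic_on (R : realType) (d : nat) (U : set 'rV[R]_d)
    (f : 'rV[R]_d -> R^o) : Prop :=
  C2_on U f /\ forall x, U x -> \sum_(i < d) pderiv i (pderiv i f) x = 0.

Definition harmonically_approximable (R : realType) (d : nat) (w : R -> R) : Prop :=
  exists (J : nat) (f : 'I_J -> 'rV[R]_d -> R^o),
    (forall j, harmonic_on (@uball R d) (f j)) /\
    equiv_on (@uball R d) (fun x => \sum_(j < J) `|f j x|) (fun x => w (enorm x)).

Definition doubling (R : realType) (w : R -> R) : Prop :=
  exists2 A : R, 1 < A &
    forall s : R, 0 < s -> s <= 1 -> w (1 - s / 2) <= A * w (1 - s).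

(* t = ln r ranges over ]-oo, 0[ when r ranges over ]0, 1[. *)
Definition log_convex (R : realType) (w : R -> R) : Prop :=
  convex_function (`]-oo, 0[%classic : set R) (fun t => ln (w (expR t))).

Definition equiv_log_convex_weight (R : realType) (w : R -> R) : Prop :=
  exists v : R -> R, [/\ is_weight v, log_convex v & equiv_on `[0, 1[ w v].

(* Main.v *)
Require Import Defs.
From mathcomp Require Import all_boot all_order all_algebra.
From mathcomp Require Import all_classical all_reals all_analysis.
From mathcomp Require Import complex.
From mathcomp Require Import ring lra zify.

(** Necessity.  Let E be the Euler field and < . >_t the mean over the sphere of
    radius e^t.  For a harmonic u, H(t) = <u^2>_t satisfies H' = 2 <u Eu> and
    H'' = 4 <(Eu)^2>; the second identity is a virial relation which follows from
    the infinitesimal rotation invariance of the mean, without spherical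
    harmonics.  By Cauchy-Schwarz the sum of the H's of a finite family is
    log-convex, and it is comparable to w(e^t)^2.  The mean is realised as an
    ultrafilter limit of grid sums, over shells that shrink to the unit sphere.

    Sufficiency.  As a function of t = ln g(r), with a suitable increasing g, ln w
    stays at bounded distance from the upper envelope of lines b_i + N_i t which
    are so well separated that, at each t, one of them dominates all the others
    geometrically, except possibly for a neighbouring one.  So it is enough to
    have, for each N, a bounded number of harmonic functions whose moduli add up
    to g(|x|)^N up to constants: their lacunary sums over even i and over odd i
    approximate w.  For a doubling w one takes g(r) = exp((r^2 - 1)/2) and sums of
    exponentials exp(zeta . x), zeta . zeta = 0, whose moduli are g^N times
    Gaussians centred at the points of a lattice.  For a log-convex w and even d
    one takes g(r) = r and sums of monomials z^alpha whose exponents are squares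
    alpha_i = k_i^2, which makes their moduli Gaussian in k as well.  If the
    lattice is split into residue classes modulo a large B, the point nearest to x
    dominates the rest of its class. *)

Set Implicit Arguments.
Unset Strict Implicit.
Unset Printing Implicit Defensive.

Import Order.TTheory GRing.Theory Num.Theory.
Import numFieldNormedType.Exports.

Local Open Scope classical_set_scope.
Local Open Scope ring_scope.

(** * Functions of class C1 *)

(** As a mean, a positive normalised linear functional that kills the rotations [x_i d_j - x_j d_i]
    is enough, so thick shells serve as well as spheres and no surface measure is built. A fixed
    shell loses too much, however: its mean at radius r sees [w] between [a * r] and r, and
    [w (a * r)] may be far below [w r]. Hence the shrinking shells, and a limit of the logarithms of
    the means, to which convexity passes.

    For the converse, several functions are needed for each N: a nonconstant homogeneous harmonic
    polynomial, for instance, has zeros on every sphere. One monomial or exponential has the size of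
    g^N only near its peak, so a whole lattice of peaks is used, and the width of the peaks must
    match the spacing uniformly in N. The modulus of z^alpha peaks where |z_j| is proportional to
    the square root of alpha_j; squares alpha_j = k_j^2 therefore give evenly spaced peaks, of width
    of order 1 in the scale sqrt(N) |z_j| / |x|. The exponentials need no complex structure on the
    space, only a vector orthogonal to a given one, which exists as soon as d >= 2; their growth g
    is bounded away from 0 at the origin. *)

Lemma heine_cantor (R : realType) (V : normedModType R) (K : set V) (P : V -> V -> Prop) :
  compact K -> (forall x, K x -> \forall y \near x & z \near x, P y z) ->
  exists2 e : R, 0 < e & forall x y, K x -> `|x - y| < e -> P x y.
Proof.
move=> /compact_near_coveringP cK h.
(* The radius is itself the parameter of the covering property, so that no minimum over a finite
   subcover has to be formed. *)
have : \forall e \near (0:R)^'+, K `<=` (fun x => forall y, `|x - y| < e -> P x y).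
  apply: (cK _ _ (fun e x => forall y, `|x - y| < e -> P x y)) => x Kx.
  have [[A B] /= [Ax Bx] AB] := h x Kx.
  have /nbhs_ballP [e e0 eB] : nbhs x (A `&` B) by exact: filterI.
  exists (ball x (e/2), [set d | d < e/2]).
    split => /=; first by apply: nbhsx_ballx; rewrite divr_gt0.
    by apply: nbhs_right_lt; rewrite divr_gt0.
  move=> [x' d] /= [x'x de] y x'y.
  have e2 : ball x e x' by apply: le_ball x'x; move: e0 => /= e0; lra.
  have e3 : ball x e y.
    rewrite (splitr e); apply: ball_triangle x'x _.
    by rewrite -ball_normE /=; apply: lt_trans x'y de.
  by apply: (AB (x', y)); split; [apply: (eB _ e2).1 | apply: (eB _ e3).2].
move=> H.
near (0:R)^'+ => e.
exists e; first by near: e; exact: nbhs_right_gt.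
by move=> x y Kx xy; have := near H e; apply.
Unshelve. all: by end_near. Qed.

Section C1.
Variables (R : realType) (d : nat).
Implicit Types (U : set 'rV[R]_d) (g h : 'rV[R]_d -> R) (x y : 'rV[R]_d).

Notation "''e_' i" := (delta_mx 0 i : 'rV[R]_d) (at level 8, i at level 2).

(** The partial derivatives are carried as explicit functions, so that sums, products, dilations and
    series are differentiated by formula and compared pointwise. *)
Definition C1 U g (dg : 'I_d -> 'rV[R]_d -> R) :=
  forall x, U x -> {for x, continuous g} /\
    forall i, is_derive x 'e_i g (dg i x) /\ {for x, continuous (dg i)}.

Lemma is_derive_line g (v : 'rV[R]_d) y (c s D : R) :
  is_derive (y + (s * c) *: v) v g D ->
  is_derive s 1 (fun t : R => g (y + (t * c) *: v)) (c * D).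
Proof.
move=> [gd gD].
have H : is_derive (s * c) 1 (fun t : R => g (y + t *: v)) D.
  have E : (fun h : R => h^-1 *: (((fun t : R => g (y + t *: v)) \o shift (s * c)) (h *: 1) - g (y + (s * c) *: v)))
    = (fun h : R => h^-1 *: ((g \o shift (y + (s * c) *: v)) (h *: v) - g (y + (s * c) *: v))).
    apply/funext => h /=; congr (_ *: (g _ - _)).
    by rewrite [_%:A]mulr1 scalerDl addrCA.
  by apply: DeriveDef; rewrite /derivable /derive E.
have H2 : is_derive s (1:R) ( *%R ^~ c) c.
  apply: (@is_derive_eq _ _ _ _ _ _ _ c); last by [].
  have := @is_deriveM R R id (cst c) s 1 1 0 (is_derive_id _ _) (is_derive_cst _ _ _).
  by move=> /is_derive_eq; apply; rewrite scaler0 add0r [_%:A]mulr1.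
have := @is_derive1_comp R (fun t : R => g (y + t *: v)) ( *%R ^~ c) s D c H H2.
by rewrite mulrC.
Qed.

(** The parameter s runs over [0, 1] whatever the sign of c, which avoids a case distinction on the
    direction of the segment. *)
Lemma MVT_line g (v : 'rV[R]_d) y (c : R) (D : 'rV[R]_d -> R) :
  (forall s : R, 0 <= s -> s <= 1 -> is_derive (y + (s * c) *: v) v g (D (y + (s * c) *: v))) ->
  exists s : R, [/\ 0 <= s, s <= 1 & g (y + c *: v) - g y = c * D (y + (s * c) *: v)].
Proof.
move=> H.
have H' (s : R) : s \in `[0,1] -> is_derive s 1 (fun t : R => g (y + (t * c) *: v)) (c * D (y + (s * c) *: v)).
  by rewrite in_itv /= => /andP[s0 s1]; apply: is_derive_line; apply: H.
have cf : {within `[0, 1], continuous (fun t : R => g (y + (t * c) *: v))}.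
  by apply: derivable_within_continuous => s s01; have [] := H' s s01.
have H'' (s : R) : s \in `]0,1[ -> is_derive s 1 (fun t : R => g (y + (t * c) *: v)) (c * D (y + (s * c) *: v)).
  by rewrite in_itv /= => /andP[s0 s1]; apply: H'; rewrite in_itv /= !ltW.
have [s] := MVT_segment ler01 H'' cf.
rewrite in_itv /= => /andP[s0 s1] E; exists s; split => //.
by move: E; rewrite mul1r mul0r scale0r addr0 subr0 mulr1.
Qed.

Lemma coord_le_norm x i : `|x 0 i| <= `|x|.
Proof.
rewrite [leRHS]/Num.norm /= mx_normrE.
by apply/bigmax_geP; right => /=; exists (0, i).
Qed.

Lemma norm_le_coord x (e : R) : 0 <= e -> (forall i, `|x 0 i| <= e) -> `|x| <= e.
Proof.
move=> e0 h; rewrite [leLHS]/Num.norm /= mx_normrE; apply/bigmax_leP; split => // -[i j] _ /=.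
by rewrite ord1.
Qed.

(* The increment is telescoped along a path parallel to the axes. *)
Lemma taylor1 U (K : set 'rV[R]_d) g dg : open U -> compact K -> K `<=` U -> C1 U g dg ->
  forall e : R, 0 < e -> exists2 dl : R, 0 < dl &
  forall x y, K x -> `|x - y| < dl ->
   `|g y - g x - \sum_i (y 0 i - x 0 i) * dg i x| <= e * \sum_i `|y 0 i - x 0 i|.
Proof.
move=> oU cK KU Cg e e0.
have [|dl dl0 H] := @heine_cantor R _ K (fun x y => U y /\ forall i, `|dg i y - dg i x| <= e) cK.
  move=> x Kx; have Ux := KU _ Kx.
  have [_ Cx] := Cg x Ux.
  have A : \forall y \near x, forall i, `|dg i x - dg i y| < e / 2.
    apply: (@filter_forall _ 'I_d (fun i y => `|dg i x - dg i y| < e / 2) (nbhs x)) => i; have [_ ci] := Cx i.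
    by move/cvgrPdist_lt : ci => /(_ (e/2)); apply; rewrite divr_gt0.
  near=> y z => /=; split; first by near: z; apply: open_nbhs_nbhs.
  move=> i; rewrite (_ : dg i z - dg i y = (dg i x - dg i y) - (dg i x - dg i z)); last by ring.
  rewrite (le_trans (ler_normB _ _))// (splitr e) lerD// ltW//.
    by move: i; near: y; exact: A.
  by move: i; near: z; exact: A.
exists dl => // x y Kx xy.
pose p (k : nat) := \row_i (if (i < k)%N then y 0 i else x 0 i) : 'rV[R]_d.
have p0 : p 0%N = x by apply/rowP => i; rewrite mxE.
have pd : p d = y by apply/rowP => i; rewrite mxE ltn_ord.
have pS (i : 'I_d) : p i.+1 = p i + (y 0 i - x 0 i) *: 'e_i.
  apply/rowP => j; rewrite !mxE eqxx /= ltnS leq_eqVlt.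
  case: (eqVneq j i) => [->|nij] /=; first by rewrite eqxx ltnn /= mulr1 addrC subrK.
  by rewrite mulr0 addr0 (_ : (nat_of_ord j == i) = false) //=; apply/negbTE.
have -> : g y - g x = \sum_(i < d) (g (p i.+1) - g (p i)).
  rewrite -(big_mkord xpredT (fun i => g (p i.+1) - g (p i))) telescope_sumr //.
  by rewrite p0 pd.
rewrite -sumrB (le_trans (ler_norm_sum _ _ _))// mulr_sumr; apply: ler_sum => i _.
have near_x (s : R) : 0 <= s -> s <= 1 -> `|x - (p i + (s * (y 0 i - x 0 i)) *: 'e_i)| < dl.
  move=> s0 s1; apply: le_lt_trans xy; apply: norm_le_coord => // j.
  rewrite !mxE eqxx /=.
  have := coord_le_norm (x - y) j; rewrite !mxE.
  case: (eqVneq j i) => [->|nij] /=.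
    rewrite ltnn mulr1 => h; apply: le_trans h.
    rewrite (_ : x 0 i - _ = s * (x 0 i - y 0 i)); last by ring.
    by rewrite normrM ger0_norm// ler_piMl.
  rewrite mulr0 addr0; case: ifP => // _ _.
  by rewrite subrr normr0.
have [s [s0 s1 E]] := @MVT_line g 'e_i (p i) (y 0 i - x 0 i) (dg i)
  (fun s s0 s1 => (((Cg _ (H _ _ Kx (near_x s s0 s1)).1).2 i)).1).
rewrite pS E -mulrBr normrM mulrC ler_wpM2r//.
by apply: (H _ _ Kx (near_x s s0 s1)).2.
Unshelve. all: by end_near. Qed.

End C1.

Lemma continuous_bigsum (R : realType) (T : topologicalType) I (r : seq I) (P : pred I)
    (f : I -> T -> R) (t : T) :
  (forall i, {for t, continuous (f i)}) ->
  {for t, continuous (fun s => \sum_(i <- r | P i) f i s)}.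
Proof.
move=> h; elim: r => [|i r IH].
  by rewrite (_ : (fun _ => _) = cst 0); [exact: cvg_cst|apply/funext => s; rewrite big_nil].
rewrite (_ : (fun _ => _) = (fun s => (if P i then f i s else 0) + \sum_(i <- r | P i) f i s)); last first.
  by apply/funext => s; rewrite big_cons; case: ifP => //; rewrite add0r.
apply: continuousD => //; case: (P i); [exact: h|exact: cvg_cst].
Qed.

Lemma continuous_sqr (R : realType) (T : topologicalType) (f : T -> R) t :
  {for t, continuous f} -> {for t, continuous (fun s => f s ^+ 2)}.
Proof. by move=> cf; exact: (@continuousM R T f f t cf cf). Qed.

Section enorm.
Variables (R : realType) (d : nat).
Implicit Types (x y : 'rV[R]_d).

Lemma sqr_enorm x : enorm x ^+ 2 = \sum_i x 0 i ^+ 2.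
Proof. by rewrite sqr_sqrtr// sumr_ge0// => i _; exact: sqr_ge0. Qed.

Lemma enorm_ge0 x : 0 <= enorm x. Proof. exact: sqrtr_ge0. Qed.

Lemma enormZ (a : R) x : enorm (a *: x) = `|a| * enorm x.
Proof.
rewrite /enorm -sqrtr_sqr -sqrtrM ?sqr_ge0// mulr_sumr; congr Num.sqrt.
by apply: eq_bigr => i _; rewrite !mxE exprMn.
Qed.

Lemma enorm0 : enorm (0 : 'rV[R]_d) = 0.
Proof. by rewrite -(scale0r 0) enormZ normr0 mul0r. Qed.

Lemma coord_le_enorm x i : `|x 0 i| <= enorm x.
Proof.
rewrite -(@ler_pXn2r _ 2)// ?nnegrE ?enorm_ge0// sqr_enorm real_normK ?num_real//.
by rewrite (bigD1 i)//= lerDl sumr_ge0// => j _; exact: sqr_ge0.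
Qed.

Lemma cauchy_schwarz x y : \sum_i x 0 i * y 0 i <= enorm x * enorm y.
Proof.
have [x0|x0] := eqVneq (enorm x) 0.
  rewrite x0 mul0r big1// => i _; have := coord_le_enorm x i.
  by rewrite x0 normr_le0 => /eqP ->; rewrite mul0r.
have [y0|y0] := eqVneq (enorm y) 0.
  rewrite y0 mulr0 big1// => i _; have := coord_le_enorm y i.
  by rewrite y0 normr_le0 => /eqP ->; rewrite mulr0.
have X : 0 < enorm x by rewrite lt_neqAle eq_sym x0 enorm_ge0.
have Y : 0 < enorm y by rewrite lt_neqAle eq_sym y0 enorm_ge0.
set a := enorm x in X *; set b := enorm y in Y *.
have : 0 <= \sum_i (b * x 0 i - a * y 0 i) ^+ 2 by apply: sumr_ge0 => i _; exact: sqr_ge0.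
rewrite (eq_bigr (fun i => b ^+ 2 * x 0 i ^+ 2 - 2 * a * b * (x 0 i * y 0 i) + a ^+ 2 * y 0 i ^+ 2)); last first.
  by move=> i _; ring.
rewrite !big_split /= sumrN -!mulr_sumr -!sqr_enorm -/a -/b => H.
have {}H : 0 <= 2 * a * b * (a * b - \sum_i x 0 i * y 0 i) by apply: le_trans H _; rewrite le_eqVlt; apply/orP; left; apply/eqP; ring.
by rewrite -subr_ge0; rewrite pmulr_rge0// !mulr_gt0 in H.
Qed.

Lemma enorm_triangle x y : enorm (x + y) <= enorm x + enorm y.
Proof.
rewrite -(@ler_pXn2r _ 2)// ?nnegrE ?addr_ge0 ?enorm_ge0// sqrrD !sqr_enorm.
rewrite (eq_bigr (fun i => x 0 i ^+ 2 + 2 * (x 0 i * y 0 i) + y 0 i ^+ 2)); last first.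
  by move=> i _; rewrite !mxE; ring.
by rewrite !big_split /= -mulr_sumr -[in leRHS]mulr_natl lerD2r lerD2l ler_pM2l// cauchy_schwarz.
Qed.

Lemma continuous_coord i : continuous (fun x : 'rV[R]_d => x 0 i).
Proof. exact: coord_continuous. Qed.

Lemma continuous_enorm : continuous (@enorm R d).
Proof.
move=> x; apply: continuous_comp; last exact: sqrt_continuous.
by apply: continuous_bigsum => i; apply: continuous_sqr; exact: continuous_coord.
Qed.

Lemma open_uball_r (r : R) : open [set x : 'rV[R]_d | enorm x < r].
Proof. by apply: (open_comp _ (@open_lt R r)) => x _; exact: continuous_enorm. Qed.

Lemma compact_cball (r : R) : compact [set x : 'rV[R]_d | enorm x <= r].
Proof.
apply: bounded_closed_compact.
  exists (`|r|); split; first exact: num_real.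
  move=> M rM x /= xr; apply: norm_le_coord => [|i]; first by rewrite ltW// (le_lt_trans _ rM).
  by rewrite (le_trans (coord_le_enorm _ _))// (le_trans xr)// (le_trans (ler_norm _))// ltW.
by apply: (closed_comp _ (@closed_le R r)) => x _; exact: continuous_enorm.
Qed.

End enorm.

Section C1_calculus.
Variables (R : realType) (d : nat).
Implicit Types (U : set 'rV[R]_d) (g h : 'rV[R]_d -> R) (x y : 'rV[R]_d).
Implicit Types (dg dh : 'I_d -> 'rV[R]_d -> R).

Notation "''e_' i" := (delta_mx 0 i : 'rV[R]_d) (at level 8, i at level 2).

Lemma C1_sub U V g dg : V `<=` U -> C1 U g dg -> C1 V g dg.
Proof. by move=> VU Cg x /VU; exact: Cg. Qed.

Lemma C1_cst U (c : R) : C1 U (fun=> c) (fun _ _ => 0).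
Proof.
move=> x _; split; first exact: cst_continuous.
by move=> i; split; [exact: is_derive_cst|exact: cst_continuous].
Qed.

Lemma is_derive_coord x i j : is_derive x 'e_j (fun y : 'rV[R]_d => y 0 i) (i == j)%:R.
Proof.
have E : (fun h : R => h^-1 *: (((fun y : 'rV[R]_d => y 0 i) \o shift x) (h *: 'e_j) - x 0 i)) @ 0^' --> ((i == j)%:R : R).
  apply: cvg_near_cst; near=> h => /=.
  have h0 : h != 0 by near: h; exact: nbhs_dnbhs_neq.
  by rewrite !mxE eqxx /= addrK [_ *: _]mulrA mulVf// mul1r.
by apply: DeriveDef; [apply/cvg_ex; eexists; exact: E|exact: cvg_lim E].
Unshelve. all: by end_near. Qed.

Lemma C1_coord U i : C1 U (fun x => x 0 i) (fun j _ => (i == j)%:R).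
Proof.
move=> x _; split; first exact: coord_continuous.
by move=> j; split; [exact: is_derive_coord|exact: cst_continuous].
Qed.

Lemma C1D U g dg h dh : C1 U g dg -> C1 U h dh ->
  C1 U (fun x => g x + h x) (fun i x => dg i x + dh i x).
Proof.
move=> Cg Ch x Ux; have [g0 g1] := Cg x Ux; have [h0 h1] := Ch x Ux.
split; first exact: continuousD.
move=> i; have [g2 g3] := g1 i; have [h2 h3] := h1 i.
by split; [exact: is_deriveD|exact: continuousD].
Qed.

Lemma C1M U g dg h dh : C1 U g dg -> C1 U h dh ->
  C1 U (fun x => g x * h x) (fun i x => dg i x * h x + g x * dh i x).
Proof.
move=> Cg Ch x Ux; have [g0 g1] := Cg x Ux; have [h0 h1] := Ch x Ux.
split; first exact: continuousM.
move=> i; have [g2 g3] := g1 i; have [h2 h3] := h1 i.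
split; last by apply: continuousD; apply: continuousM.
by apply: is_derive_eq; rewrite addrC [_ *: _]mulrC.
Qed.

Lemma C1_ext U g dg h dh : (forall x, g x = h x) -> (forall i x, dg i x = dh i x) ->
  C1 U g dg -> C1 U h dh.
Proof.
move=> /funext -> e; rewrite (_ : dg = dh)//.
by apply/funext => i; apply/funext => x.
Qed.

Lemma C1_sum U (I : finType) (P : pred I) (G : I -> 'rV[R]_d -> R) (dG : I -> 'I_d -> 'rV[R]_d -> R) :
  (forall k, C1 U (G k) (dG k)) ->
  C1 U (fun x => \sum_(k | P k) G k x) (fun i x => \sum_(k | P k) dG k i x).
Proof.
move=> CG; elim: (index_enum I) => [|k r IH].
  by apply: C1_ext (C1_cst 0) => [x|i x]; rewrite big_nil.
case Pk: (P k).
  by apply: C1_ext (C1D (CG k) IH) => [x|i x]; rewrite big_cons Pk.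
by apply: C1_ext IH => [x|i x]; rewrite big_cons Pk.
Qed.

Lemma C1Z U g dg (c : R) : C1 U g dg -> C1 U (fun x => c * g x) (fun i x => c * dg i x).
Proof.
move=> Cg x Ux; have [h0 h1] := C1M (C1_cst c) Cg Ux; split => // i.
by have := h1 i; rewrite mul0r add0r (_ : (fun _ => 0 * _ + _) = fun x => c * dg i x)//; apply/funext => y; rewrite mul0r add0r.
Qed.

Lemma C1N U g dg : C1 U g dg -> C1 U (fun x => - g x) (fun i x => - dg i x).
Proof.
move=> /(C1Z (-1)) Cg x Ux; have [h0 h1] := Cg x Ux; split.
  by rewrite (_ : (fun _ => _) = (fun x => -1 * g x))//; apply/funext => y; rewrite mulN1r.
move=> i; have := h1 i; rewrite !mulN1r (_ : (fun x => -1 * g x) = (fun x => - g x)); last first.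
  by apply/funext => y; rewrite mulN1r.
by rewrite (_ : (fun x => -1 * dg i x) = (fun x => - dg i x))//; apply/funext => y; rewrite mulN1r.
Qed.

Lemma C1_dilate U g dg (c : R) : C1 U g dg ->
  C1 [set x | U (c *: x)] (fun x => g (c *: x)) (fun i x => c * dg i (c *: x)).
Proof.
move=> Cg x Ux; have [g0 g1] := Cg _ Ux.
have cc : {for x, continuous (fun y : 'rV[R]_d => c *: y)}.
  exact: scaler_continuous.
split; first exact: (@continuous_comp _ _ _ _ g).
move=> i; have [g2 g3] := g1 i; split; last first.
  apply: continuousM; first exact: cst_continuous.
  exact: (@continuous_comp _ _ _ _ (dg i)).
have := @is_derive_line R d g 'e_i (c *: x) c 0 (dg i (c *: x)).
rewrite mul0r scale0r addr0 => /(_ g2) [H1 H2].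
have E : (fun h : R => h^-1 *: (((fun x => g (c *: x)) \o shift x) (h *: 'e_i) - g (c *: x)))
  = (fun h : R => h^-1 *: (((fun t : R => g (c *: x + (t * c) *: 'e_i)) \o shift 0) (h *: 1) - g (c *: x + (0 * c) *: 'e_i))).
  apply/funext => h /=; rewrite mul0r scale0r addr0; congr (_ *: (g _ - _)).
    by rewrite [_%:A]mulr1 scalerDr scalerA addrC mulrC.
  by rewrite addr0.
by apply: DeriveDef; rewrite /derivable /derive E.
Qed.

Definition euler dg x := \sum_i x 0 i * dg i x.

(* Second-order difference quotients along two axes, computed in both orders. *)
Lemma schwarz U g dg (ddg : 'I_d -> 'I_d -> 'rV[R]_d -> R) : open U -> C1 U g dg ->
  (forall i, C1 U (dg i) (ddg i)) -> forall i j x, U x -> ddg i j x = ddg j i x.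
Proof.
move=> oU Cg Cdg i j x Ux.
suff H (e : R) : 0 < e -> `|ddg i j x - ddg j i x| <= e + e.
  apply/eqP; rewrite -subr_eq0 -normr_le0; apply/ler_addgt0Pr => e e0.
  by rewrite add0r (splitr e); apply: H; rewrite divr_gt0.
move=> e0.
have near_e a b : \forall y \near x, `|ddg a b x - ddg a b y| < e.
  have [_ /(_ b)[_ c]] := Cdg a x Ux.
  by move/cvgrPdist_lt : c; apply.
have : \forall y \near x, [/\ U y, `|ddg i j x - ddg i j y| < e & `|ddg j i x - ddg j i y| < e].
  near=> y; split; [|by near: y; exact: near_e|by near: y; exact: near_e].
  by near: y; apply: open_nbhs_nbhs.
move=> /nbhs_ballP[r /= r0 rB].
have [s s0 ssr] : exists2 s : R, 0 < s & s + s < r by exists (r / 4); move: r0; lra.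
have ins (a b : R) k l : 0 <= a -> a <= 1 -> 0 <= b -> b <= 1 ->
  ball x r (x + (a * s) *: 'e_k + (b * s) *: 'e_l).
  move=> a0 a1 b0 b1; rewrite -ball_normE /= -addrA opprD addrA subrr add0r normrN.
  have ee (m : 'I_d) : `|'e_m| <= 1.
    apply: norm_le_coord => // m'; rewrite !mxE eqxx /=.
    by case: (_ == _); rewrite ?normr1 ?normr0.
  apply: (@le_lt_trans _ _ (s + s)); last by [].
  apply: (le_trans (ler_normD _ _)); rewrite !normrZ ?normrM.
  rewrite (ger0_norm a0) (ger0_norm b0) (ger0_norm (ltW s0)).
  by apply: lerD; rewrite -[leRHS]mulr1 ler_pM// ?mulr_ge0 ?ler_piMl// ltW.
have key k l : exists y, ball x r y /\
  g (x + s *: 'e_k + s *: 'e_l) - g (x + s *: 'e_k) - g (x + s *: 'e_l) + g x = s * (s * ddg l k y).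
  pose f y := g (y + s *: 'e_k) - g y.
  have [t [t0 t1 E]] : exists t : R, [/\ 0 <= t, t <= 1 &
     f (x + s *: 'e_l) - f x = s * (dg l (x + (t * s) *: 'e_l + s *: 'e_k) - dg l (x + (t * s) *: 'e_l))].
    apply: (@MVT_line _ _ f 'e_l x s (fun y => dg l (y + s *: 'e_k) - dg l y)) => t t0 t1.
    apply: is_deriveB; last first.
      apply: ((Cg _ _).2 l).1; have := ins t 0 l l t0 t1 (lexx _) ler01.
      by rewrite mul0r scale0r addr0 => /rB[].
    have := (((Cg (x + (t * s) *: 'e_l + s *: 'e_k)) _).2 l).1.
    have := ins t 1 l k t0 t1 ler01 (lexx _); rewrite mul1r => /rB[Uy _ _] /(_ Uy) [D1 D2].
    by apply: DeriveDef; rewrite /derivable /derive; move: D1 D2; rewrite /derivable /derive /=;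
      under eq_fun do rewrite addrA.
  have [t' [t'0 t'1 E']] : exists t' : R, [/\ 0 <= t', t' <= 1 &
     dg l (x + (t * s) *: 'e_l + s *: 'e_k) - dg l (x + (t * s) *: 'e_l) =
     s * ddg l k (x + (t * s) *: 'e_l + (t' * s) *: 'e_k)].
    apply: MVT_line => t' t'0 t'1.
    by apply: ((Cdg l _ _).2 k).1; have /rB[] := ins t t' l k t0 t1 t'0 t'1.
  exists (x + (t * s) *: 'e_l + (t' * s) *: 'e_k); split; first exact: ins.
  rewrite -E' -E /f (addrAC x); ring.
have [y [/rB[_ _ y1] y2]] := key i j; have [z [/rB[_ z1 _] z2]] := key j i.
have E : ddg j i y = ddg i j z.
  by do 2 apply: (mulfI (lt0r_neq0 s0)); rewrite -y2 -z2 (addrAC x); ring.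
rewrite (_ : _ - _ = (ddg i j x - ddg i j z) - (ddg j i x - ddg j i y)); last by rewrite E; ring.
by rewrite (le_trans (ler_normB _ _))// lerD// ltW.
Unshelve. all: by end_near. Qed.

End C1_calculus.

(** * Means over the sphere *)

Definition ultra_oo : set_system nat :=
  projT1 (cid (ultraFilterLemma (F := \oo) eventually_filter)).

Lemma ultra_ooP : UltraFilter ultra_oo /\ (\oo : set_system nat) `<=` ultra_oo.
Proof. by rewrite /ultra_oo; case: cid. Qed.

Instance ultra_oo_proper : ProperFilter ultra_oo.
Proof. by have [[]] := ultra_ooP. Qed.

(** A limit functional defined on all bounded sequences, linear and monotone. Thanks to it neither
    the grid sums nor the means over shrinking shells have to be shown to converge. *)
Definition ulim (R : realType) (u : nat -> R) : R := lim (u n @[n --> ultra_oo]).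

Section ulim.
Variable R : realType.
Implicit Types u v : nat -> R.

(** The image of an ultrafilter is an ultrafilter, and on the compact segment [-M, M] every
    ultrafilter converges. *)
Lemma cvg_ulim u (M : R) : (forall n, `|u n| <= M) -> u n @[n --> ultra_oo] --> ulim u.
Proof.
move=> uM; have [ul _] := ultra_ooP.
have FU : UltraFilter (u n @[n --> ultra_oo]).
  split; first exact: fmap_proper_filter.
  move=> G GG sG; apply/seteqP; split => // A GA.
  have [//|FnA] := in_ultra_setVsetC (u @^-1` A) ul.
  have GnA : G (~` A) by apply: sG.
  by have /filter_ex [? []] : G (A `&` ~` A) by exact: filterI.
have := @segment_compact R (- M) M; rewrite compact_ultra => /(_ _ FU) [|p [_ up]].
  change (ultra_oo (u @^-1` `[- M, M]%classic)); apply: filterE => n /=; rewrite in_itv /=.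
  by have := uM n; rewrite ler_norml.
by apply: (cvgP p).
Qed.

Lemma ulimE u (l : R) : u n @[n --> ultra_oo] --> l -> ulim u = l.
Proof. exact: cvg_lim. Qed.

Lemma cvg_ulimE u (l : R) : u @ \oo --> l -> ulim u = l.
Proof.
by move=> ul; apply: ulimE; have [_ s] := ultra_ooP => A /ul uA; exact: s.
Qed.

Lemma ulim_cst (c : R) : ulim (fun=> c) = c.
Proof. by apply: ulimE; exact: cvg_cst. Qed.

Lemma ulimD u v (M M' : R) : (forall n, `|u n| <= M) -> (forall n, `|v n| <= M') ->
  ulim (fun n => u n + v n) = ulim u + ulim v.
Proof. by move=> /cvg_ulim cu /cvg_ulim cv; apply: ulimE; exact: cvgD. Qed.

Lemma ulimZ u (M c : R) : (forall n, `|u n| <= M) -> ulim (fun n => c * u n) = c * ulim u.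
Proof. by move=> /cvg_ulim cu; apply: ulimE; apply: cvgM => //; exact: cvg_cst. Qed.

Lemma ler_ulim u v (M M' : R) : (forall n, `|u n| <= M) -> (forall n, `|v n| <= M') ->
  (\forall n \near \oo, u n <= v n) -> ulim u <= ulim v.
Proof.
move=> /cvg_ulim cu /cvg_ulim cv uv.
have [_ s] := ultra_ooP.
by apply: (ler_cvg_to cu cv); exact: s.
Qed.

End ulim.

(** * Riemann sums on a cyclic grid of the cube *)

Section grid.
Variables (R : realType) (d : nat).
Implicit Types (F G : 'rV[R]_d -> R).

Notation "''e_' i" := (delta_mx 0 i : 'rV[R]_d) (at level 8, i at level 2).

(** Lower corners of the cells of the cube [-1, 1]^d cut into (N+1)^d equal cells. One corner per
    cell makes the index set a discrete torus, on which a shift by one cell is a bijection. *)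
Definition gpt N (k : {ffun 'I_d -> 'I_N.+1}) : 'rV[R]_d :=
  \row_i (-1 + (2 / N.+1%:R) * (k i)%:R).

Definition gmean F N : R := (N.+1%:R ^+ d)^-1 * \sum_(k : {ffun 'I_d -> 'I_N.+1}) F (gpt k).

Lemma gmeanD F G N : gmean (fun x => F x + G x) N = gmean F N + gmean G N.
Proof. by rewrite /gmean big_split mulrDr. Qed.

Lemma gmeanZ (c : R) F N : gmean (fun x => c * F x) N = c * gmean F N.
Proof. by rewrite /gmean -mulr_sumr mulrCA. Qed.

Lemma ler_gmean F G N : (forall x, F x <= G x) -> gmean F N <= gmean G N.
Proof.
move=> FG; rewrite /gmean ler_wpM2l ?invr_ge0 ?exprn_ge0// ler_sum//.
Qed.

Lemma gmean_cst (c : R) N : gmean (fun=> c) N = c.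
Proof.
rewrite /gmean sumr_const card_ffun !card_ord -[c *+ _]mulr_natl natrX mulrA.
by rewrite mulVf ?mul1r// expf_neq0// pnatr_eq0.
Qed.

Lemma gmean_bound F (M : R) N : (forall x, `|F x| <= M) -> `|gmean F N| <= M.
Proof.
move=> FM; rewrite ler_norml -{1}(gmean_cst (- M) N) -[X in _ && (_ <= X)](gmean_cst M N).
by rewrite !ler_gmean// => x; have := FM x; rewrite ler_norml => /andP[].
Qed.

Definition gshift N (i : 'I_d) (k : {ffun 'I_d -> 'I_N.+1}) : {ffun 'I_d -> 'I_N.+1} :=
  [ffun j => if j == i then ordS (k j) else k j].

Lemma gshift_inj N i : injective (@gshift N i).
Proof.
move=> k l /ffunP kl; apply/ffunP => j; have := kl j; rewrite !ffunE.
by case: ifP => // _ /ordS_inj.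
Qed.

Lemma enorm_delta (i : 'I_d) : enorm ('e_i : 'rV[R]_d) = 1.
Proof.
rewrite /enorm (bigD1 i)//= big1 => [|j ji]; first by rewrite mxE !eqxx expr1n addr0 sqrtr1.
by rewrite mxE (negbTE ji) andbF expr0n.
Qed.

(* The grid sums of increments telescope cyclically, since G vanishes at the
   boundary of the cube. *)
Lemma gmean_pderiv G (dG : 'I_d -> 'rV[R]_d -> R) (b : R) i : b < 1 ->
  C1 (@uball R d) G dG -> (forall x, b <= enorm x -> G x = 0 /\ dG i x = 0) ->
  gmean (dG i) @ \oo --> (0 : R).
Proof.
move=> b1 CG Gb.
apply/cvgrPdist_le => e e0.
have sub : [set x : 'rV[R]_d | enorm x <= (1 + b) / 2] `<=` @uball R d.
  by move=> x /= h; apply: le_lt_trans h _; lra.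
have [dl dl0 H] := taylor1 (@open_uball_r R d 1) (@compact_cball R d _) sub CG e0.
(* A step below (1 - b) / 2 ensures that a grid point outside the ball of radius (1 + b) / 2 has its
   translate outside the ball of radius b, where [G] vanishes too. *)
have h0 : \forall N \near \oo, 2 / N.+1%:R < Num.min dl ((1 - b) / 2).
  have : (fun N : nat => 2 * (N.+1%:R : R)^-1) @ \oo --> (2 * 0 : R).
    by apply: cvgM; [exact: cvg_cst|exact: cvg_harmonic].
  rewrite mulr0 => /cvgrPdist_lt /(_ (Num.min dl ((1 - b) / 2))) [|N _ HN].
    by rewrite lt_min dl0 divr_gt0// subr_gt0.
  exists N => // n /HN /=; rewrite sub0r normrN ger0_norm// mulr_ge0// invr_ge0//.
near=> N.
rewrite sub0r normrN.
have hlt : 2 / N.+1%:R < Num.min dl ((1 - b) / 2) by near: N; exact: h0.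
set h := 2 / N.+1%:R : R in hlt *.
have hgt0 : 0 < h by rewrite divr_gt0.
have [hdl hb] : h < dl /\ h < (1 - b) / 2.
  by apply/andP; rewrite -lt_min.
have shE (k : {ffun 'I_d -> 'I_N.+1}) : G (gpt (gshift i k)) = G (gpt k + h *: 'e_i).
  case: (ltnP (k i).+1 N.+1) => ki.
    congr G; apply/rowP => j; rewrite !mxE !ffunE eqxx /=.
    case: (eqVneq j i) => [->|ji]; last by rewrite mulr0 addr0.
    by rewrite /= modn_small// -/h -natr1; ring.
  have kN : (k i).+1 = N.+1 by apply/eqP; rewrite eqn_leq ki ltn_ord.
  rewrite (Gb (gpt _) _).1; last first.
    apply: le_trans (coord_le_enorm _ i); rewrite !mxE !ffunE eqxx /= kN modnn mulr0 addr0.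
    by rewrite normrN normr1 ltW.
  rewrite (Gb (_ + _) _).1//.
  apply: le_trans (coord_le_enorm _ i); rewrite !mxE !eqxx /= mulr1 -/h.
  rewrite -addrA -{2}[h]mulr1 -mulrDr natr1 kN /h divfK ?pnatr_eq0//.
  by rewrite (_ : -1 + 2 = 1) ?normr1 ?ltW//; ring.
have est (k : {ffun 'I_d -> 'I_N.+1}) :
   `|G (gpt k + h *: 'e_i) - G (gpt k) - h * dG i (gpt k)| <= e * h.
  case: (lerP (enorm (gpt k)) ((1 + b) / 2)) => hk.
    have hx : `|gpt k - (gpt k + h *: 'e_i)| < dl.
      rewrite opprD addrA subrr add0r normrN normrZ (ger0_norm (ltW hgt0)).
      apply: le_lt_trans hdl; rewrite ler_piMr ?(ltW hgt0)//.
      apply: norm_le_coord => // j; rewrite mxE eqxx /=.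
      by case: (_ == _); rewrite ?normr1 ?normr0.
    have E (j : 'I_d) : (gpt k + h *: 'e_i) 0 j - gpt k 0 j = if j == i then h else 0.
      rewrite !mxE eqxx /= addrC addrA addNr add0r.
      by case: (j == i); rewrite ?mulr1 ?mulr0.
    have := H _ _ hk hx.
    rewrite (bigD1 i)//= E eqxx big1 => [|j ji]; last by rewrite E (negbTE ji) mul0r.
    rewrite addr0 (bigD1 i)//= E eqxx big1 => [|j ji]; last by rewrite E (negbTE ji) normr0.
    by rewrite addr0 (ger0_norm (ltW hgt0)).
  have gb : b <= enorm (gpt k) by move: hk b1; lra.
  have gb' : b <= enorm (gpt k + h *: 'e_i).
    have := enorm_triangle (gpt k + h *: 'e_i) (- h *: 'e_i).
    rewrite enormZ enorm_delta mulr1 normrN (ger0_norm (ltW hgt0)) scaleNr addrK.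
    by move: hk hb; lra.
  by rewrite (Gb _ gb).1 (Gb _ gb).2 (Gb _ gb').1 !subr0 mulr0 subr0 normr0 mulr_ge0// ltW.
have sum0 : \sum_(k : {ffun 'I_d -> 'I_N.+1}) (G (gpt k + h *: 'e_i) - G (gpt k)) = 0.
  rewrite sumrB (eq_bigr (fun k => G (gpt (gshift i k)))) => [|k _]; last by rewrite shE.
  rewrite [X in _ - X](reindex_inj (@gshift_inj N i))/=.
  by rewrite subrr.
have : `|gmean (fun x => h * dG i x) N| <= e * h.
  rewrite /gmean normrM ger0_norm ?invr_ge0 ?exprn_ge0//.
  rewrite ler_pdivrMl ?exprn_gt0//.
  rewrite -normrN -sumrN.
  rewrite (_ : \sum__ _ = \sum_(k : {ffun 'I_d -> 'I_N.+1}) (G (gpt k + h *: 'e_i) - G (gpt k) - h * dG i (gpt k))); last first.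
    by rewrite [RHS]sumrB sum0 sub0r sumrN.
  apply: le_trans (ler_norm_sum _ _ _) _.
  apply: le_trans (ler_sum _ (fun k _ => est k)) _.
  by rewrite sumr_const card_ffun !card_ord -[_ *+ _]mulr_natl natrX.
by rewrite gmeanZ normrM (ger0_norm (ltW hgt0)) mulrC ler_pM2r.
Unshelve. all: by end_near. Qed.

Definition gint F := ulim (gmean F).

Lemma gint_pderiv G (dG : 'I_d -> 'rV[R]_d -> R) (b : R) i : b < 1 ->
  C1 (@uball R d) G dG -> (forall x, b <= enorm x -> G x = 0 /\ dG i x = 0) ->
  gint (dG i) = 0.
Proof. by move=> b1 CG Gb; apply: cvg_ulimE; exact: gmean_pderiv b1 CG Gb. Qed.

Lemma gintD F G (M M' : R) : (forall x, `|F x| <= M) -> (forall x, `|G x| <= M') ->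
  gint (fun x => F x + G x) = gint F + gint G.
Proof.
move=> FM GM; rewrite /gint (_ : gmean _ = fun N => gmean F N + gmean G N).
  by apply: (@ulimD _ _ _ M M') => N; exact: gmean_bound.
by apply/funext => N; exact: gmeanD.
Qed.

Lemma gintZ (c : R) F (M : R) : (forall x, `|F x| <= M) ->
  gint (fun x => c * F x) = c * gint F.
Proof.
move=> FM; rewrite /gint (_ : gmean _ = fun N => c * gmean F N).
  by apply: (@ulimZ _ _ M) => N; exact: gmean_bound.
by apply/funext => N; exact: gmeanZ.
Qed.

Lemma ler_gint F G (M M' : R) : (forall x, `|F x| <= M) -> (forall x, `|G x| <= M') ->
  (forall x, F x <= G x) -> gint F <= gint G.
Proof.
move=> FM GM FG; apply: (@ler_ulim _ _ _ M M') => [N|N|]; try exact: gmean_bound.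
by near=> N; exact: ler_gmean.
Unshelve. all: by end_near. Qed.

End grid.

(** With n = N + 1, the point y has the real index a = n (1 + y) / 2, and distance below r means
    index distance below r n / 2. Counting only the floor of r n / 4 indices just above a leaves
    room for the rounding, and gives at least r n / 8 of them once r n > 8. *)
Lemma grid_count (R : realType) (y r : R) : -1 < y -> y < 1 -> 0 < r -> r < 1 - y ->
  \forall N \near \oo, r / 8 * N.+1%:R <=
    \sum_(k < N.+1) (`|-1 + (2 / N.+1%:R) * k%:R - y| < r)%R%:R.
Proof.
move=> y1 y2 r0 ry; near=> N.
have nbig : 8 / r < N.+1%:R.
  near: N; exists (Num.truncn (8 / r)).+1 => // N /= hN.
  have h8 : 0 <= 8 / r by rewrite divr_ge0// ltW.
  have /andP[_ h] := truncn_itv h8.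
  by apply: lt_le_trans h _; rewrite ler_nat ltnS ltnW.
set n := N.+1%:R : R in nbig *.
have n0 : 0 < n by rewrite ltr0n.
have rn : 8 < r * n by rewrite mulrC -ltr_pdivrMr.
pose a := n * (1 + y) / 2.
have a0 : 0 <= a by rewrite /a divr_ge0// mulr_ge0 ?ltW//; move: y1; lra.
set k0 := (Num.truncn a).+1.
have /andP[ta1 ta2] := truncn_itv a0.
have k0a : a < k0%:R by [].
have k0b : k0%:R <= a + 1 by rewrite -natr1 lerD2r.
have q0 : 0 <= r * n / 4 by rewrite divr_ge0// mulr_ge0// ltW.
set L := Num.truncn (r * n / 4).
have /andP[L1 L2] := truncn_itv q0.
have kL : (k0 + L <= N.+1)%N.
  rewrite -(ler_nat R) natrD -/n.
  have : a + r * n / 2 <= n.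
    rewrite /a (_ : _ + _ = n * ((1 + y + r) / 2)); last by ring.
    by rewrite ger_pMr//; move: ry; lra.
  by move: k0b L1 rn; rewrite -/L; lra.
rewrite -(big_mkord xpredT (fun k => (`|-1 + 2 / n * k%:R - y| < r)%R%:R)).
rewrite (big_cat_nat (n := k0)) ?(leq_trans (leq_addr L k0))//=.
rewrite (big_cat_nat (m := k0) (n := k0 + L)) ?leq_addr//=.
apply: (@le_trans _ _ (0 + (\sum_(k0 <= k < k0 + L) 1 + 0))); last first.
  rewrite lerD ?sumr_ge0// lerD ?sumr_ge0//.
  apply: ler_sum_nat => k /andP[ka kb].
  rewrite (_ : (_ < _)%R = true)//.
  have k1 : k0%:R <= k%:R :> R by rewrite ler_nat.
  have k2 : k%:R < k0%:R + L%:R :> R by rewrite -natrD ltr_nat.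
  rewrite (_ : _ - y = 2 / n * (k%:R - a)); last by rewrite /a; field; rewrite gt_eqF.
  rewrite normrM !gtr0_norm ?divr_gt0 ?subr_gt0 ?(lt_le_trans k0a)//.
  rewrite mulrAC ltr_pdivrMr//; move: L1; rewrite -/L => L1; lra.
rewrite add0r addr0 sumr_const_nat addKn.
have L2' : r * n / 4 < L%:R + 1 by rewrite natr1.
by rewrite -/n; lra.
Unshelve. all: by end_near. Qed.

(** A fixed fraction of the grid points, a product of d one-dimensional counts, falls in the cube of
    side 2r about [x0], so the grid means stay away from 0. This allows the mean over a shell to be
    normalised. *)
Lemma gint_gt0 (R : realType) (d : nat) (F : 'rV[R]_d -> R) (M c r : R) (x0 : 'rV[R]_d) :
  (forall x, 0 <= F x) -> (forall x, `|F x| <= M) -> enorm x0 < 1 -> 0 < c -> 0 < r ->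
  (forall x : 'rV[R]_d, (forall i, `|x 0 i - x0 0 i| < r) -> c <= F x) -> 0 < gint F.
Proof.
move=> F0 FM x01 c0 r0 Fc.
have xi i : -1 < x0 0 i < 1.
  by rewrite -ltr_norml; apply: le_lt_trans (coord_le_enorm _ _) x01.
have [r' r'0 [r'r r'x]] : exists2 r' : R, 0 < r' & r' <= r /\ forall i, r' < 1 - x0 0 i.
  exists (Num.min r ((1 - enorm x0) / 2)); first by rewrite lt_min r0 divr_gt0// subr_gt0.
  split => [|i]; first by rewrite ge_min lexx.
  rewrite gt_min; apply/orP; right.
  have := coord_le_enorm x0 i; have := ler_norm (x0 0 i); move: x01; lra.
apply: (@lt_le_trans _ _ (c * (r' / 8) ^+ d)).
  by rewrite mulr_gt0// exprn_gt0// divr_gt0.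
rewrite -(@ulim_cst R (c * _)).
apply: (@ler_ulim _ _ _ (`|c * (r' / 8) ^+ d|) M) => // [N|]; first exact: gmean_bound.
have H : \forall N \near \oo, forall i : 'I_d, r' / 8 * N.+1%:R <=
    \sum_(k < N.+1) (`|-1 + (2 / N.+1%:R) * k%:R - x0 0 i| < r')%R%:R.
  apply: (@filter_forall _ 'I_d (fun i N => r' / 8 * N.+1%:R <=
    \sum_(k < N.+1) (`|-1 + (2 / N.+1%:R) * k%:R - x0 0 i| < r')%R%:R) \oo) => i.
  by have /andP[h1 h2] := xi i; apply: grid_count.
near=> N.
have HN : forall i : 'I_d, r' / 8 * N.+1%:R <=
    \sum_(k < N.+1) (`|-1 + (2 / N.+1%:R) * k%:R - x0 0 i| < r')%R%:R by near: N; exact: H.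
rewrite /gmean ler_pdivlMl ?exprn_gt0//.
pose b (i : 'I_d) (k : 'I_N.+1) : R := (`|-1 + (2 / N.+1%:R) * k%:R - x0 0 i| < r')%R%:R.
apply: (@le_trans _ _ (\sum_(k : {ffun 'I_d -> 'I_N.+1}) c * \prod_i b i (k i))); last first.
  apply: ler_sum => k _.
  case: (boolP [forall i, `|-1 + (2 / N.+1%:R) * (k i)%:R - x0 0 i| < r']) => [/forallP h|].
    rewrite big1 ?mulr1 => [|i _]; last by rewrite /b h.
    by apply: Fc => i; rewrite mxE (lt_le_trans (h i)).
  rewrite negb_forall => /existsP[i hi].
  by rewrite (bigD1 i)//= /b (negbTE hi) mul0r mulr0.
rewrite -mulr_sumr -bigA_distr_bigA /= mulrCA ler_pM2l// -exprMn mulrC.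
rewrite -[in leLHS](card_ord d) -prodr_const; apply: ler_prod => i _.
by rewrite HN mulr_ge0// divr_ge0// ltW.
Unshelve. all: by end_near. Qed.

Lemma compact_bounded_fun (R : realType) (T : topologicalType) (K : set T) (f : T -> R) :
  compact K -> (forall x, K x -> {for x, continuous f}) ->
  exists M : R, forall x, K x -> `|f x| <= M.
Proof.
move=> /compact_near_coveringP cK cf.
have : \forall M \near +oo, K `<=` (fun x => `|f x| <= M).
  apply: (cK _ _ (fun M x => `|f x| <= M)) => x Kx.
  exists ([set y | `|f x - f y| < 1], [set M | `|f x| + 1 < M]).
    split => /=; last exact: nbhs_pinfty_gt.
    by have /cvgrPdist_lt := cf x Kx; apply.
  move=> [y M] /= [h1 h2].
  have -> : f y = f x - (f x - f y) by ring.
  rewrite ltW// (le_lt_trans (ler_normB _ _))// (lt_trans _ h2)// ltrD2l.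
  exact: h1.
move=> [M [_ h]]; exists (M + 1) => x Kx.
by apply: h => //; rewrite ltrDl.
Qed.

Lemma is_derive_comp_scalar (R : realType) (V : normedModType R) (g : V -> R)
    (phi : R -> R) (x v : V) (D E : R) :
  is_derive x v g D -> is_derive (g x) 1 phi E ->
  is_derive x v (fun y => phi (g y)) (E * D).
Proof.
move=> [gd gD] Hp.
have HE : is_derive (0 : R) 1 (fun h : R => g (h *: v + x)) D.
  have E1 : (fun h : R => h^-1 *: (((fun h : R => g (h *: v + x)) \o shift 0) (h *: 1) - g ((0 : R) *: v + x)))
    = (fun h : R => h^-1 *: ((g \o shift x) (h *: v) - g x)).
    apply/funext => h /=; rewrite scale0r add0r; congr (_ *: (g _ - _)).
    by rewrite addr0 [_%:A]mulr1.
  by apply: DeriveDef; rewrite /derivable /derive E1.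
have Hp' : is_derive (g ((0 : R) *: v + x)) 1 phi E by rewrite scale0r add0r.
have [H1 H2] := @is_derive1_comp R phi (fun h : R => g (h *: v + x)) 0 E D Hp' HE.
have E2 : (fun h : R => h^-1 *: (((fun y => phi (g y)) \o shift x) (h *: v) - phi (g x))) =
   (fun h : R => h^-1 *: (((phi \o (fun h : R => g (h *: v + x))) \o shift 0) (h *: 1)
                         - (phi \o (fun h : R => g (h *: v + x))) 0)).
  by apply/funext => h /=; rewrite scale0r add0r addr0 [_%:A]mulr1.
by apply: DeriveDef; rewrite /derivable /derive E2.
Qed.

Lemma C1_comp (R : realType) (d : nat) U (g : 'rV[R]_d -> R) dg (phi dphi : R -> R) :
  C1 U g dg -> (forall t : R, is_derive t 1 phi (dphi t)) -> continuous dphi ->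
  C1 U (fun x => phi (g x)) (fun i x => dphi (g x) * dg i x).
Proof.
move=> Cg hphi cdphi x Ux; have [g0 g1] := Cg x Ux.
split.
  apply: (@continuous_comp _ _ _ g phi) => //.
  by apply/differentiable_continuous/derivable1_diffP; have [] := hphi (g x).
move=> i; have [g2 g3] := g1 i; split; first exact: is_derive_comp_scalar.
apply: continuousM => //.
by apply: (@continuous_comp _ _ _ g dphi) => //; exact: cdphi.
Qed.

Lemma is_derive_sqr_pos (R : realType) (s : R) :
  is_derive s 1 (fun t : R => Num.max 0 t ^+ 2) (2 * Num.max 0 s).
Proof.
have E : (fun h : R => h^-1 *: (((fun t : R => Num.max 0 t ^+ 2) \o shift s) (h *: 1) - Num.max 0 s ^+ 2)) @ 0^'
    --> (2 * Num.max 0 s : R).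
  apply/cvgrPdist_le => e e0; near=> h => /=.
  have h0 : h != 0 by near: h; exact: nbhs_dnbhs_neq.
  have he : `|h| <= e.
    near: h; apply: nbhs_dnbhs; apply/nbhs_ballP; exists e => //= h.
    by rewrite -ball_normE /= sub0r normrN => /ltW.
  apply: le_trans he.
  rewrite [_%:A]mulr1 -[_ *: _]/(_ * _).
  have hn : 0 < `|h| by rewrite normr_gt0.
  rewrite -(ler_pM2l hn) -normrM (_ : h * _ = 2 * h * Num.max 0 s - (Num.max 0 (h + s) ^+ 2 - Num.max 0 s ^+ 2)); last by field.
  rewrite (_ : `|h| * `|h| = h ^+ 2); last by rewrite -normrM ger0_norm// -expr2 sqr_ge0.
  have [s0|s0] := lerP s 0.
    have [sh|sh] := lerP (h + s) 0; first by rewrite !expr0n /= mulr0 !subrr normr0 sqr_ge0.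
    rewrite expr0n /= subr0 !mulr0 sub0r normrN ger0_norm ?sqr_ge0//; nra.
  have [sh|sh] := lerP (h + s) 0; first by rewrite ler_norml; apply/andP; split; nra.
  by rewrite ler_norml; apply/andP; split; nra.
by apply: DeriveDef; [apply/cvg_ex; eexists; exact: E|exact: cvg_lim E].
Unshelve. all: by end_near. Qed.

Lemma continuous_pos (R : realType) : continuous (fun t : R => 2 * Num.max 0 t).
Proof.
move=> t; apply: (@continuousM R R (fun=> 2) (fun t : R => Num.max 0 t) t); first exact: cst_continuous.
by apply: (@continuous_max R R (fun=> 0) id t); [exact: cst_continuous|exact: cvg_id].
Qed.

(** The product of the squared positive parts of t - a and b - t suffices, since only one continuous
    derivative of the cutoff is ever used. *)
Lemma C1_bump (R : realType) (a b : R) : a < b ->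
  exists P dP : R -> R, [/\ forall t : R, is_derive t 1 P (dP t), continuous dP,
    forall t, 0 <= P t, forall t, a < t -> t < b -> 0 < P t
    & forall t, t <= a \/ b <= t -> P t = 0 /\ dP t = 0].
Proof.
move=> ab.
pose p : R -> R := (fun t : R => Num.max 0 t ^+ 2); pose q : R -> R := (fun t : R => 2 * Num.max 0 t).
have pd (t : R) : is_derive t 1 (fun t : R => p (t - a)) (q (t - a)).
  have := @is_derive_comp_scalar R R (fun t : R => t - a) p t 1 1 (q (t - a)).
  rewrite mulr1; apply; last exact: is_derive_sqr_pos.
  by apply: is_derive_eq; rewrite subr0.
have pd' (t : R) : is_derive t 1 (fun t : R => p (b - t)) (- q (b - t)).
  have := @is_derive_comp_scalar R R (fun t : R => b - t) p t 1 (-1) (q (b - t)).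
  rewrite mulrN1; apply; last exact: is_derive_sqr_pos.
  have := @is_deriveB R R R (cst b) id t 1 0 1 (is_derive_cst b t 1) (is_derive_id t 1).
  by rewrite sub0r.
have cq t : {for t, continuous (fun t : R => q (t - a))}.
  apply: (@continuous_comp _ _ _ (fun t : R => t - a) q); last exact: continuous_pos.
  by apply: continuousB; [exact: cvg_id|exact: cst_continuous].
have cq' t : {for t, continuous (fun t : R => q (b - t))}.
  apply: (@continuous_comp _ _ _ (fun t : R => b - t) q); last exact: continuous_pos.
  by apply: continuousB; [exact: cst_continuous|exact: cvg_id].
have dc (f : R -> R) (df t : R) : is_derive t 1 f df -> {for t, continuous f}.
  by move=> [fd _]; apply/differentiable_continuous/derivable1_diffP.
exists (fun t => p (t - a) * p (b - t)).
exists (fun t => q (t - a) * p (b - t) - p (t - a) * q (b - t)).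
split.
- move=> t; apply: is_derive_eq (is_deriveM (pd t) (pd' t)) _.
  by rewrite -![_ *: _]/(_ * _); ring.
- move=> t.
  have h1 : {for t, continuous (fun t : R => q (t - a) * p (b - t))} := continuousM (cq t) (dc _ _ _ (pd' t)).
  have h2 : {for t, continuous (fun t : R => p (t - a) * q (b - t))} := continuousM (dc _ _ _ (pd t)) (cq' t).
  exact: (continuousB h1 h2).
- by move=> t; rewrite mulr_ge0 ?sqr_ge0.
- move=> t ta tb; rewrite mulr_gt0// /p exprn_gt0// lt_max ?subr_gt0 ?ta ?tb orbT//.
- move=> t [ta|tb]; rewrite /p /q.
    by rewrite (max_l (_ : t - a <= 0)) ?subr_le0// expr0n /= mulr0 !mul0r subr0.
  by rewrite (max_l (_ : b - t <= 0)) ?subr_le0// expr0n /= !mulr0 subr0.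
Qed.

Lemma MVT_neg (R : realType) (f df : R -> R) (s t : R) : s < t -> t < 0 -> (forall x : R, x < 0 -> is_derive x 1 f (df x)) ->
  exists c, [/\ s < c, c < t & f t - f s = df c * (t - s)].
Proof.
move=> st t0 fD.
have [x||c] := @MVT R f df s t st.
- by rewrite in_itv /= => /andP[_ xt]; apply: fD; exact: lt_trans t0.
- apply: derivable_within_continuous => x; rewrite in_itv /= => /andP[_ xt].
  by have [] := fD x (le_lt_trans xt t0).
by rewrite in_itv /= => /andP[sc ct] ->; exists c.
Qed.

Section sphere_mean.
Variables (R : realType) (d : nat).
Implicit Types (F G : 'rV[R]_d -> R).

Definition shell (a b : R) : set 'rV[R]_d := [set x | a <= enorm x <= b].

(* J plays the role of the mean over the unit sphere; its rotation invariance
   is expressed infinitesimally, by the last clause. *)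
Definition shell_mean (a b : R) (J : ('rV[R]_d -> R) -> R) : Prop :=
  [/\ forall F G (M : R), (forall x, shell a b x -> `|F x| <= M /\ `|G x| <= M) ->
        J (fun x => F x + G x) = J F + J G,
      forall (c : R) F (M : R), (forall x, shell a b x -> `|F x| <= M) ->
        J (fun x => c * F x) = c * J F,
      forall F G (M : R), (forall x, shell a b x -> `|F x| <= M /\ `|G x| <= M) ->
        (forall x, shell a b x -> F x <= G x) -> J F <= J G,
      J (fun=> 1) = 1
    & forall g dg (l : R), 0 < l -> l < 1 -> C1 (@uball R d) g dg -> forall i j,
        J (fun x => (l * x 0 i) * dg j (l *: x) - (l * x 0 j) * dg i (l *: x)) = 0].

Lemma C1_enorm2 U : C1 U (fun x : 'rV[R]_d => enorm x ^+ 2) (fun i x => 2 * x 0 i).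
Proof.
have H := @C1_sum R d U _ xpredT _ _ (fun k => C1M (@C1_coord R d U k) (@C1_coord R d U k)).
apply: C1_ext H => [x|i x].
  by rewrite sqr_enorm; apply: eq_bigr => i _; rewrite expr2.
rewrite (bigD1 i)//= big1 => [|k ki]; first by rewrite eqxx mul1r mulr1 addr0 -mulr2n mulr_natl.
by rewrite (negbTE ki) mul0r mulr0 addr0.
Qed.

Lemma C1_bounded (G : 'rV[R]_d -> R) dG (b : R) i : b < 1 -> C1 (@uball R d) G dG ->
  (forall x, b <= enorm x -> G x = 0 /\ dG i x = 0) ->
  exists M : R, forall x, `|G x| <= M /\ `|dG i x| <= M.
Proof.
move=> b1 CG Gb.
have sub (x : 'rV[R]_d) : enorm x <= b -> uball x by move=> h; apply: le_lt_trans h _.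
have [M1 H1] := @compact_bounded_fun R _ _ G (@compact_cball R d b) (fun x h => (CG x (sub x h)).1).
have [M2 H2] := @compact_bounded_fun R _ _ (dG i) (@compact_cball R d b)
  (fun x h => ((CG x (sub x h)).2 i).2).
exists (`|M1| + `|M2|) => x; have [h|h] := leP (enorm x) b.
  split; first by rewrite (le_trans (H1 x h))// (le_trans (ler_norm _))// lerDl.
  by rewrite (le_trans (H2 x h))// (le_trans (ler_norm _))// lerDr.
by have [-> ->] := Gb x (ltW h); rewrite normr0 addr_ge0.
Qed.

(** The functional is F |-> int(chi F) / int(chi), with a radial cutoff [chi] supported in the
    shell. Rotations annihilate [chi], so [chi * (x_i d_j g - x_j d_i g)] equals
    [d_j (chi x_i g) - d_i (chi x_j g)], a sum of partial derivatives of functions that vanish near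
    the boundary of the ball. *)
Lemma exists_shell_mean (a b : R) : (0 < d)%N -> 0 < a -> a < b -> b < 1 ->
  exists J, shell_mean a b J.
Proof.
move=> d0 a0 ab b1.
have b0 : 0 < b by exact: lt_trans ab.
have ab2 : a ^+ 2 < b ^+ 2 by rewrite ltr_pXn2r ?nnegrE ?ltW.
have [P [dP [Pd cdP P0 Ppos Pout]]] := C1_bump ab2.
pose chi (x : 'rV[R]_d) := P (enorm x ^+ 2).
pose dchi (i : 'I_d) (x : 'rV[R]_d) := dP (enorm x ^+ 2) * (2 * x 0 i).
have Cchi U : C1 U chi dchi by exact: C1_comp (@C1_enorm2 U) Pd cdP.
have out x : ~ shell a b x -> chi x = 0 /\ forall i, dchi i x = 0.
  move=> h; have [h1 h2] : P (enorm x ^+ 2) = 0 /\ dP (enorm x ^+ 2) = 0.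
    apply: Pout; rewrite !ler_pXn2r ?nnegrE ?enorm_ge0 ?(ltW a0) ?(ltW b0)//.
    have [?|h1] := leP (enorm x) a; first by left.
    have [?|h2] := leP b (enorm x); first by right.
    by exfalso; apply: h; rewrite /shell /= (ltW h1) (ltW h2).
  by split => // i; rewrite /dchi h2 mul0r.
have outb x : b <= enorm x -> chi x = 0 /\ forall i, dchi i x = 0.
  move=> h; have [h1 h2] : P (enorm x ^+ 2) = 0 /\ dP (enorm x ^+ 2) = 0.
    by apply: Pout; right; rewrite ler_pXn2r ?nnegrE ?enorm_ge0 ?(ltW b0).
  by split => // i; rewrite /dchi h2 mul0r.
have [C HC] : exists C : R, forall x, `|chi x| <= C.
  have [C H] := @C1_bounded chi dchi b (Ordinal d0) b1 (Cchi _) (fun x h => conj (outb x h).1 ((outb x h).2 _)).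
  by exists C => x; have [] := H x.
have C0 : 0 <= C by apply: le_trans (HC 0).
have chi0 x : 0 <= chi x by exact: P0.
have bnd F (M : R) : (forall x, shell a b x -> `|F x| <= M) -> forall x, `|chi x * F x| <= C * `|M|.
  move=> h x; case: (pselect (shell a b x)) => hx.
    by rewrite normrM ler_pM// (le_trans (h x hx))// ler_norm.
  by rewrite (out x hx).1 mul0r normr0 mulr_ge0.
have I0 : 0 < gint chi.
  pose m := (a + b) / 2; have am : a < m by rewrite /m; lra.
  have mb : m < b by rewrite /m; lra.
  have m0 : 0 < m by apply: lt_trans am.
  pose x0 : 'rV[R]_d := m *: delta_mx 0 (Ordinal d0).
  have ex0 : enorm x0 = m by rewrite /x0 enormZ enorm_delta mulr1 gtr0_norm.
  have cx0 : 0 < chi x0 by rewrite /chi ex0; apply: Ppos; rewrite ltr_pXn2r ?nnegrE ?ltW.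
  have [/cvgrPdist_lt c0 _] := Cchi setT x0 I.
  have h2 : 0 < chi x0 / 2 by rewrite divr_gt0.
  have /nbhs_ballP[r /= r0 rB] := c0 _ h2.
  apply: (@gint_gt0 R d chi C (chi x0 / 2) (r / 2) x0) => //; first by rewrite ex0 (lt_trans mb).
    by rewrite divr_gt0.
  move=> x hx; have /rB /= : ball x0 r x.
    rewrite -ball_normE /=; apply: (@le_lt_trans _ _ (r / 2)); last by move: r0; lra.
    apply: norm_le_coord => [|i]; first by rewrite divr_ge0// ltW.
    by have := hx i; rewrite -normrN opprB !mxE => /ltW.
  by have := ler_norm (chi x0 - chi x); lra.
exists (fun F => (gint chi)^-1 * gint (fun x => chi x * F x)); split.
- move=> F G M h; rewrite -mulrDr; congr (_ * _).
  rewrite -(@gintD R d _ _ (C * `|M|) (C * `|M|)); first last.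
  + by apply: bnd => x /h[].
  + by apply: bnd => x /h[].
  by congr gint; apply/funext => x; rewrite mulrDr.
- move=> c F M h; rewrite mulrCA; congr (_ * _).
  rewrite -(@gintZ R d c _ (C * `|M|)); last exact: bnd.
  by congr gint; apply/funext => x; rewrite mulrCA.
- move=> F G M h FG; rewrite ler_pM2l ?invr_gt0//.
  apply: (@ler_gint R d _ _ (C * `|M|) (C * `|M|)).
  + by apply: bnd => x /h[].
  + by apply: bnd => x /h[].
  move=> x; case: (pselect (shell a b x)) => hx; first by rewrite ler_wpM2l// FG.
  by rewrite (out x hx).1 !mul0r.
- rewrite (_ : (fun x => chi x * 1) = chi) ?mulVf ?gt_eqF//.
  by apply/funext => x; rewrite mulr1.
- move=> g dg l l0 l1 Cg i j; apply/eqP; rewrite mulf_eq0; apply/orP; right; apply/eqP.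
  have sub : @uball R d `<=` [set x | uball (l *: x)].
    move=> x; rewrite /uball /= enormZ gtr0_norm// => h.
    by apply: lt_trans l1; rewrite gtr_pMr.
  have Cgl := C1_sub sub (@C1_dilate R d _ _ _ l Cg).
  have CG k := C1M (Cchi (@uball R d)) (C1M (@C1_coord R d _ k) Cgl).
  pose dG k m x := dchi m x * (x 0 k * g (l *: x)) +
     chi x * ((k == m)%:R * g (l *: x) + x 0 k * (l * dg m (l *: x))).
  have dGb k m x : b <= enorm x -> chi x * (x 0 k * g (l *: x)) = 0 /\ dG k m x = 0.
    by move=> /outb[h1 h2]; rewrite /dG h1 h2 !mul0r addr0.
  have z1 := gint_pderiv b1 (CG i) (@dGb i j).
  have z2 := gint_pderiv b1 (CG j) (@dGb j i).
  have [M1 H1] := C1_bounded b1 (CG i) (@dGb i j).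
  have [M2 H2] := C1_bounded b1 (CG j) (@dGb j i).
  have -> : (fun x => chi x * (l * x 0 i * dg j (l *: x) - l * x 0 j * dg i (l *: x))) =
     (fun x => dG i j x + -1 * dG j i x).
    by apply/funext => x; rewrite /dG /dchi eq_sym; ring.
  rewrite (@gintD R d _ (fun x => -1 * dG j i x) M1 M2); first last.
  + by move=> x; rewrite mulN1r normrN; exact: (H2 x).2.
  + by move=> x; exact: (H1 x).2.
  rewrite (@gintZ R d (-1) _ M2); last by move=> x; exact: (H2 x).2.
  by rewrite z1 z2 mulr0 addr0.
Qed.

End sphere_mean.

Section shell_average.
Variables (R : realType) (d : nat) (a b : R) (J : ('rV[R]_d -> R) -> R).
Hypotheses (b1 : b < 1) (HJ : shell_mean a b J).
Implicit Types (F G g h : 'rV[R]_d -> R) (dg dh : 'I_d -> 'rV[R]_d -> R).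

Definition bounded_on_shell F := exists M : R, forall x, shell a b x -> `|F x| <= M.

Lemma shell_mean_eq F G : bounded_on_shell F ->
  (forall x, shell a b x -> F x = G x) -> J F = J G.
Proof.
move=> [M FM] FG; case: HJ => _ _ Jle _ _; apply/eqP; rewrite eq_le; apply/andP; split.
  by apply: (Jle _ _ M) => x sx; rewrite -?FG ?lexx ?FM.
by apply: (Jle _ _ M) => x sx; rewrite -?FG ?lexx ?FM.
Qed.

Lemma shell_mean_lin F G (c : R) : bounded_on_shell F -> bounded_on_shell G ->
  J (fun x => F x + c * G x) = J F + c * J G.
Proof.
move=> [M FM] [N GN]; case: HJ => Jadd JZ _ _ _.
rewrite -(JZ c G N GN) (Jadd F (fun x => c * G x) (`|M| + `|c| * `|N|))// => x sx.
have h1 := FM x sx; have h2 := GN x sx; have h3 := ler_norm M; have h4 := ler_norm N.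
have h5 : `|c| * `|G x| <= `|c| * `|N| by rewrite ler_wpM2l// (le_trans h2).
have h6 := normr_ge0 M; have h7 : 0 <= `|c| * `|N| by rewrite mulr_ge0.
by rewrite normrM; split; lra.
Qed.

Lemma shell_mean_cst (c : R) : J (fun=> c) = c.
Proof.
case: HJ => _ JZ _ J1 _.
rewrite (_ : (fun=> c) = (fun x : 'rV[R]_d => c * 1)); last by apply/funext => x; rewrite mulr1.
by rewrite (JZ c (fun=> 1) 1) ?J1 ?mulr1// => x _; rewrite normr1.
Qed.

Lemma shell_mean_bound F (M : R) : (forall x, shell a b x -> `|F x| <= M) -> `|J F| <= M.
Proof.
move=> FM; case: HJ => _ _ Jle _ _.
rewrite ler_norml -{1}(shell_mean_cst (- M)) -{2}(shell_mean_cst M).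
apply/andP; split; apply: (Jle _ _ `|M|) => x sx; rewrite ?normrN ?lexx ?(le_trans (FM x sx)) ?ler_norm//.
  by have := FM x sx; rewrite ler_norml => /andP[].
by have := FM x sx; rewrite ler_norml => /andP[].
Qed.

Definition cont g := forall x, @uball R d x -> {for x, continuous g}.

Lemma C1_cont g dg : C1 (@uball R d) g dg -> cont g.
Proof. by move=> Cg x /Cg[]. Qed.

Lemma C1_cont_partial g dg i : C1 (@uball R d) g dg -> cont (dg i).
Proof. by move=> Cg x /Cg[_ /(_ i)[]]. Qed.

Lemma contD g h : cont g -> cont h -> cont (fun x => g x + h x).
Proof. by move=> cg ch x Ux; apply: continuousD; [exact: cg|exact: ch]. Qed.

Lemma contM g h : cont g -> cont h -> cont (fun x => g x * h x).
Proof. by move=> cg ch x Ux; apply: continuousM; [exact: cg|exact: ch]. Qed.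

Lemma cont_sum n (F : 'I_n -> 'rV[R]_d -> R) : (forall i, cont (F i)) -> cont (fun x => \sum_i F i x).
Proof. by move=> cF x Ux; apply: continuous_bigsum => i; exact: cF. Qed.

Lemma cont_coord i : cont (fun x => x 0 i).
Proof. by move=> x _; exact: coord_continuous. Qed.

Lemma cont_euler g dg : C1 (@uball R d) g dg -> cont (euler dg).
Proof.
move=> Cg; apply: cont_sum => i; apply: contM; first exact: cont_coord.
exact: C1_cont_partial Cg.
Qed.

(** The dilated shell moves rigidly with t, all its spheres at once. Hence the derivative in t is
    given by the Euler field, exactly as for a single sphere. *)
Definition savg (t : R) g := J (fun x => g (expR t *: x)).

Lemma dilate_in (l : R) (x : 'rV[R]_d) : 0 < l -> shell a b x -> enorm (l *: x) <= l.
Proof.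
move=> l0 /andP[_ xb]; rewrite enormZ gtr0_norm// ger_pMr//.
by rewrite (le_trans xb) ?ltW.
Qed.

Lemma cont_bounded_on_shell g (l : R) : 0 < l -> l < 1 -> cont g ->
  bounded_on_shell (fun x => g (l *: x)).
Proof.
move=> l0 l1 cg.
have [M HM] := @compact_bounded_fun R _ _ g (@compact_cball R d l)
  (fun x (h : enorm x <= l) => cg x (le_lt_trans h l1)).
by exists M => x sx; apply: HM; exact: dilate_in.
Qed.

Lemma savg_eq t g h : t < 0 -> cont g -> (forall x, @uball R d x -> g x = h x) ->
  savg t g = savg t h.
Proof.
move=> t0 cg gh; have l1 : expR t < 1 by rewrite expR_lt1.
apply: shell_mean_eq; first exact: cont_bounded_on_shell (expR_gt0 t) l1 cg.
by move=> x sx; apply: gh; apply: le_lt_trans (dilate_in (expR_gt0 t) sx) l1.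
Qed.

Lemma savg_lin t g h (c : R) : t < 0 -> cont g -> cont h ->
  savg t (fun x => g x + c * h x) = savg t g + c * savg t h.
Proof.
move=> t0 cg ch; have l1 : expR t < 1 by rewrite expR_lt1.
by apply: shell_mean_lin; apply: cont_bounded_on_shell => //; exact: expR_gt0.
Qed.

Lemma savg0 t : t < 0 -> savg t (fun=> 0) = 0.
Proof.
move=> t0; have c0 : cont (fun=> 0) by move=> x _; exact: cst_continuous.
have := savg_lin (-1) t0 c0 c0; rewrite (_ : (fun x => 0 + -1 * 0) = (fun=> 0)); first by lra.
by apply/funext => x; rewrite mulr0 addr0.
Qed.

Lemma savg_sum t n (F : 'I_n -> 'rV[R]_d -> R) : t < 0 -> (forall i, cont (F i)) ->
  savg t (fun x => \sum_i F i x) = \sum_i savg t (F i).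
Proof.
move=> t0; elim: n F => [|n IH] F cF.
  rewrite big_ord0 -[RHS](savg0 t0); congr savg.
  by apply/funext => x; rewrite big_ord0.
rewrite big_ord_recl -IH => [|i]; last exact: cF.
rewrite -[X in _ = _ + X]mul1r -savg_lin//; last by apply: cont_sum => i; exact: cF.
by congr savg; apply/funext => x; rewrite big_ord_recl mul1r.
Qed.

Lemma savg_ge0 t g : t < 0 -> cont g -> (forall x, 0 <= g x) -> 0 <= savg t g.
Proof.
move=> t0 cg g0; have l1 : expR t < 1 by rewrite expR_lt1.
rewrite -(savg0 t0); case: HJ => _ _ Jle _ _.
have [M HM] := cont_bounded_on_shell (expR_gt0 t) l1 cg.
by apply: (Jle _ _ M) => // x sx; rewrite normr0 HM// (le_trans _ (HM x sx)).
Qed.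

Lemma savg_rot t g dg i j : t < 0 -> C1 (@uball R d) g dg ->
  savg t (fun x => x 0 i * dg j x - x 0 j * dg i x) = 0.
Proof.
move=> t0 Cg; case: HJ => _ _ _ _ /(_ g dg (expR t) (expR_gt0 t)); rewrite expR_lt1 => /(_ t0 Cg i j) H.
by rewrite -[RHS]H /savg; congr J; apply/funext => x; rewrite !mxE.
Qed.

(** Differentiation under [J]. As [J] is only known to be linear and monotone, the first-order
    expansion must be uniform over the shell, which [taylor1] on the closed ball of radius l
    provides. *)
Lemma is_derive_dilate_avg g dg (l : R) : 0 < l -> l < 1 -> C1 (@uball R d) g dg ->
  is_derive l 1 (fun l => J (fun x => g (l *: x))) (J (fun x => euler dg (l *: x)) / l).
Proof.
move=> l0 l1 Cg; have cg := C1_cont Cg; have ce := cont_euler Cg.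
set D := J _ / l.
have E : (fun h : R => h^-1 *: (((fun l => J (fun x => g (l *: x))) \o shift l) (h *: 1) - J (fun x => g (l *: x)))) @ 0^' --> D.
  apply/cvgrPdist_le => e e0.
  have sub : [set x | enorm x <= l] `<=` @uball R d by move=> x /= h; exact: le_lt_trans h l1.
  (* The error of [taylor1] is a sum over d coordinates, each at most 1 in modulus on the shell; the
     added 1 keeps the divisor positive for d = 0. *)
  have e'0 : 0 < e / (d%:R + 1) by rewrite divr_gt0// ltr_wpDl.
  have [dl dl0 H] := taylor1 (@open_uball_r R d 1) (@compact_cball R d l) sub Cg e'0.
  near=> h => /=.
  have h0 : h != 0 by near: h; exact: nbhs_dnbhs_neq.
  have hs : `|h| < Num.min dl (Num.min l (1 - l)).
    near: h; apply: nbhs_dnbhs; apply/nbhs_ballP; exists (Num.min dl (Num.min l (1 - l))) => /=.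
      by rewrite !lt_min dl0 l0 subr_gt0.
    by move=> h; rewrite -ball_normE /= sub0r normrN.
  move: hs; rewrite !lt_min => /and3P[hdl hl hl1].
  rewrite [_%:A]mulr1 -[_ *: _]/(_ * _).
  have lh0 : 0 < h + l by have := ler_norm (- h); rewrite normrN; lra.
  have lh1 : h + l < 1 by have := ler_norm h; lra.
  have bg := cont_bounded_on_shell lh0 lh1 cg.
  have bg' := cont_bounded_on_shell l0 l1 cg.
  have be := cont_bounded_on_shell l0 l1 ce.
  have bgg : bounded_on_shell (fun x => g ((h + l) *: x) + -1 * g (l *: x)).
    move: bg bg' => [M1 HM1] [M2 HM2]; exists (M1 + M2) => x sx.
    by rewrite mulN1r (le_trans (ler_normB _ _))// lerD ?HM1 ?HM2.
  have -> : D - h^-1 * (J (fun x => g ((h + l) *: x)) - J (fun x => g (l *: x))) =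
     - h^-1 * J (fun x => g ((h + l) *: x) + -1 * g (l *: x) + - (h / l) * euler dg (l *: x)).
    by rewrite !shell_mean_lin// /D; field; rewrite h0 gt_eqF.
  rewrite normrM normrN normfV ler_pdivrMl ?normr_gt0//.
  apply: shell_mean_bound => x sx.
  have xb i : `|x 0 i| <= 1.
    have /andP[_ xb] := sx; rewrite (le_trans (coord_le_enorm _ _))// (le_trans xb)// ltW//.
  have := H (l *: x) ((h + l) *: x) (dilate_in l0 sx).
  rewrite -scalerBl normrZ opprD addrCA subrr addr0 normrN.
  have xn : `|x| <= 1 by apply: norm_le_coord.
  move=> /(_ (le_lt_trans (ler_piMr (normr_ge0 h) xn) hdl)).
  have cE i : ((h + l) *: x) 0 i - (l *: x) 0 i = h * x 0 i by rewrite !mxE mulrDl addrK.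
  under eq_bigr do rewrite cE.
  under [in X in _ <= _ * X]eq_bigr do rewrite cE normrM.
  have -> : \sum_i h * x 0 i * dg i (l *: x) = (h / l) * euler dg (l *: x).
    rewrite /euler mulr_sumr; apply: eq_bigr => i _; rewrite mxE.
    by field; rewrite gt_eqF.
  rewrite mulN1r -mulNr => /le_trans; apply.
  rewrite -mulr_sumr mulrCA ler_wpM2l// -[leRHS](@divfK _ (d%:R + 1)); last first.
    by rewrite gt_eqF// ltr_wpDl.
  rewrite ler_wpM2l ?(ltW e'0)//.
  apply: (@le_trans _ _ (\sum_(i < d) 1)); first exact: ler_sum.
  by rewrite sumr_const card_ord lerDl.
by apply: DeriveDef; [apply/cvg_ex; eexists; exact: E|exact: cvg_lim E].
Unshelve. all: by end_near. Qed.

Lemma is_derive_savg (t : R) g dg : t < 0 -> C1 (@uball R d) g dg ->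
  is_derive t 1 (fun t : R => savg t g) (savg t (euler dg)).
Proof.
move=> t0 Cg; have l1 : expR t < 1 by rewrite expR_lt1.
have := is_derive_comp_scalar (is_derive_expR t) (is_derive_dilate_avg (expR_gt0 t) l1 Cg).
by rewrite divfK ?gt_eqF ?expR_gt0.
Qed.

Lemma savg_small g : cont g -> g 0 = 0 -> forall e : R, 0 < e ->
  exists2 t0 : R, t0 < 0 & forall t, t < t0 -> `|savg t g| <= e.
Proof.
move=> cg g0 e e0.
have := cg 0; rewrite /uball /= enorm0 => /(_ ltr01) /cvgrPdist_lt /(_ e e0).
move=> /nbhs_ballP[r /= r0 rB].
exists (Num.min (-1) (ln r)); first by rewrite gt_min ltrN10.
move=> t; rewrite lt_min => /andP[t1 tr].
apply: shell_mean_bound => x sx.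
have /rB /= : ball (0 : 'rV[R]_d) r (expR t *: x).
  rewrite -ball_normE /= sub0r normrN; apply: (@le_lt_trans _ _ (expR t)).
    apply: norm_le_coord => [|i]; first exact: expR_ge0.
    by rewrite (le_trans (coord_le_enorm _ _))// dilate_in// expR_gt0.
  by rewrite -[ltRHS](lnK _) ?posrE// ltr_expR.
by rewrite g0 sub0r normrN => /ltW.
Qed.

End shell_average.

(** * Logarithmic convexity of quadratic means *)

Section harmonic_average.
Variables (R : realType) (d : nat) (a b : R) (J : ('rV[R]_d -> R) -> R).
Hypotheses (b1 : b < 1) (HJ : shell_mean a b J).
Variables (u : 'rV[R]_d -> R) (du : 'I_d -> 'rV[R]_d -> R) (ddu : 'I_d -> 'I_d -> 'rV[R]_d -> R).
Hypotheses (Cu : C1 (@uball R d) u du) (Cdu : forall i, C1 (@uball R d) (du i) (ddu i)).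
Hypothesis harm : forall x, @uball R d x -> \sum_i ddu i i x = 0.
Hypothesis d2 : (2 <= d)%N.

Notation B := (@uball R d).
Notation E := (euler du).
Let dE (j : 'I_d) (x : 'rV[R]_d) := \sum_i ((i == j)%:R * du i x + x 0 i * ddu i j x).
Let L (i j : 'I_d) (x : 'rV[R]_d) := x 0 i * du j x - x 0 j * du i x.
Let dL (i j k : 'I_d) (x : 'rV[R]_d) := ((i == k)%:R * du j x + x 0 i * ddu j k x)
   - ((j == k)%:R * du i x + x 0 j * ddu i k x).
Let m : R := d%:R - 2.

Let CE : C1 B E dE.
Proof. by apply: C1_sum => i; apply: C1M; [exact: C1_coord|exact: Cdu]. Qed.

Let CL i j : C1 B (L i j) (dL i j).
Proof.
by apply: C1D; [|apply: C1N]; apply: C1M (Cdu _); exact: C1_coord.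
Qed.

Let sym i j x : B x -> ddu i j x = ddu j i x.
Proof. exact: (schwarz (@open_uball_r R d 1) Cu Cdu). Qed.

Let dE_E j x : dE j x = du j x + \sum_i x 0 i * ddu i j x.
Proof.
rewrite /dE big_split /=; congr (_ + _).
by rewrite (bigD1 j)//= eqxx mul1r big1 ?addr0// => i ij; rewrite (negbTE ij) mul0r.
Qed.

(** Dilations commute with rotations: E (L_ij u) = L_ij (E u), by the symmetry of the second
    derivatives. *)
Let EL i j x : B x -> euler (dL i j) x = x 0 i * dE j x - x 0 j * dE i x.
Proof.
move=> Bx; rewrite !dE_E /euler /dL.
transitivity (\sum_k (((i == k)%:R * x 0 k) * du j x + x 0 i * (x 0 k * ddu k j x)
    - (((j == k)%:R * x 0 k) * du i x + x 0 j * (x 0 k * ddu k i x)))).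
  by apply: eq_bigr => k _; rewrite (sym j k Bx) (sym i k Bx); ring.
have S (l : 'I_d) (c : R) : \sum_k (l == k)%:R * x 0 k * c = x 0 l * c.
  by rewrite (bigD1 l)//= eqxx mul1r big1 ?addr0// => k kl; rewrite eq_sym (negbTE kl) !mul0r.
by rewrite sumrB !big_split /= !S -!mulr_sumr !mulrDr.
Qed.

(** Over all ordered pairs, the sum of the squares of the rotations is the operator 2 (|x|^2
    Laplacian - E^2 - (d - 2) E), and the Laplacian of u vanishes. *)
Let trace_dL x : B x -> \sum_i \sum_j (x 0 i * dL i j j x - x 0 j * dL i j i x) =
   - 2 * (euler dE x + m * E x).
Proof.
move=> Bx.
pose e := \sum_i x 0 i * du i x; pose w := \sum_i \sum_j x 0 i * x 0 j * ddu i j x.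
have -> : E x = e by [].
have -> : euler dE x = e + w.
  rewrite /euler /e /w exchange_big /= -big_split /=; apply: eq_bigr => j _.
  rewrite dE_E mulrDr mulr_sumr; congr (_ + _); apply: eq_bigr => i _; ring.
have S (c : 'I_d -> 'I_d -> R) : \sum_i \sum_j (i == j)%:R * c i j = \sum_i c i i.
  apply: eq_bigr => i _; rewrite (bigD1 i)//= eqxx mul1r big1 ?addr0// => j ji.
  by rewrite eq_sym (negbTE ji) mul0r.
have H1 : \sum_i \sum_j x 0 i * dL i j j x = (1 - d%:R) * e - w.
  transitivity (\sum_i \sum_j ((i == j)%:R * (x 0 i * du j x) + (x 0 i ^+ 2 * ddu j j x
      - (x 0 i * du i x + x 0 i * x 0 j * ddu i j x)))).
    by apply: eq_bigr => i _; apply: eq_bigr => j _; rewrite /dL eqxx mul1r; ring.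
  under eq_bigr do rewrite big_split /= sumrB big_split /= -mulr_sumr harm// mulr0 sub0r.
  rewrite big_split /= S sumrN big_split /=.
  under [X in _ - (X + _)]eq_bigr do rewrite sumr_const card_ord -mulr_natl.
  by rewrite -mulr_sumr -/e -/w; ring.
have H2 : \sum_i \sum_j x 0 j * dL i j i x = (d%:R - 1) * e + w.
  transitivity (\sum_i \sum_j (x 0 j * du j x + x 0 i * x 0 j * ddu i j x - ((i == j)%:R * (x 0 j * du i x)
      + x 0 j ^+ 2 * ddu i i x))).
    apply: eq_bigr => i _; apply: eq_bigr => j _; rewrite /dL eqxx mul1r (sym j i Bx) [j == i]eq_sym; ring.
  under eq_bigr do rewrite sumrB !big_split /= -[X in _ - (_ + X)]mulr_suml.
  rewrite sumrB !big_split /= S -mulr_sumr harm// mulr0 addr0.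
  by rewrite sumr_const card_ord -mulr_natl -/e -/w; ring.
under eq_bigr do rewrite sumrB.
by rewrite sumrB H1 H2 /m; ring.
Qed.

Let cu : cont u. Proof. exact: C1_cont Cu. Qed.
Let cE : cont E. Proof. exact: C1_cont CE. Qed.
Let cEE : cont (euler dE). Proof. exact: cont_euler CE. Qed.

Notation A := (savg J).

(** The rotations L_ij applied to the products [g * L i j], summed. That its mean vanishes is
    integration by parts for the rotations. *)
Let rot (g : 'rV[R]_d -> R) (dg : 'I_d -> 'rV[R]_d -> R) (x : 'rV[R]_d) := \sum_i \sum_j (x 0 i * (dg j x * L i j x + g x * dL i j j x)
   - x 0 j * (dg i x * L i j x + g x * dL i j i x)).

Let cont_rot_term g dg i j : C1 B g dg -> cont (fun x => x 0 i * (dg j x * L i j x + g x * dL i j j x)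
   - x 0 j * (dg i x * L i j x + g x * dL i j i x)).
Proof.
move=> Cg x Bx; have CM := C1M Cg (@CL i j).
by apply: continuousB; apply: continuousM; try exact: coord_continuous; exact: (C1_cont_partial CM).
Qed.

Let cont_rot g dg : C1 B g dg -> cont (rot g dg).
Proof. by move=> Cg; apply: cont_sum => i; apply: cont_sum => j; exact: cont_rot_term. Qed.

Let savg_rot_sum g dg t : t < 0 -> C1 B g dg -> A t (rot g dg) = 0.
Proof.
move=> t0 Cg; rewrite (savg_sum b1 HJ)// => [|i].
  rewrite big1// => i _; rewrite (savg_sum b1 HJ)// => [|j]; last exact: cont_rot_term.
  by rewrite big1// => j _; exact: (savg_rot HJ i j t0 (C1M Cg (@CL i j))).
by apply: cont_sum => j; exact: cont_rot_term.
Qed.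

Let rot_u x : B x -> rot u du x =
  \sum_i \sum_j (L i j x * L i j x) + u x * (-2 * (euler dE x + m * E x)).
Proof.
move=> Bx; rewrite /rot -trace_dL// mulr_sumr -big_split; apply: eq_bigr => i _ /=.
by rewrite mulr_sumr -big_split; apply: eq_bigr => j _ /=; rewrite /L; ring.
Qed.

Let rot_E x : B x -> rot E dE x =
  \sum_i \sum_j (L i j x * euler (dL i j) x) + E x * (-2 * (euler dE x + m * E x)).
Proof.
move=> Bx; rewrite /rot -trace_dL// mulr_sumr -big_split; apply: eq_bigr => i _ /=.
by rewrite mulr_sumr -big_split; apply: eq_bigr => j _ /=; rewrite EL//; ring.
Qed.

(** Subtracting [rot u du], which has mean zero, leaves 2 u E^2 u - 2 (E u)^2; thus the virial
    relation amounts to the vanishing of the mean of [q]. *)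
Let q x := \sum_i \sum_j (L i j x * L i j x) + ((-2) * (E x * E x) + (-2 * m) * (u x * E x)).

Let Cq : exists dq, C1 B q dq /\ forall x, euler dq x =
   \sum_i \sum_j (2 * L i j x * euler (dL i j) x) + ((-4) * (E x * euler dE x)
     + (-2 * m) * (euler du x * E x + u x * euler dE x)).
Proof.
have C := C1D (C1_sum xpredT (fun i : 'I_d => C1_sum xpredT (fun j : 'I_d => C1M (@CL i j) (@CL i j))))
  (C1D (@C1Z _ _ _ _ _ (-2) (C1M CE CE)) (@C1Z _ _ _ _ _ (-2 * m) (C1M Cu CE))).
eexists; split; first exact: C.
move=> x; rewrite /euler /=.
rewrite (eq_bigr (fun k => \sum_i \sum_j (2 * L i j x * (x 0 k * dL i j k x)) +
   ((-4 * E x) * (x 0 k * dE k x) + ((-2 * m * E x) * (x 0 k * du k x) + (-2 * m * u x) * (x 0 k * dE k x))))); last first.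
  move=> k _; rewrite mulrDr; congr (_ + _); last by rewrite /E; ring.
  rewrite mulr_sumr; apply: eq_bigr => i _; rewrite mulr_sumr; apply: eq_bigr => j _; ring.
rewrite !big_split /= -!mulr_sumr; congr (_ + _); last by rewrite /E /euler; ring.
rewrite exchange_big; apply: eq_bigr => i _; rewrite exchange_big; apply: eq_bigr => j _.
by rewrite mulr_sumr.
Qed.

(** The identity E q + m q = m [rot u du] + 2 [rot E dE] shows that the mean Q of [q] satisfies Q' =
    - m Q, so e^{mt} Q is constant. It tends to 0 at -oo, because [q 0 = 0] and e^{mt} <= 1 there;
    the latter is m >= 0, that is d >= 2. *)
Let savg_q t : t < 0 -> A t q = 0.
Proof.
have [dq [Cdq dqE]] := Cq.
have D (s : R) : s < 0 -> is_derive (s : R) 1 (fun s : R => A s q) (- m * A s q).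
  move=> s0; have H := is_derive_savg b1 HJ s0 Cdq.
  suff Z : A s (euler dq) + m * A s q = 0 by apply: is_derive_eq H _; lra.
  have z1 := savg_rot_sum s0 Cu; have z2 := savg_rot_sum s0 CE.
  rewrite -(savg_lin b1 HJ)//; [|exact: cont_euler Cdq|exact: C1_cont Cdq].
  have ccst (c : R) : cont (fun _ : 'rV[R]_d => c) by move=> x _; exact: cst_continuous.
  have c1 := cont_rot Cu; have c2 := cont_rot CE.
  have z3 : A s (fun x => 0 + m * rot u du x + 2 * rot E dE x) = 0.
    rewrite (savg_lin b1 HJ)//; last by apply: contD => //; exact: contM.
    by rewrite (savg_lin b1 HJ)// (savg0 b1 HJ)// z1 z2 !mulr0 !addr0.
  rewrite -[RHS]z3; apply: (savg_eq b1 HJ) => //.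
    apply: contD; first exact: cont_euler Cdq.
    by apply: contM => //; exact: C1_cont Cdq.
  move=> x Bx; rewrite dqE /q rot_u// rot_E//.
  under eq_bigr do under eq_bigr do rewrite -mulrA.
  under eq_bigr do rewrite -mulr_sumr.
  rewrite -mulr_sumr; ring.
move=> t0.
have m0 : 0 <= m by rewrite subr_ge0 ler_nat.
pose f (s : R) := expR (m * s) * A s q.
have fD (s : R) : s < 0 -> is_derive s 1 f 0.
  move=> s0; have D1 := D s s0.
  have D2 : is_derive s 1 (fun s : R => expR (m * s)) (expR (m * s) * m).
    apply: is_derive_comp_scalar.
    by apply: is_derive_eq (@is_deriveZ R R R id m s 1 1 (is_derive_id s 1)) _; rewrite [_%:A]mulr1.
  by apply: is_derive_eq (is_deriveM D2 D1) _; rewrite -![_ *: _]/(_ * _); ring.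
have fc (s : R) : s < t -> f s = f t.
  move=> st; have [c [_ _ /eqP]] := MVT_neg st t0 fD.
  by rewrite mul0r subr_eq0 => /eqP.
suff : f t = 0 by move/eqP; rewrite mulf_eq0 gt_eqF ?expR_gt0//= => /eqP.
apply/eqP; rewrite -normr_le0; apply/ler_addgt0Pr => e e0; rewrite add0r.
have q0 : q 0 = 0.
  have E0 : E 0 = 0 by rewrite /euler big1// => i _; rewrite mxE mul0r.
  rewrite /q E0 !mulr0 !addr0 big1// => i _; rewrite big1// => j _.
  by rewrite /L !mxE !mul0r subrr mul0r.
have [s1 s10 Hs] := savg_small b1 HJ (C1_cont Cdq) q0 e0.
pose s := Num.min s1 t - 1.
have s_s1 : s < s1 by rewrite /s ltrBlDr (le_lt_trans (_ : _ <= s1)) ?ge_min ?lexx// ltrDl.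
have st : s < t by rewrite /s ltrBlDr (le_lt_trans (_ : _ <= t)) ?ge_min ?lexx ?orbT// ltrDl.
rewrite -(fc s st) /f normrM (le_trans _ (Hs s s_s1))// ler_piMl// ger0_norm ?expR_ge0//.
by rewrite -expR0 ler_expR mulr_ge0_le0// ltW// (lt_trans st).
Qed.

(* Spectrally: if u is a sum of spherical harmonics of degree k with weights h_k,
   both sides are the sum of the k^2 h_k e^{2kt}. *)
Lemma savg_virial t : t < 0 ->
  savg J t (fun x => u x * euler dE x) = savg J t (fun x => E x * E x).
Proof.
move=> t0; have z1 := savg_rot_sum t0 Cu; have zq := savg_q t0.
have [dq [Cdq _]] := Cq; have cq := C1_cont Cdq; have cr := cont_rot Cu.
have c1 : cont (fun x => u x * euler dE x) by apply: contM.
have c2 : cont (fun x => E x * E x) by apply: contM.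
have : A t (fun x => q x + -1 * rot u du x) = 0 by rewrite (savg_lin b1 HJ)// zq z1 mulr0 addr0.
have -> : A t (fun x => q x + -1 * rot u du x) =
   A t (fun x => 2 * (u x * euler dE x) + -2 * (E x * E x)).
  apply: (savg_eq b1 HJ) => //.
    by apply: contD => //; apply: contM => // x _; exact: cst_continuous.
  by move=> x Bx; rewrite rot_u// /q; ring.
have c0 : cont (fun _ : 'rV[R]_d => 0 : R) by move=> x _; exact: cst_continuous.
rewrite (savg_lin b1 HJ)//; last by apply: contM => // x _; exact: cst_continuous.
have -> : A t (fun x => 2 * (u x * euler dE x)) = 2 * A t (fun x => u x * euler dE x).
  rewrite -[RHS]add0r -[X in X + _](savg0 b1 HJ t0) -(savg_lin b1 HJ)//.
  by congr savg; apply/funext => x; rewrite add0r.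
by move=> H; lra.
Qed.

Lemma is_derive_savg_sqr (t : R) : t < 0 ->
  is_derive t 1 (fun t : R => savg J t (fun x => u x * u x)) (2 * savg J t (fun x => u x * E x)).
Proof.
move=> t0; have c0 : cont (fun _ : 'rV[R]_d => 0 : R) by move=> x _; exact: cst_continuous.
apply: is_derive_eq (is_derive_savg b1 HJ t0 (C1M Cu Cu)) _.
rewrite -[RHS]add0r -[X in X + _](savg0 b1 HJ t0) -(savg_lin b1 HJ)//; last exact: contM.
congr savg; apply/funext => x; rewrite /euler add0r mulrA mulr_sumr; apply: eq_bigr => i _; ring.
Qed.

(** The derivative of the mean of u E u is the sum of the means of (E u)^2 and u E^2 u, which the
    virial relation makes equal. *)
Lemma is_derive_savg_euler (t : R) : t < 0 ->
  is_derive t 1 (fun t : R => 2 * savg J t (fun x => u x * E x)) (4 * savg J t (fun x => E x * E x)).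
Proof.
move=> t0; have H := is_derive_savg b1 HJ t0 (C1M Cu CE).
have := @is_deriveZ R R R _ 2 t 1 _ H; move/is_derive_eq; apply.
rewrite -[_ *: _]/(_ * _).
have -> : euler (fun i x => du i x * E x + u x * dE i x) = (fun x => E x * E x + 1 * (u x * euler dE x)).
  apply/funext => x; rewrite mul1r /E /euler mulr_suml mulr_sumr -big_split; apply: eq_bigr => i _ /=.
  by ring.
rewrite (savg_lin b1 HJ)//; [|exact: contM|exact: contM].
by rewrite savg_virial//; ring.
Qed.

End harmonic_average.

Section convexity.
Variable R : realType.
Implicit Types f df : R -> R.

Lemma convex_of_derive2 f df ddf : (forall x : R, x < 0 -> is_derive x 1 f (df x)) ->
  (forall x : R, x < 0 -> is_derive x 1 df (ddf x)) -> (forall x, x < 0 -> 0 <= ddf x) ->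
  forall x y l, x < 0 -> y < 0 -> 0 <= l -> l <= 1 ->
    f (l * x + (1 - l) * y) <= l * f x + (1 - l) * f y.
Proof.
move=> fD dfD dd0.
have dfm s t : s <= t -> t < 0 -> df s <= df t.
  rewrite le_eqVlt => /predU1P[->//|st] t0.
  have [c [sc ct E]] := MVT_neg st t0 dfD.
  by rewrite -subr_ge0 E mulr_ge0 ?dd0 ?subr_ge0 ?(ltW st)//; exact: lt_trans t0.
suff H x y l : x < y -> y < 0 -> 0 < l -> l < 1 -> f (l * x + (1 - l) * y) <= l * f x + (1 - l) * f y.
  move=> x y l x0 y0; rewrite le_eqVlt => /predU1P[<- _|l0].
    by rewrite subr0 !mul0r !mul1r !add0r.
  rewrite le_eqVlt => /predU1P[->|l1]; first by rewrite subrr !mul0r !mul1r !addr0.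
  have [xy|yx|->] := ltgtP x y; first exact: H.
    have := H y x (1 - l) yx x0; rewrite subr_gt0 => /(_ l1); rewrite gtrBl => /(_ l0).
    by rewrite opprB addrCA subrr addr0 addrC [leRHS]addrC.
  by rewrite -!mulrDl addrCA subrr addr0 !mul1r.
move=> xy y0 l0 l1; set z := l * x + _.
have xz : x < z by rewrite /z; nra.
have zy : z < y by rewrite /z; nra.
have [c1 [xc1 c1z E1]] := MVT_neg xz (lt_trans zy y0) fD.
have [c2 [zc2 c2y E2]] := MVT_neg zy y0 fD.
have c12 : df c1 <= df c2 by apply: dfm; [rewrite ltW// (lt_trans c1z)|exact: lt_trans y0].
rewrite -subr_ge0.
have -> : l * f x + (1 - l) * f y - f z = (1 - l) * (f y - f z) - l * (f z - f x) by ring.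
rewrite E1 E2.
have -> : (1 - l) * (df c2 * (y - z)) - l * (df c1 * (z - x)) = l * (1 - l) * (y - x) * (df c2 - df c1).
  by rewrite /z; ring.
by rewrite !mulr_ge0 ?subr_ge0// ltW.
Qed.

Lemma ln_convex_of_derive (H H1 H2 : R -> R) :
  (forall t : R, t < 0 -> is_derive t 1 H (H1 t)) -> (forall t : R, t < 0 -> is_derive t 1 H1 (H2 t)) ->
  (forall t, t < 0 -> 0 < H t) -> (forall t, t < 0 -> H1 t ^+ 2 <= H t * H2 t) ->
  forall x y l, x < 0 -> y < 0 -> 0 <= l -> l <= 1 ->
    ln (H (l * x + (1 - l) * y)) <= l * ln (H x) + (1 - l) * ln (H y).
Proof.
move=> D1 D2 H0 CS.
apply: (@convex_of_derive2 (fun t => ln (H t)) (fun t => (H t)^-1 * H1 t)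
   (fun t => (H t)^-1 * H2 t - (H t)^- 2 * H1 t * H1 t)) => t t0.
- exact: is_derive_comp_scalar (D1 t t0) (is_derive1_ln (H0 t t0)).
- have Hn : H t != 0 by rewrite gt_eqF ?H0.
  have DV := is_deriveV Hn (D1 t t0).
  have := is_deriveM DV (D2 t t0); move/is_derive_eq; apply.
  by rewrite -![_ *: _]/(_ * _); ring.
- have h := H0 t t0.
  rewrite (_ : _ - _ = (H t)^- 2 * (H t * H2 t - H1 t ^+ 2)); last by field; rewrite gt_eqF.
  by rewrite mulr_ge0 ?invr_ge0 ?sqr_ge0// subr_ge0 CS.
Qed.

(** If f dropped from x to y, convexity would make it grow at least linearly to the left of x,
    against the bound near -oo. *)
Lemma nondecreasing_of_convex f (M t0 : R) :
  (forall x y l, x < 0 -> y < 0 -> 0 <= l -> l <= 1 ->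
    f (l * x + (1 - l) * y) <= l * f x + (1 - l) * f y) ->
  (forall t, t < t0 -> f t <= M) -> forall x y, x <= y -> y < 0 -> f x <= f y.
Proof.
move=> cf fM x y; rewrite le_eqVlt => /predU1P[->//|xy] y0.
rewrite leNgt; apply/negP => fxy.
have d0 : 0 < f x - f y by rewrite subr_gt0.
have yx0 : 0 < y - x by rewrite subr_gt0.
(* Chosen so that [x - k * (y - x)] lies to the left of [t0] and the chord through x and y, extended
   to that point, has a value above M. *)
pose k := Num.max 1 (Num.max ((x - t0 + 1) / (y - x)) ((M - f x + 1) / (f x - f y))).
have k1 : 1 <= k by rewrite le_max lexx.
have k2 : x - t0 + 1 <= k * (y - x) by rewrite -ler_pdivrMr// !le_max lexx !orbT.
have k3 : M - f x + 1 <= k * (f x - f y) by rewrite -ler_pdivrMr// !le_max lexx !orbT.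
have k0 : 0 < k + 1 by lra.
pose z := x - k * (y - x).
have zx : z < x by rewrite /z; nra.
have := cf z y (k + 1)^-1 (lt_trans zx (lt_trans xy y0)) y0.
rewrite invr_ge0 (ltW k0) invf_le1// => /(_ isT).
have -> : (1 <= k + 1) = true by apply/idP; lra.
have -> : (k + 1)^-1 * z + (1 - (k + 1)^-1) * y = x by rewrite /z; field; rewrite gt_eqF.
have -> : (k + 1)^-1 * f z + (1 - (k + 1)^-1) * f y = (f z + k * f y) / (k + 1) by field; rewrite gt_eqF.
rewrite ler_pdivlMr// => /(_ isT) h.
have : f z <= M by apply: fM; rewrite /z; lra.
by lra.
Qed.

End convexity.

Section harmonic_family.
Variables (R : realType) (d n : nat) (f : 'I_n -> 'rV[R]_d -> R).
Hypothesis hf : forall j, harmonic_on (@uball R d) (f j).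
Hypothesis d2 : (2 <= d)%N.

Let du j i := pderiv i (f j).
Let ddu j i k := pderiv k (pderiv i (f j)).

Lemma harmonic_C1 j : C1 (@uball R d) (f j) (du j).
Proof.
move=> x Ux; have [C2 _] := hf j; have [h1 h2] := C2 x Ux; split => // i.
by have [h3 h4 _] := h2 i; split => //; exact: derivableP.
Qed.

Lemma harmonic_C1_pderiv j i : C1 (@uball R d) (du j i) (ddu j i).
Proof.
move=> x Ux; have [C2 _] := hf j; have [h1 h2] := C2 x Ux.
have [h3 h4 h5] := h2 i; split => // k.
by have [h6 h7] := h5 k; split => //; exact: derivableP.
Qed.

Let S (x : 'rV[R]_d) := \sum_j f j x * f j x.

Lemma cont_sum_sqr : cont S.
Proof. by apply: cont_sum => j; apply: contM; exact: C1_cont (harmonic_C1 j). Qed.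

Variables (a b : R) (J : ('rV[R]_d -> R) -> R).
Hypotheses (b1 : b < 1) (HJ : shell_mean a b J).

Let E j := euler (du j).
Let cf j : cont (f j). Proof. exact: C1_cont (harmonic_C1 j). Qed.
Let cE j : cont (E j). Proof. exact: cont_euler (harmonic_C1 j). Qed.

Lemma ln_savg_convex : (forall t, t < 0 -> 0 < savg J t S) ->
  forall x y l, x < 0 -> y < 0 -> 0 <= l -> l <= 1 ->
    ln (savg J (l * x + (1 - l) * y) S) <= l * ln (savg J x S) + (1 - l) * ln (savg J y S).
Proof.
pose H t := \sum_j savg J t (fun x => f j x * f j x).
pose P t := \sum_j savg J t (fun x => f j x * E j x).
pose D t := \sum_j savg J t (fun x => E j x * E j x).
have HS t : t < 0 -> savg J t S = H t.
  by move=> t0; rewrite /S (savg_sum b1 HJ)// => j; exact: contM.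
move=> S0 x y l x0 y0 l0 l1.
have z0 : l * x + (1 - l) * y < 0.
  have [->|lp] := eqVneq l 0; first by rewrite mul0r add0r subr0 mul1r.
  have l00 : 0 < l by rewrite lt_neqAle eq_sym lp.
  by nra.
rewrite !HS//; move: x y l x0 y0 l0 l1 {z0}.
apply: (@ln_convex_of_derive R H (fun t => 2 * P t) (fun t => 4 * D t)).
- move=> t t0.
  have -> : H = \sum_j (fun t => savg J t (fun x => f j x * f j x)).
    by apply/funext => s; rewrite fct_sumE.
  rewrite /P mulr_sumr; apply: is_derive_sum => j.
  apply: (is_derive_savg_sqr b1 HJ (harmonic_C1 j) (harmonic_C1_pderiv j)) => //.
- move=> t t0.
  have -> : (fun t => 2 * P t) = \sum_j (fun t => 2 * savg J t (fun x => f j x * E j x)).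
    by apply/funext => s; rewrite fct_sumE mulr_sumr.
  rewrite /D mulr_sumr; apply: is_derive_sum => j.
  apply: (is_derive_savg_euler b1 HJ (harmonic_C1 j) (harmonic_C1_pderiv j)) => //.
  by have [_ h] := hf j.
- by move=> t t0; rewrite -HS// S0.
move=> t t0.
have H0 : 0 < H t by rewrite -HS// S0.
(* Cauchy-Schwarz for the whole family at once: the means of (P f_j - H E_j)^2 add up to H (H D -
   P^2). *)
have : 0 <= \sum_j (P t ^+ 2 * savg J t (fun x => f j x * f j x)
     + (- 2 * P t * H t) * savg J t (fun x => f j x * E j x) + H t ^+ 2 * savg J t (fun x => E j x * E j x)).
  apply: sumr_ge0 => j _.
  have c0 : cont (fun _ : 'rV[R]_d => 0 : R) by move=> x _; exact: cst_continuous.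
  have c1 : cont (fun x => f j x * f j x) by exact: contM.
  have c2 : cont (fun x => f j x * E j x) by exact: contM.
  have c3 : cont (fun x => E j x * E j x) by exact: contM.
  have cc (c : R) (g : 'rV[R]_d -> R) : cont g -> cont (fun x => c * g x).
    by move=> cg; apply: contM => // x _; exact: cst_continuous.
  have -> : P t ^+ 2 * savg J t (fun x => f j x * f j x) = savg J t (fun x => 0 + P t ^+ 2 * (f j x * f j x)).
    by rewrite (savg_lin b1 HJ)// (savg0 b1 HJ)// add0r.
  rewrite -!(savg_lin b1 HJ)//; first last.
  + by apply: contD => //; exact: cc.
  + by apply: contD; [|exact: cc]; apply: contD => //; exact: cc.
  apply: (savg_ge0 b1 HJ) => //.
  + by apply: contD; [|exact: cc]; apply: contD; [|exact: cc]; apply: contD => //; exact: cc.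
  + move=> x; rewrite (_ : _ + _ = (P t * f j x - H t * E j x) ^+ 2) ?sqr_ge0//; ring.
rewrite !big_split /= -!mulr_sumr -/(H t) -/(P t) -/(D t).
rewrite (_ : _ + _ = H t * (H t * D t - P t ^+ 2)); last by ring.
by rewrite pmulr_rge0// subr_ge0 => h; lra.
Qed.

End harmonic_family.

(** * From an approximating family to a log-convex weight *)

Section approximable_log_convex.
Variable R : realType.

Lemma ulim_le_cst (u : nat -> R) (M c : R) : (forall n, `|u n| <= M) -> (forall n, u n <= c) -> ulim u <= c.
Proof.
move=> uM uc; rewrite -[leRHS]ulim_cst; apply: (@ler_ulim R u _ M `|c|) => //.
by near=> n; exact: uc.
Unshelve. all: by end_near. Qed.

Lemma ulim_dist (u v : nat -> R) (M M' e : R) : (forall n, `|u n| <= M) -> (forall n, `|v n| <= M') ->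
  (forall n, `|u n - v n| <= e) -> `|ulim u - ulim v| <= e.
Proof.
move=> uM vM uv.
have he (w1 w2 : nat -> R) (N1 N2 : R) : (forall n, `|w1 n| <= N1) -> (forall n, `|w2 n| <= N2) ->
    (forall n, `|w1 n - w2 n| <= e) -> ulim w1 <= ulim w2 + e.
  move=> h1 h2 h3.
  rewrite -[e in leRHS]ulim_cst -(@ulimD R w2 (fun=> e) N2 `|e|)//.
  apply: (@ler_ulim R w1 _ N1 (N2 + `|e|)) => // [n|].
    by rewrite (le_trans (ler_normD _ _))// lerD.
  by near=> n; have := le_trans (ler_norm _) (h3 n); rewrite lerBlDl addrC.
have h1 := he u v M M' uM vM uv.
have h2 : ulim v <= ulim u + e by apply: he vM uM _ => n; rewrite distrC.
by rewrite ler_norml; apply/andP; split; lra.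
Unshelve. all: by end_near. Qed.

Lemma ln_dist (x y c : R) : 0 < c -> c <= x -> c <= y -> `|ln x - ln y| <= `|x - y| / c.
Proof.
move=> c0 cx cy.
have he (s t : R) : c <= s -> c <= t -> ln s - ln t <= `|s - t| / c.
  move=> cs ct; have t0 : 0 < t by apply: lt_le_trans ct.
  have s0 : 0 < s by apply: lt_le_trans cs.
  rewrite -ln_div ?posrE//.
  apply: (@le_trans _ _ (s / t - 1)).
    by have := @le_ln1Dx R (s / t - 1); rewrite addrCA subrr addr0; apply; rewrite ltrBrDl subrr divr_gt0.
  rewrite (_ : s / t - 1 = (s - t) / t); last by field; rewrite gt_eqF.
  apply: (@le_trans _ _ (`|s - t| / t)); first by rewrite ler_pM2r ?invr_gt0// ler_norm.
  by rewrite ler_wpM2l// lef_pV2 ?posrE.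
by rewrite ler_norml; have := he x y cx cy; have := he y x cy cx; rewrite (distrC y); lra.
Qed.

Lemma within_continuousP (A : set R) (w : R -> R) : {within A, continuous w} <->
  forall x, A x -> forall e : R, 0 < e -> exists2 dl : R, 0 < dl &
    forall y, A y -> `|x - y| < dl -> `|w x - w y| < e.
Proof.
rewrite subspace_continuousP; split => [cw x Ax e e0|H x Ax].
  have /cvgrPdist_lt /(_ e e0) /nbhs_ballP[dl /= dl0 h] := cw x Ax.
  by exists dl => // y Ay xy; apply: h => //; rewrite -ball_normE.
apply/cvgrPdist_lt => e e0; have [dl dl0 h] := H x Ax e e0.
by apply/nbhs_ballP; exists dl => // y; rewrite -ball_normE /= => xy Ay; exact: h.
Qed.

(** The mean [hh k r] lies between multiples of the squares of [w (r * aa k)] and [w r]. As [aa k]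
    tends to 1, continuity of [w] at r recovers [w r ^+ 2] on both sides. The limit is that of
    [ln (hh k r)], so that convexity in ln r survives, and the division by 2 in [v] undoes the
    square. *)
Lemma approximable_log_convex (d : nat) (w : R -> R) : (2 <= d)%N -> is_weight w ->
  harmonically_approximable d w -> equiv_log_convex_weight w.
Proof.
move=> d2 [w0 wm cw wub] [n [f [hf [C1 [C2 [C10 C20 HC]]]]]].
have d0 : (0 < d)%N by exact: leq_trans d2.
pose S (x : 'rV[R]_d) := \sum_j f j x * f j x.
have cS : cont S := cont_sum_sqr hf.
(* The factor n comes from Cauchy-Schwarz, (sum of |f_j|)^2 <= n S; [n.+1] avoids a zero divisor. *)
pose k1 : R := (C2 ^+ 2 * n.+1%:R)^-1; pose k2 : R := (C1 ^- 2).
have k10 : 0 < k1 by rewrite invr_gt0 mulr_gt0// exprn_gt0.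
have k20 : 0 < k2 by rewrite invr_gt0 exprn_gt0.
have sqle (x y : R) : 0 <= x -> x <= y -> x ^+ 2 <= y ^+ 2.
  by move=> x0 xy; rewrite ler_pXn2r ?nnegrE// (le_trans x0).
have Sb x : enorm x < 1 -> k1 * w (enorm x) ^+ 2 <= S x <= k2 * w (enorm x) ^+ 2.
  move=> x1; have [h1 h2] := HC x x1.
  have wx : 0 < w (enorm x) by rewrite w0 ?enorm_ge0.
  set s := \sum_j `|f j x| in h1 h2.
  have s0 : 0 <= s by rewrite sumr_ge0.
  have Ss : S x <= s ^+ 2.
    rewrite /S /s expr2 mulr_suml; apply: ler_sum => i _.
    rewrite (_ : f i x * f i x = `|f i x| * `|f i x|); last first.
      by rewrite -normrM ger0_norm// -expr2 sqr_ge0.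
    by rewrite ler_wpM2l// (bigD1 i)//= lerDl sumr_ge0.
  have sS : s ^+ 2 <= n.+1%:R * S x.
    have := cauchy_schwarz (\row_(j < n) `|f j x|) (const_mx 1).
    rewrite (eq_bigr (fun j => `|f j x|)) => [|j _]; last by rewrite !mxE mulr1.
    rewrite -/s => hs.
    have : s ^+ 2 <= (enorm (\row_(j < n) `|f j x|) * enorm (const_mx 1 : 'rV[R]_n)) ^+ 2.
      exact: sqle.
    rewrite exprMn !sqr_enorm (eq_bigr (fun j => f j x * f j x)) => [|j _]; last first.
      by rewrite mxE -expr2 real_normK ?num_real// expr2.
    rewrite [X in _ * X](eq_bigr (fun=> 1)) => [|j _]; last by rewrite mxE expr1n.
    rewrite sumr_const card_ord mulrC => /le_trans; apply.
    by rewrite ler_wpM2r ?ler_nat// /S sumr_ge0// => j _; rewrite -expr2 sqr_ge0.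
  apply/andP; split.
    rewrite /k1 ler_pdivrMl ?mulr_gt0 ?exprn_gt0// -mulrA.
    apply: (@le_trans _ _ ((C2 * s) ^+ 2)).
      by apply: sqle => //; exact: ltW.
    by rewrite exprMn ler_pM2l ?exprn_gt0.
  rewrite /k2 ler_pdivlMl ?exprn_gt0//.
  apply: (@le_trans _ _ ((C1 * s) ^+ 2)); first by rewrite exprMn ler_pM2l ?exprn_gt0.
  by apply: sqle => //; rewrite mulr_ge0// ltW.
have [zz [zz0 zz1 zzl]] : exists zz : nat -> R, [/\ forall k, 0 < zz k, forall k, zz k <= 1 / 2 & zz @ \oo --> (0 : R)].
  exists (fun k => k.+2%:R^-1); split => [k|k|]; first by rewrite invr_gt0.
    by rewrite div1r lef_pV2 ?posrE// ler_nat.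
  by rewrite (cvg_shiftS (fun n => n.+1%:R^-1 : R)); exact: cvg_harmonic.
pose aa (k : nat) : R := 1 - zz k; pose bb (k : nat) : R := 1 - zz k / 2.
have a0 k : 0 < aa k by rewrite /aa; have := zz1 k; lra.
have a1 k : aa k < 1 by rewrite /aa; have := zz0 k; lra.
have ab k : aa k < bb k by rewrite /aa /bb; have := zz0 k; lra.
have b1 k : bb k < 1 by rewrite /bb; have := zz0 k; lra.
have acvg : aa @ \oo --> (1 : R).
  by rewrite -[X in _ --> X]subr0; apply: cvgB => //; exact: cvg_cst.
have /choice[J HJ] : forall k, exists J, @shell_mean R d (aa k) (bb k) J by move=> k; exact: exists_shell_mean.
pose hh k r := J k (fun x : 'rV[R]_d => S (r *: x)).
have sw k r x : 0 <= r -> r < 1 -> shell (aa k) (bb k) x ->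
    k1 * w (r * aa k) ^+ 2 <= S (r *: x) <= k2 * w r ^+ 2.
  move=> r0 r1 /andP[xa xb].
  have x1 : enorm x <= 1 by rewrite (le_trans xb)// ltW.
  have ex : enorm (r *: x) = r * enorm x by rewrite enormZ ger0_norm.
  have rx1 : r * enorm x <= r by rewrite ler_piMr.
  have /Sb : enorm (r *: x) < 1 by rewrite ex (le_lt_trans rx1).
  rewrite ex => /andP[h1 h2]; apply/andP; split.
    apply: le_trans h1; rewrite ler_pM2l//; apply: sqle.
      by rewrite ltW// w0 ?mulr_ge0 ?(ltW (a0 k))// (le_lt_trans (ler_piMr r0 (ltW (a1 k)))).
    by apply: wm; rewrite ?mulr_ge0 ?(ltW (a0 k)) ?ler_wpM2l// (le_lt_trans rx1).
  apply: le_trans h2 _; rewrite ler_pM2l//; apply: sqle.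
    by rewrite ltW// w0 ?mulr_ge0 ?enorm_ge0// (le_lt_trans rx1).
  by apply: wm; rewrite ?mulr_ge0 ?enorm_ge0.
have W0 : 0 < w 0 by rewrite w0.
pose cc : R := k1 * w 0 ^+ 2.
have cc0 : 0 < cc by rewrite mulr_gt0// exprn_gt0.
have ra k r : 0 <= r -> r < 1 -> 0 <= r * aa k /\ r * aa k < 1.
  move=> r0 r1; split; first by rewrite mulr_ge0// ltW.
  by rewrite (le_lt_trans (ler_piMr r0 (ltW (a1 k)))).
have bnd k r : 0 <= r -> r < 1 -> bounded_on_shell (aa k) (bb k) (fun x : 'rV[R]_d => S (r *: x)).
  move=> r0 r1; exists (k2 * w r ^+ 2) => x sx.
  have /andP[h1 h2] := sw k r x r0 r1 sx; rewrite ger0_norm//.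
  by rewrite (le_trans _ h1)// mulr_ge0 ?sqr_ge0// ltW.
have hb k r : 0 <= r -> r < 1 -> k1 * w (r * aa k) ^+ 2 <= hh k r <= k2 * w r ^+ 2.
  move=> r0 r1; have [_ _ Jle _ _] := HJ k; have [M HM] := bnd k r r0 r1.
  rewrite -[in X in X && _](shell_mean_cst (HJ k) (k1 * _)) -[in X in _ && X](shell_mean_cst (HJ k) (k2 * _)).
  apply/andP; split.
    apply: (Jle _ _ (`|M| + `|k1 * w (r * aa k) ^+ 2|)) => x sx.
      by rewrite lerDr normr_ge0 (le_trans (HM x sx))// (le_trans (ler_norm _))// lerDl.
    by have /andP[] := sw k r x r0 r1 sx.
  apply: (Jle _ _ (`|M| + `|k2 * w r ^+ 2|)) => x sx.
    by rewrite lerDr normr_ge0 (le_trans (HM x sx))// (le_trans (ler_norm _))// lerDl.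
  by have /andP[] := sw k r x r0 r1 sx.
have hc k r : 0 <= r -> r < 1 -> cc <= hh k r.
  move=> r0 r1; have /andP[h _] := hb k r r0 r1; apply: le_trans h.
  have [h1 h2] := ra k r r0 r1.
  rewrite /cc ler_pM2l//; apply: sqle; first exact: ltW.
  exact: wm.
have h0 k r : 0 <= r -> r < 1 -> 0 < hh k r by move=> r0 r1; exact: lt_le_trans (hc k r r0 r1).
have lnb r : 0 <= r -> r < 1 -> exists M : R, forall k, `|ln (hh k r)| <= M.
  move=> r0 r1; exists (`|ln cc| + `|ln (k2 * w r ^+ 2)|) => k.
  have K0 : 0 < k2 * w r ^+ 2 by rewrite mulr_gt0// exprn_gt0// w0.
  have /andP[_ h2] := hb k r r0 r1.
  have l1 : ln cc <= ln (hh k r) by rewrite ler_ln ?posrE ?h0 ?hc.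
  have l2 : ln (hh k r) <= ln (k2 * w r ^+ 2) by rewrite ler_ln ?posrE ?h0.
  have := ler_norm (ln (k2 * w r ^+ 2)); have := ler_norm (- ln cc); rewrite normrN => n1 n2.
  have n3 := normr_ge0 (ln cc); have n4 := normr_ge0 (ln (k2 * w r ^+ 2)).
  by rewrite ler_norml; apply/andP; split; lra.
pose Lv r := ulim (fun k => ln (hh k r)).
pose v r := expR (Lv r / 2).
have Lv_le r s (e : R) : 0 <= r -> r < 1 -> 0 <= s -> s < 1 -> 0 <= e ->
   (forall k, `|hh k r - hh k s| <= e) -> `|Lv r - Lv s| <= e / cc.
  move=> r0 r1 s0 s1 e0 h; have [M HM] := lnb r r0 r1; have [N HN] := lnb s s0 s1.
  apply: ulim_dist HM HN _ => k.
  apply: le_trans (ln_dist cc0 (hc k r r0 r1) (hc k s s0 s1)) _.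
  by rewrite ler_pM2r ?invr_gt0.
(* The [hh k] are equicontinuous, since a modulus of continuity of S on a closed ball passes to all
   its means. The logarithm is Lipschitz above [cc], so the limit inherits continuity. *)
have Lcont r : 0 <= r -> r < 1 -> forall e : R, 0 < e -> exists2 dl : R, 0 < dl &
   forall s, 0 <= s -> s < 1 -> `|r - s| < dl -> `|Lv r - Lv s| <= e.
  move=> r0 r1 e e0.
  have sub (x : 'rV[R]_d) : enorm x <= r -> enorm x < 1 by move=> h; exact: le_lt_trans r1.
  have [|dl dl0 H] := @heine_cantor R _ [set x : 'rV[R]_d | enorm x <= r]
     (fun x y => `|S x - S y| <= e * cc) (@compact_cball R d r).
    move=> x /sub Ux; have /cvgrPdist_lt/(_ (e * cc / 2)) := cS x Ux.
    rewrite divr_gt0 ?mulr_gt0// => /(_ isT) h.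
    near=> y z => /=; rewrite (_ : S y - S z = (S x - S z) - (S x - S y)); last by ring.
    rewrite (le_trans (ler_normB _ _))// (splitr (e * cc)) lerD// ltW//.
      by near: z.
    by near: y.
  exists dl => // s s0 s1 rs.
  rewrite -(@mulfK _ cc _ e) ?gt_eqF//.
  apply: Lv_le => //; first by rewrite mulr_ge0 ?ltW.
  move=> k.
  have := shell_mean_lin (HJ k) (-1) (bnd k r r0 r1) (bnd k s s0 s1).
  rewrite mulN1r -/(hh k r) -/(hh k s) => <-.
  apply: (shell_mean_bound (HJ k)) => x /andP[xa xb].
  have x1 : enorm x <= 1 by rewrite (le_trans xb)// ltW.
  rewrite mulN1r; apply: H; first by rewrite /= enormZ ger0_norm// ler_piMr.
  rewrite -scalerBl normrZ (le_lt_trans _ rs)// ler_piMr//.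
  by apply: norm_le_coord => // i; rewrite (le_trans (coord_le_enorm _ _)).
have Lconv x y l : x < 0 -> y < 0 -> 0 <= l -> l <= 1 ->
   Lv (expR (l * x + (1 - l) * y)) <= l * Lv (expR x) + (1 - l) * Lv (expR y).
  move=> x0 y0 l0 l1.
  have z0 : l * x + (1 - l) * y < 0.
    have [->|lp] := eqVneq l 0; first by rewrite mul0r add0r subr0 mul1r.
    have l00 : 0 < l by rewrite lt_neqAle eq_sym lp.
    by nra.
  have e1 (t : R) : t < 0 -> expR t < 1 by move=> t0; rewrite expR_lt1.
  have [M HM] := lnb _ (expR_ge0 (l * x + (1 - l) * y)) (e1 _ z0).
  have [M1 HM1] := lnb _ (expR_ge0 x) (e1 _ x0).
  have [M2 HM2] := lnb _ (expR_ge0 y) (e1 _ y0).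
  have H1 k : `|l * ln (hh k (expR x))| <= l * M1 by rewrite normrM ger0_norm// ler_wpM2l.
  have H2 k : `|(1 - l) * ln (hh k (expR y))| <= (1 - l) * M2.
    by rewrite normrM ger0_norm ?subr_ge0// ler_wpM2l ?subr_ge0.
  rewrite /Lv -(@ulimZ R _ M1 l)// -(@ulimZ R _ M2 (1 - l))// -(ulimD H1 H2).
  apply: (@ler_ulim R _ _ M (l * M1 + (1 - l) * M2)) => // [k|].
    by rewrite (le_trans (ler_normD _ _))// lerD.
  near=> k; apply: (ln_savg_convex hf d2 (b1 k) (HJ k)) => // t t0.
  exact: h0 (expR_ge0 t) (e1 _ t0).
have Lmono_pos r s : 0 < r -> r <= s -> s < 1 -> Lv r <= Lv s.
  move=> r0 rs s1; have s0 := lt_le_trans r0 rs.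
  have lrs : ln r <= ln s by rewrite ler_ln ?posrE.
  have ls0 : ln s < 0 by rewrite ln_lt0// s0.
  suff : Lv (expR (ln r)) <= Lv (expR (ln s)) by rewrite !lnK ?posrE.
  apply: (@nondecreasing_of_convex R (fun t => Lv (expR t)) (ln (k2 * w (expR (-1)) ^+ 2)) (-1)) => //.
  move=> t t1; have et : expR t < 1 by rewrite expR_lt1; lra.
    have et1 : expR (-1) < 1 :> R by rewrite expR_lt1; lra.
    have [M HM] := lnb _ (expR_ge0 t) et.
    apply: (ulim_le_cst HM) => k; have /andP[_ h] := hb k _ (expR_ge0 t) et.
    have w1 : 0 < w (expR t) by rewrite w0 ?expR_ge0.
    have w2 : 0 < w (expR (-1)) by rewrite w0 ?expR_ge0.
    rewrite ler_ln ?posrE ?h0 ?expR_ge0 ?mulr_gt0 ?exprn_gt0// (le_trans h)// ler_pM2l//.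
    apply: sqle; first exact: ltW.
    by apply: wm; rewrite ?expR_ge0// ler_expR ltW.
(* The variable ln r does not reach r = 0; monotonicity extends there by continuity. *)
have Lmono r s : 0 <= r -> r <= s -> s < 1 -> Lv r <= Lv s.
  rewrite le_eqVlt => /predU1P[<-|]; last exact: Lmono_pos.
  rewrite le_eqVlt => /predU1P[<-//|s0 s1].
  apply/ler_addgt0Pr => e e0; have [dl dl0 H] := Lcont 0 (lexx _) ltr01 e e0.
  have m0 : 0 < Num.min (dl / 2) s by rewrite lt_min s0 divr_gt0.
  have ms : Num.min (dl / 2) s <= s by rewrite ge_min lexx orbT.
  have md : Num.min (dl / 2) s < dl by rewrite gt_min; apply/orP; left; lra.
  have := Lmono_pos _ _ m0 ms s1.
  have := H _ (ltW m0) (le_lt_trans ms s1); rewrite sub0r normrN gtr0_norm// => /(_ md).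
  by have := ler_norm (Lv 0 - Lv (Num.min (dl / 2) s)); lra.
have Lw r : 0 <= r -> r < 1 -> ln (k1 * w r ^+ 2) <= Lv r <= ln (k2 * w r ^+ 2).
  move=> r0 r1; have wr : 0 < w r by rewrite w0.
  have [M HM] := lnb r r0 r1; apply/andP; split; last first.
    apply: (ulim_le_cst HM) => k; have /andP[_ h] := hb k _ r0 r1.
    by rewrite ler_ln ?posrE ?h0 ?mulr_gt0 ?exprn_gt0.
  have cw1 : (fun k => w (r * aa k)) @ \oo --> w r.
    apply/cvgrPdist_lt => e e0; have rin : `[0, 1[%classic r by rewrite /= in_itv /= r0.
    have [dl dl0 H] := (within_continuousP _ _).1 cw r rin e e0.
    have : (fun k => r * aa k) @ \oo --> r * 1 by apply: cvgM => //; exact: cvg_cst.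
    rewrite mulr1 => /cvgrPdist_lt /(_ dl dl0); apply: filterS => k; apply: H.
    by have [h1 h2] := ra k r r0 r1; rewrite /= in_itv /= h1.
  have cw2 : (fun k => ln (k1 * (w (r * aa k) * w (r * aa k)))) @ \oo --> ln (k1 * w r ^+ 2).
    rewrite expr2; apply: (@cvg_comp _ _ _ (fun k => k1 * (w (r * aa k) * w (r * aa k))) (@ln R)
      _ (nbhs (k1 * (w r * w r)))); last by apply: continuous_ln; rewrite !mulr_gt0.
    by apply: cvgM; [exact: cvg_cst|exact: cvgM].
  rewrite -(cvg_ulimE cw2).
  have lb k : ln cc <= ln (k1 * (w (r * aa k) * w (r * aa k))) <= ln (hh k r).
    have [h1 h2] := ra k r r0 r1; have W := w0 _ h1 h2; have /andP[h3 _] := hb k r r0 r1.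
    rewrite -expr2 !ler_ln ?posrE ?h0 ?mulr_gt0 ?exprn_gt0// h3 andbT /cc ler_pM2l//.
    by apply: sqle; [exact: ltW|exact: wm].
  apply: (@ler_ulim R _ _ (`|ln cc| + M) M) => // [k|].
    have /andP[l1 l2] := lb k; have := HM k; rewrite ler_norml => /andP[_ l3].
    have l4 := ler_norm (- ln cc); rewrite normrN in l4; have l5 := normr_ge0 (ln cc).
    have l6 : 0 <= M by apply: le_trans (HM 0%N).
    by rewrite ler_norml; apply/andP; split; lra.
  by near=> k; have /andP[] := lb k.
have vw r : 0 <= r -> r < 1 -> Num.sqrt k1 * w r <= v r <= Num.sqrt k2 * w r.
  move=> r0 r1; have /andP[l1 l2] := Lw r r0 r1; have wr : 0 < w r by rewrite w0.
  have E (k : R) : 0 < k -> ln (k * w r ^+ 2) / 2 = ln (Num.sqrt k * w r).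
    move=> k0; have <- : (Num.sqrt k * w r) ^+ 2 = k * w r ^+ 2 by rewrite exprMn sqr_sqrtr// ltW.
    by rewrite lnXn ?mulr_gt0 ?sqrtr_gt0// -[_ *+ 2]mulr_natr mulfK.
  have P (k : R) : 0 < k -> Num.sqrt k * w r = expR (ln (k * w r ^+ 2) / 2).
    by move=> k0; rewrite E// lnK// posrE mulr_gt0 ?sqrtr_gt0.
  by rewrite !P// /v !ler_expR !ler_pM2r ?invr_gt0// l1.
exists v; split.
- split.
  + by move=> r _ _; exact: expR_gt0.
  + by move=> r s r0 rs s1; rewrite ler_expR ler_pM2r ?invr_gt0// Lmono.
  + apply/within_continuousP => r; rewrite /= in_itv /= => /andP[r0 r1] e e0.
    have /cvgrPdist_lt/(_ e e0)/nbhs_ballP[dl /= dl0 H] := @continuous_expR R (Lv r / 2).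
    have [dl' dl'0 H'] := Lcont r r0 r1 dl dl0.
    exists dl' => // s; rewrite /= in_itv /= => /andP[s0 s1] rs.
    apply: H; rewrite -ball_normE /= -mulrBl normrM [`|2^-1|]gtr0_norm//.
    have h3 := H' s s0 s1 rs; have h4 := normr_ge0 (Lv r - Lv s).
    by move: dl0 h3 h4; lra.
  + move=> [M HM]; apply: wub; exists (M / Num.sqrt k1) => _ [r /= rin <-].
    have := rin; rewrite in_itv /= => /andP[r0 r1].
    rewrite ler_pdivlMr ?sqrtr_gt0// mulrC; have /andP[h _] := vw r r0 r1.
    by apply: le_trans h _; apply: HM; exists r.
- move=> l x y; rewrite !inE /= !in_itv /= => x0 y0.
  have E t : ln (v (expR t)) = Lv (expR t) / 2 by rewrite /v expRK.
  have half (A B C A' B' C' c : R) : A' = A / 2 -> B' = B / 2 -> C' = C / 2 ->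
    A <= c * B + (1 - c) * C -> A' <= c * B' + (1 - c) * C' by move=> -> -> ->; lra.
  exact: (half _ _ _ _ _ _ _ (E _) (E x) (E y)
    (Lconv x y l%:num x0 y0 ltac:(by []) ltac:(by []))).
- exists (Num.sqrt k1), (Num.sqrt k2); split; rewrite ?sqrtr_gt0// => r.
  by rewrite /= in_itv /= => /andP[r0 r1]; have /andP[] := vw r r0 r1.
Unshelve. all: by end_near. Qed.

End approximable_log_convex.

(** * Lacunary series of harmonic functions *)

Section geometric_series.
Variable R : realType.
Implicit Types (u v : nat -> R) (C r : R).

Definition gsum u : R := limn (series u).

Definition geo u C r := [/\ 0 <= r, r < 1 & forall k, `|u k| <= C * r ^+ k].

Lemma geo_cvg u C r : geo u C r -> cvgn (series u).
Proof.
move=> [r0 r1 uC]; apply: normed_cvg.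
have C0 : 0 <= C by have := uC 0%N; rewrite expr0 mulr1; exact: le_trans.
apply: (@series_le_cvg _ _ (geometric C r)).
- by move=> n; exact: normr_ge0.
- by move=> n; rewrite /geometric /= mulr_ge0 ?exprn_ge0.
- by move=> n; rewrite /geometric /=.
- by apply: is_cvg_geometric_series; rewrite ger0_norm.
Qed.

Lemma geo_C u C r : geo u C r -> 0 <= C.
Proof. by move=> [_ _ /(_ 0%N)]; rewrite expr0 mulr1; exact: le_trans. Qed.

Lemma geo_tail u C r n : geo u C r -> `|gsum u - \sum_(k < n) u k| <= C * r ^+ n / (1 - r).
Proof.
move=> g; have cu := geo_cvg g; have C0 := geo_C g; have [r0 r1 uC] := g.
have r1' : 0 < 1 - r by rewrite subr_gt0.
have part m : `|\sum_(k < n + m) u k - \sum_(k < n) u k| <= C * r ^+ n / (1 - r).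
  rewrite big_split_ord /= addrAC subrr add0r.
  apply: le_trans (ler_norm_sum _ _ _) _.
  apply: (@le_trans _ _ (\sum_(i < m) C * r ^+ n * r ^+ i)).
    by apply: ler_sum => i _; rewrite -mulrA -exprD.
  rewrite -mulr_sumr; apply: ler_wpM2l; first by rewrite mulr_ge0 ?exprn_ge0.
  rewrite -(@ler_pM2r _ (1 - r))// mulVf ?gt_eqF// mulrC -opprB mulNr -subrX1 opprB.
  by rewrite gerBl exprn_ge0.
have : (fun m => `|\sum_(k < n + m) u k - \sum_(k < n) u k|) @ \oo --> `|gsum u - \sum_(k < n) u k|.
  apply: cvg_norm; apply: cvgB; last exact: cvg_cst.
  have := cu; rewrite /gsum -(cvg_shiftn n (series u)) => h.
  rewrite (_ : (fun m => _) = (fun m => series u (m + n)%N)); first exact: h.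
  by apply/funext => m; rewrite /series /= addnC big_mkord.
by move=> h; apply: (cvgr_to_le h); apply: nearW => m; exact: part.
Qed.

Lemma gsumD u v C D r s : geo u C r -> geo v D s -> gsum (fun k => u k + v k) = gsum u + gsum v.
Proof. by move=> /geo_cvg cu /geo_cvg cv; rewrite /gsum -lim_seriesD. Qed.

Lemma gsum0 : gsum (fun=> 0) = 0.
Proof. by apply: cvg_lim => //; rewrite (_ : series _ = cst 0); [exact: cvg_cst|apply/funext => n; rewrite /series /= big1]. Qed.

Lemma geoD u v C D r s : geo u C r -> geo v D s ->
  geo (fun k => u k + v k) (C + D) (Num.max r s).
Proof.
move=> gu gv; have C0 := geo_C gu; have D0 := geo_C gv.
move: gu gv => [r0 r1 uC] [s0 s1 vD]; split.
- by rewrite le_max r0.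
- by rewrite gt_max r1.
move=> k; rewrite (le_trans (ler_normD _ _))// mulrDl lerD//.
  rewrite (le_trans (uC k))// ler_wpM2l// lerXn2r ?nnegrE ?le_max ?r0 ?lexx//.
by rewrite (le_trans (vD k))// ler_wpM2l// lerXn2r ?nnegrE ?le_max ?r0 ?lexx ?orbT.
Qed.

Lemma gsum_sum n (u : 'I_n -> nat -> R) : (forall i, exists C r, geo (u i) C r) ->
  (exists C r, geo (fun k => \sum_i u i k) C r) /\
  gsum (fun k => \sum_i u i k) = \sum_i gsum (u i).
Proof.
elim: n u => [|n IH] u g.
  split; last by rewrite big_ord0 -[RHS]gsum0; congr gsum; apply/funext => k; rewrite big_ord0.
  by exists 0, 0; split => // k; rewrite big_ord0 normr0 mul0r.
have [C [r gl]] := g ord_max.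
have [[D [s gs]] E] := IH (fun i => u (widen_ord (leqnSn n) i)) (fun i => g _).
have -> : (fun k => \sum_i u i k) = (fun k => \sum_(i < n) u (widen_ord (leqnSn n) i) k + u ord_max k).
  by apply/funext => k; rewrite big_ord_recr.
split; first by do 2 eexists; exact: geoD gs gl.
by rewrite (gsumD gs gl) E big_ord_recr.
Qed.

(** Dominated convergence for series along any proper filter. The neighbourhoods of a point give
    continuity of a sum, the punctured neighbourhoods of 0 give its differentiability. *)
Lemma tannery (T : Type) (F : set_system T) (q : nat -> T -> R) (l : nat -> R) C r :
  ProperFilter F -> 0 <= r -> r < 1 -> (forall k, q k x @[x --> F] --> l k) ->
  (\forall x \near F, forall k, `|q k x| <= C * r ^+ k) ->
  gsum (fun k => q k x) @[x --> F] --> gsum l.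
Proof.
move=> FF r0 r1 ql qC.
have lg : geo l C r.
  split => // k; apply: (@cvgr_to_le _ F _ _ (fun x => `|q k x|)); first exact: cvg_norm.
  by apply: filterS qC => x; apply.
have C0 := geo_C lg.
have r1' : 0 < 1 - r by rewrite subr_gt0.
apply/cvgrPdist_le => e e0.
have [n hn] : exists n, C * r ^+ n / (1 - r) <= e / 3.
  have : (fun n => C * r ^+ n / (1 - r)) @ \oo --> C * 0 / (1 - r).
    apply: cvgM; last exact: cvg_cst.
    by apply: cvgM; [exact: cvg_cst|apply: cvg_expr; rewrite ger0_norm].
  rewrite mulr0 mul0r => /cvgrPdist_le /(_ (e / 3)); rewrite divr_gt0// => /(_ isT) [n _ hn].
  exists n; have := hn n (leqnn n); rewrite /= sub0r normrN ger0_norm//.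
  by rewrite !mulr_ge0 ?exprn_ge0 ?invr_ge0 ?(ltW r1').
have : \forall x \near F, `|\sum_(k < n) l k - \sum_(k < n) q k x| <= e / 3.
  have : (fun x => \sum_(k < n) q k x) @ F --> \sum_(k < n) l k.
    elim: n {hn} => [|n IH].
      rewrite big_ord0 (_ : (fun _ => _) = cst 0); first exact: cvg_cst.
      by apply/funext => x; rewrite big_ord0.
    rewrite big_ord_recr /= (_ : (fun _ => _) = (fun x => \sum_(k < n) q k x + q n x)); first exact: cvgD.
    by apply/funext => x; rewrite big_ord_recr.
  by move=> /cvgrPdist_le; apply; rewrite divr_gt0.
apply: filterS2 qC => x qC hx.
have g : geo (fun k => q k x) C r by split.
have t1 := geo_tail n lg; have t2 := geo_tail n g.
rewrite (_ : gsum l - _ = (gsum l - \sum_(k < n) l k) + (\sum_(k < n) l k - \sum_(k < n) q k x)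
   - (gsum (fun k => q k x) - \sum_(k < n) q k x)); last by ring.
rewrite (le_trans (ler_normB _ _))// (_ : e = e / 3 + e / 3 + e / 3); last by field.
rewrite lerD//; last exact: le_trans hn.
rewrite (le_trans (ler_normD _ _))// lerD//; exact: le_trans hn.
Qed.

End geometric_series.

Section termwise.
Variables (R : realType) (d : nat).
Notation B := (@uball R d).

Definition locally_geo (p : nat -> 'rV[R]_d -> R) :=
  forall rho : R, rho < 1 -> exists C r : R, forall x, enorm x <= rho -> geo (fun k => p k x) C r.

Lemma near_in_ball (x : 'rV[R]_d) : B x -> exists2 rho : R, rho < 1 &
  \forall y \near x, enorm y <= rho.
Proof.
move=> Bx; exists ((1 + enorm x) / 2); first by move: Bx; rewrite /uball /=; lra.
have h : enorm x < (1 + enorm x) / 2 by move: Bx; rewrite /uball /=; lra.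
have : \forall y \near x, [set y : 'rV[R]_d | enorm y < (1 + enorm x) / 2] y.
  by apply: open_nbhs_nbhs; split => //; exact: open_uball_r.
by apply: filterS => y /= /ltW.
Qed.

(** By the mean value theorem the difference quotients of the terms are values of [dp] at
    intermediate points, hence dominated by the geometric bound on [dp]; termwise differentiation
    becomes an instance of [tannery]. *)
Lemma C1_gsum (p : nat -> 'rV[R]_d -> R) (dp : nat -> 'I_d -> 'rV[R]_d -> R) :
  (forall k, C1 B (p k) (dp k)) -> locally_geo p -> (forall i, locally_geo (fun k => dp k i)) ->
  C1 B (fun x => gsum (fun k => p k x)) (fun i x => gsum (fun k => dp k i x)).
Proof.
move=> Cp gp gdp x Bx; have [rho rho1 nx] := near_in_ball Bx.
have cont0 (q : nat -> 'rV[R]_d -> R) : (forall k, {for x, continuous (q k)}) -> locally_geo q ->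
    {for x, continuous (fun x => gsum (fun k => q k x))}.
  move=> cq gq; have [C [r H]] := gq rho rho1.
  have [r0 r1 _] := H x (nbhs_singleton nx).
  apply: (@tannery R _ (nbhs x) q (fun k => q k x) C r) => //.
  by apply: filterS nx => y /H[].
split; first by apply: cont0 => // k; have [] := Cp k x Bx.
move=> i; split; last first.
  by apply: cont0 => // k; have [_ /(_ i)[]] := Cp k x Bx.
have [C [r H]] := gp rho rho1; have [C' [r' H']] := gdp i rho rho1.
have gx := H x (nbhs_singleton nx); have [r0 r1 _] := gx.
have [r0' r1' _] := H' x (nbhs_singleton nx).
pose e := delta_mx 0 i : 'rV[R]_d.
have E : (fun h : R => h^-1 *: (((fun x => gsum (fun k => p k x)) \o shift x) (h *: e) - gsum (fun k => p k x))) @ 0^'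
    --> gsum (fun k => dp k i x).
  have nh : \forall h \near (0 : R)^', forall s : R, 0 <= s -> s <= 1 -> enorm (x + (s * h) *: e) <= rho.
    have [dl /= dl0 hd] := (nbhs_ballP _ _).1 nx.
    apply: nbhs_dnbhs; apply/nbhs_ballP; exists dl => //= h; rewrite -ball_normE /= sub0r normrN => hdl s s0 s1.
    apply: hd; rewrite -ball_normE /= opprD addrA subrr add0r normrN normrZ normrM (ger0_norm s0).
    apply: le_lt_trans hdl; rewrite -[leRHS]mul1r -[leRHS]mulr1.
    rewrite ler_pM ?mulr_ge0 ?ler_wpM2r//.
    by apply: norm_le_coord => // j; rewrite mxE eqxx /=; case: (_ == _); rewrite ?normr1 ?normr0.
  have key : (fun h : R => gsum (fun k => h^-1 * (p k (x + h *: e) - p k x))) @ 0^' --> gsum (fun k => dp k i x).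
    apply: (@tannery R _ _ (fun k h => h^-1 * (p k (x + h *: e) - p k x)) _ C' r') => // [k|].
      have [_ /(_ i)[[dd <-] _]] := Cp k x Bx.
      have := dd; rewrite /derivable => /cvg_ex [l hl].
      have -> : 'D_e (p k) x = l by exact: cvg_lim hl.
      apply: cvg_trans hl; apply: near_eq_cvg; apply: nearW => h /=.
      by rewrite [h *: _ + x]addrC.
    near=> h => k.
    have h0 : h != 0 by near: h; exact: nbhs_dnbhs_neq.
    have hn : forall s : R, 0 <= s -> s <= 1 -> enorm (x + (s * h) *: e) <= rho by near: h.
    have [|s [s0 s1 ->]] := @MVT_line R d (p k) e x h (dp k i).
      move=> s s0 s1; have Bs : B (x + (s * h) *: e) by exact: le_lt_trans (hn s s0 s1) rho1.
      by have [_ /(_ i)[]] := Cp k _ Bs.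
    by rewrite mulKf//; have [_ _] := H' _ (hn s s0 s1); apply.
  apply: cvg_trans key; apply: near_eq_cvg; near=> h => /=.
  have hn : forall s : R, 0 <= s -> s <= 1 -> enorm (x + (s * h) *: e) <= rho by near: h.
  have gh : geo (fun k => p k (x + h *: e)) C r.
    by apply: H; have := hn 1 ler01 (lexx _); rewrite mul1r.
  rewrite (addrC (h *: e) x) -[RHS]/(h^-1 * _) mulrBr.
  have c1 := geo_cvg gh; have c2 := geo_cvg gx.
  apply: cvg_lim => //.
  have -> : series (fun k => h^-1 * (p k (x + h *: e) - p k x)) =
     (fun n => h^-1 * series (fun k => p k (x + h *: e)) n - h^-1 * series (fun k => p k x) n).
    apply/funext => n; rewrite /series /= -mulrBr -sumrB mulr_sumr//.
  by apply: cvgB; apply: cvgM => //; exact: cvg_cst.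
by apply: DeriveDef; [apply/cvg_ex; eexists; exact: E|exact: cvg_lim E].
Unshelve. all: by end_near. Qed.

(** [pderiv] is known to agree with the explicit derivative only on the ball. Since the ball is
    open, the second derivatives can be transferred through equality near each point. *)
Lemma C1_harmonic_on (g : 'rV[R]_d -> R) dg ddg : C1 B g dg -> (forall i, C1 B (dg i) (ddg i)) ->
  (forall x, B x -> \sum_i ddg i i x = 0) -> harmonic_on B (g : 'rV[R]_d -> R^o).
Proof.
move=> Cg Cdg harm.
have pdE i x : B x -> pderiv i g x = dg i x.
  by move=> Bx; have [_ /(_ i)[[_ h] _]] := Cg x Bx.
have nB x : B x -> \forall y \near x, B y.
  by move=> Bx; apply: open_nbhs_nbhs; split => //; exact: open_uball_r.
have nE i x : B x -> \forall y \near x, dg i y = pderiv i g y.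
  by move=> Bx; apply: filterS (nB x Bx) => y By; rewrite pdE.
have D2 i j x : B x -> is_derive x (delta_mx 0 j : 'rV[R]_d) (pderiv i g : 'rV[R]_d -> R^o) (ddg i j x).
  move=> Bx; apply: (@near_eq_is_derive R _ _ (dg i)); first exact: nE.
  by have [_ /(_ j)[]] := Cdg i x Bx.
have pd2E i j x : B x -> pderiv j (pderiv i g) x = ddg i j x.
  by move=> Bx; have [_ h] := D2 i j x Bx.
have cnear (f h : 'rV[R]_d -> R) (x : 'rV[R]_d) : (\forall y \near x, f y = h y) -> {for x, continuous f} -> {for x, continuous h}.
  move=> fh cf A; rewrite -(nbhs_singleton fh) => /cf fA.
  have fA' : nbhs x (f @^-1` A) by exact: fA.
  have : nbhs x (h @^-1` A) by apply: filterS2 fh fA' => y /= ->.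
  exact.
split; last by move=> x Bx; rewrite -[RHS](harm x Bx); apply: eq_bigr => i _; exact: pd2E.
move=> x Bx; have [c0 h] := Cg x Bx; split => // i; have [h1 h2] := h i.
have [c1 h3] := Cdg i x Bx.
split; first by case: h1.
  exact: cnear (nE i x Bx) c1.
move=> j; have [h4 h5] := h3 j; split; first by have [] := D2 i j x Bx.
apply: cnear h5; apply: filterS (nB x Bx) => y By; rewrite pd2E//.
Qed.

Lemma harmonic_gsum (p : nat -> 'rV[R]_d -> R) dp ddp :
  (forall k, C1 B (p k) (dp k)) -> (forall k i, C1 B (dp k i) (ddp k i)) ->
  (forall k x, B x -> \sum_i ddp k i i x = 0) ->
  locally_geo p -> (forall i, locally_geo (fun k => dp k i)) ->
  (forall i j, locally_geo (fun k => ddp k i j)) ->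
  harmonic_on B ((fun x => gsum (fun k => p k x)) : 'rV[R]_d -> R^o).
Proof.
move=> Cp Cdp harm gp gdp gddp.
apply: (C1_harmonic_on (C1_gsum Cp gp gdp)
  (fun i => C1_gsum (fun k => Cdp k i) (gdp i) (gddp i))) => x Bx.
rewrite -(gsum_sum (u := fun i k => ddp k i i x) _).2 => [|i].
  by rewrite -[RHS]gsum0; congr gsum; apply/funext => k; rewrite harm.
have [C [r H]] := gddp i i (enorm x) Bx.
by exists C, r; exact: H.
Qed.

End termwise.

(** * Estimates for lacunary sums *)

Section lacunary.
Variable R : realType.

(** One factor n + 1 is absorbed at a time through Bernoulli's inequality, at the price of moving
    the rate half way towards 1. The maximum with 1/2 keeps the rate away from 0, where it could not
    be divided by. *)
Lemma poly_geo (K : nat) (q : R) : 0 <= q -> q < 1 ->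
  exists C s : R, [/\ 0 <= C, 0 <= s, s < 1 & forall n : nat, n.+1%:R ^+ K * q ^+ n <= C * s ^+ n].
Proof.
elim: K q => [|K IH] q q0 q1.
  by exists 1, q; split => // n; rewrite expr0.
pose q' := Num.max q (1 / 2).
have q'0 : 0 < q' by rewrite lt_max; apply/orP; right; lra.
have q'1 : q' < 1 by rewrite gt_max q1; lra.
have qq' : q <= q' by rewrite le_max lexx.
pose s := (1 + q') / 2.
have s0 : 0 <= s by rewrite /s; lra.
have s1 : s < 1 by rewrite /s; lra.
have q's : q' < s by rewrite /s; lra.
have [C [t [C0 t0 t1 H]]] := IH s s0 s1.
pose x := s / q' - 1.
have x0 : 0 < x by rewrite /x subr_gt0 ltr_pdivlMr// mul1r.
have bern n : 1 + n%:R * x <= (1 + x) ^+ n.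
  elim: n => [|n IHn]; first by rewrite mul0r addr0 expr0.
  rewrite exprS -natr1; have n0 : 0 <= (n%:R : R) by [].
  have : (1 + x) * (1 + n%:R * x) <= (1 + x) * (1 + x) ^+ n by rewrite ler_wpM2l//; lra.
  by apply: le_trans; nra.
exists ((1 + x^-1) * C), t; split => // [|n]; first by rewrite mulr_ge0// addr_ge0// invr_ge0 ltW.
have xs : (1 + x) * q' = s by rewrite /x addrC subrK divfK// gt_eqF.
have step : n.+1%:R * q ^+ n <= (1 + x^-1) * s ^+ n.
  rewrite -xs exprMn mulrA ler_pM ?exprn_ge0//; last by rewrite lerXn2r ?nnegrE ?(ltW q'0).
  apply: (@le_trans _ _ ((1 + x^-1) * (1 + n%:R * x))); last by rewrite ler_wpM2l// addr_ge0// invr_ge0 ltW.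
  rewrite -natr1; have n0 : 0 <= (n%:R : R) by []; have xi : 0 < x^-1 by rewrite invr_gt0.
  have E : (1 + x^-1) * (1 + n%:R * x) = 1 + n%:R * x + x^-1 + n%:R by field; rewrite gt_eqF.
  by rewrite E; nra.
rewrite exprSr -mulrA -[leRHS]mulrA.
apply: (@le_trans _ _ (n.+1%:R ^+ K * ((1 + x^-1) * s ^+ n))); first by rewrite ler_wpM2l ?exprn_ge0.
by rewrite mulrCA ler_wpM2l// addr_ge0// invr_ge0 ltW.
Qed.

Definition adist (k l : nat) : nat := ((k - l) + (l - k))%N.

Lemma adist_gt0 k l : k != l -> (0 < adist k l)%N.
Proof. by rewrite /adist; lia. Qed.

Lemma adist_half (b b' : bool) k l : ((adist k l).-1 <= (adist (b + k.*2) (b' + l.*2)).-1)%N.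
Proof. by rewrite /adist; case: b b' => [] []; rewrite -!muln2; lia. Qed.

(** Within one parity class distances are doubled, which pays for the unit lost in the exponent
    [(adist j q).-1] of a scale sequence. *)
Lemma adist_half_eq (b : bool) k l : k != l -> (adist k l <= (adist (b + k.*2) (b + l.*2)).-1)%N.
Proof. by rewrite /adist; case: b; rewrite -!muln2; lia. Qed.

Lemma sum_adist (dl : R) (n l : nat) : 0 <= dl -> dl <= 1 / 2 ->
  \sum_(k < n | k != l :> nat) dl ^+ adist k l <= 4 * dl.
Proof.
move=> d0 d1.
(* [Phi n - dl ^+ l.+1] is exactly (1 - dl) times the partial sum, the two geometric progressions on
   either side of l being summed; the induction needs only an upper bound. *)
pose Phi (n : nat) : R := if (n <= l)%N then dl ^+ (l - n).+1 else 2 * dl - dl ^+ (n - l).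
have H m : (1 - dl) * (\sum_(k < m | k != l :> nat) dl ^+ adist k l) <= Phi m.
  elim: m => [|m IH].
    by rewrite big_ord0 mulr0 /Phi leq0n exprn_ge0.
  rewrite big_mkcond big_ord_recr -big_mkcond /= mulrDr.
  apply: (@le_trans _ _ (Phi m + (1 - dl) * (if m != l then dl ^+ adist m l else 0))).
    by rewrite lerD2r.
  rewrite /Phi /adist; case: (ltngtP m l) => ml /=.
  - rewrite (_ : (m - l = 0)%N) ?add0n; last by apply/eqP; rewrite subn_eq0 ltnW.
    by rewrite -(subnSK ml) [dl ^+ _.+2]exprS; lra.
  - rewrite subSn; last exact: ltnW.
    rewrite (_ : (l - m = 0)%N) ?addn0; last by apply/eqP; rewrite subn_eq0 ltnW.
    by rewrite exprS; lra.
  - by rewrite ml subnn subSnn !expr1 mulr0; lra.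
have Phi_le : Phi n <= 2 * dl.
  rewrite /Phi; case: ifP => _; last by rewrite gerBl exprn_ge0.
  rewrite exprS mulrC ler_wpM2r//; apply: (@le_trans _ _ 1); last by rewrite ler1n.
  by rewrite exprn_ile1//; lra.
have Sp : 0 <= \sum_(k < n | k != l :> nat) dl ^+ adist k l by apply: sumr_ge0 => k _; rewrite exprn_ge0.
by have := le_trans (H n) Phi_le; nra.
Qed.

Lemma gsum_dist (u : nat -> R) (l : nat) (X C r : R) : geo u C r ->
  (forall n, (l < n)%N -> \sum_(k < n | k != l :> nat) `|u k| <= X) -> `|gsum u - u l| <= X.
Proof.
move=> g H.
have h : (fun n => `|series u n - u l|) @ \oo --> `|gsum u - u l|.
  by apply: cvg_norm; apply: cvgB; [exact: geo_cvg g|exact: cvg_cst].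
apply: (cvgr_to_le h); near=> n.
have ln : (l < n)%N by near: n; exists l.+1.
rewrite /series /= big_mkord (bigD1 (Ordinal ln))//= addrC addrK.
by apply: le_trans (ler_norm_sum _ _ _) (H n ln).
Unshelve. all: by end_near. Qed.

End lacunary.

Section tame.
Variables (R : realType) (d : nat) (g : R -> R).
Notation B := (@uball R d).
Hypothesis g0 : forall r, 0 <= r -> r < 1 -> 0 <= g r.
Hypothesis gm : forall r s, 0 <= r -> r < s -> s < 1 -> g r < g s.

(** The bounds may lose a polynomial factor in n and pass from rho to another radius rho' < 1. Both
    losses are made up for by comparing with a still larger radius, as g is strictly increasing. *)
Definition tame (P : nat -> 'rV[R]_d -> R) :=
  exists dP ddP, [/\ forall n, C1 B (P n) (dP n), forall n i, C1 B (dP n i) (ddP n i),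
    forall n x, B x -> \sum_i ddP n i i x = 0
  & forall rho : R, rho < 1 -> exists (C rho' : R) (K : nat), [/\ 0 <= C, 0 <= rho', rho' < 1
    & forall n x, enorm x <= rho -> [/\ `|P n x| <= C * n.+1%:R ^+ K * g rho' ^+ n,
       forall i, `|dP n i x| <= C * n.+1%:R ^+ K * g rho' ^+ n
     & forall i j, `|ddP n i j x| <= C * n.+1%:R ^+ K * g rho' ^+ n]]].

Variables (a : nat -> R) (N : nat -> nat).
Hypothesis a0 : forall k, 0 <= a k.
Hypothesis Nk : forall k, (k <= N k)%N.
Hypothesis aN : forall r : R, 0 <= r -> r < 1 -> exists M, forall k, a k * g r ^+ N k <= M.

(** The terms [a k * g r ^+ N k] are bounded at the intermediate radius (1 + rho) / 2. At rho they
    gain the factor q^{N k} with q = g(rho) / g((1 + rho) / 2) < 1, which beats the polynomial and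
    is geometric in k because k <= N k. *)
Lemma lacunary_geo (C rho : R) (K : nat) : 0 <= C -> 0 <= rho -> rho < 1 ->
  exists C' s : R, forall u : nat -> R,
    (forall k, `|u k| <= C * (N k).+1%:R ^+ K * g rho ^+ N k) -> geo (fun k => a k * u k) C' s.
Proof.
move=> C0 r0 r1; pose rho' := (1 + rho) / 2.
have rr' : rho < rho' by rewrite /rho'; lra.
have r'0 : 0 <= rho' by rewrite /rho'; lra.
have r'1 : rho' < 1 by rewrite /rho'; lra.
have gg := gm r0 rr' r'1; have gr0 := g0 r0 r1.
have g'0 : 0 < g rho' by exact: le_lt_trans gg.
pose q := g rho / g rho'.
have q0 : 0 <= q by rewrite divr_ge0// ltW.
have q1 : q < 1 by rewrite ltr_pdivrMr// mul1r.
have [C1 [s [C10 s0 s1 H]]] := poly_geo K q0 q1.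
have [M HM] := aN r'0 r'1.
have M0 : 0 <= M by apply: le_trans (HM 0%N); rewrite mulr_ge0// exprn_ge0// ltW.
exists (M * (C * C1)), s => u hu; split => // k.
rewrite normrM ger0_norm//.
apply: (@le_trans _ _ (a k * (C * (N k).+1%:R ^+ K * g rho ^+ N k))); first by rewrite ler_wpM2l.
have -> : g rho = q * g rho' by rewrite /q divfK// gt_eqF.
rewrite exprMn.
apply: (@le_trans _ _ ((a k * g rho' ^+ N k) * (C * ((N k).+1%:R ^+ K * q ^+ N k)))).
  by rewrite le_eqVlt; apply/orP; left; apply/eqP; ring.
apply: (@le_trans _ _ (M * (C * (C1 * s ^+ N k)))).
  apply: ler_pM => //; first by rewrite mulr_ge0// exprn_ge0// ltW.
    by rewrite !mulr_ge0 ?exprn_ge0.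
  by rewrite ler_wpM2l.
rewrite -!mulrA ler_wpM2l// ler_wpM2l// ler_wpM2l//.
by rewrite ler_wiXn2l// ltW.
Qed.

Lemma tame_locally_geo P : tame P -> locally_geo (fun k x => a k * P (N k) x).
Proof.
move=> [dP [ddP [_ _ _ H]]] rho r1; have [C [rho' [K [C0 r0' r1' HH]]]] := H rho r1.
have [C' [s G]] := lacunary_geo K C0 r0' r1'.
by exists C', s => x xr; apply: G => k; have [] := HH (N k) x xr.
Qed.

Lemma tame_harmonic P : tame P ->
  harmonic_on B ((fun x => gsum (fun k => a k * P (N k) x)) : 'rV[R]_d -> R^o).
Proof.
move=> tP; have [dP [ddP [CP CdP hP H]]] := tP.
apply: (@harmonic_gsum R d (fun k x => a k * P (N k) x) (fun k i x => a k * dP (N k) i x)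
  (fun k i j x => a k * ddP (N k) i j x)).
- by move=> k; exact: C1Z.
- by move=> k i; exact: C1Z.
- by move=> k x Bx; rewrite -mulr_sumr hP// mulr0.
- exact: tame_locally_geo.
- move=> i rho r1; have [C [rho' [K [C0 r0' r1' HH]]]] := H rho r1.
  have [C' [s G]] := lacunary_geo K C0 r0' r1'.
  by exists C', s => x xr; apply: G => k; have [_ ] := HH (N k) x xr.
- move=> i j rho r1; have [C [rho' [K [C0 r0' r1' HH]]]] := H rho r1.
  have [C' [s G]] := lacunary_geo K C0 r0' r1'.
  by exists C', s => x xr; apply: G => k; have [_ _] := HH (N k) x xr.
Qed.

End tame.

Lemma approximable_finType (R : realType) (d : nat) (w : R -> R) (T : finType)
    (f : T -> 'rV[R]_d -> R^o) : (forall t, harmonic_on (@uball R d) (f t)) ->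
  equiv_on (@uball R d) (fun x => \sum_t `|f t x|) (fun x => w (enorm x)) ->
  harmonically_approximable d w.
Proof.
move=> hf [C1 [C2 [C10 C20 H]]]; exists #|T|, (fun i => f (enum_val i)); split => //.
exists C1, C2; split => // x Bx.
suff -> : \sum_(j < #|T|) `|f (enum_val j) x| = \sum_t `|f t x| by exact: H.
rewrite [RHS](reindex_onto (@enum_val T xpredT) (@enum_rank T)) => [|t _]; last exact: enum_rankK.
by apply: eq_bigl => j; rewrite enum_valK eqxx.
Qed.

Lemma harmonic_on_cst (R : realType) (d : nat) (c : R) :
  harmonic_on (@uball R d) ((fun=> c) : 'rV[R]_d -> R^o).
Proof.
apply: (@C1_harmonic_on R d _ (fun _ _ => 0) (fun _ _ _ => 0)); first exact: C1_cst.
  by move=> i; exact: C1_cst.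
by move=> x _; rewrite big1.
Qed.

(* Up to constants, w is the largest of the terms a_q g^{N_q}.  The exponent
   (adist j q).-1 lets a neighbour of the dominant term be as large as it; summing
   over even and odd indices separately removes that neighbour. *)
Definition scale_sequence (R : realType) (g w : R -> R) (dl : R) :=
  exists (a : nat -> R) (N : nat -> nat) (r0 K : R), [/\ forall k, 0 < a k,
    forall k, (k <= N k)%N, 0 <= r0 < 1, 0 < K &
    forall r, r0 <= r -> r < 1 -> exists q, [/\ w r <= K * (a q * g r ^+ N q),
      a q * g r ^+ N q <= K * w r & forall j, j != q ->
      a j * g r ^+ N j <= dl ^+ (adist j q).-1 * (a q * g r ^+ N q)]].

(** * The approximating family of a weight with a scale sequence *)

Section assembly.
Variables (R : realType) (d : nat) (w g : R -> R) (T : finType) (P : T -> nat -> 'rV[R]_d -> R).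
Variables (Cb cb : R).
Hypothesis hw : is_weight w.
Hypothesis g0 : forall r, 0 <= r -> r < 1 -> 0 <= g r.
Hypothesis gm : forall r s, 0 <= r -> r < s -> s < 1 -> g r < g s.
Hypothesis tP : forall t, tame g (P t).
Hypotheses (cb0 : 0 < cb) (Cb0 : 0 < Cb).
Hypothesis Pu : forall t n x, uball x -> `|P t n x| <= Cb * g (enorm x) ^+ n.
Hypothesis Pl : forall n x, uball x -> cb * g (enorm x) ^+ n <= \sum_t `|P t n x|.

Lemma approximable_of_scale : (forall dl : R, 0 < dl -> scale_sequence g w dl) ->
  harmonically_approximable d w.
Proof.
move=> HS; have [w0 wm _ _] := hw.
(* In the lower bound each of the #|T| functions loses at most 4 dl Cb times the dominant term; in
   total this must not exceed half of cb. *)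
pose dl := Num.min (1 / 2) (cb / (8 * (#|T|.+1%:R * Cb))).
have TC0 : 0 < 8 * (#|T|.+1%:R * Cb) by rewrite !mulr_gt0.
have dl0 : 0 < dl by rewrite lt_min divr_gt0 //= divr_gt0.
have dl1 : dl <= 1 / 2 by rewrite ge_min lexx.
have dl2 : 4 * dl * (#|T|%:R * Cb) <= cb / 2.
  have : dl <= cb / (8 * (#|T|.+1%:R * Cb)) by rewrite ge_min lexx orbT.
  rewrite ler_pdivlMr// => h; apply: le_trans (_ : 4 * dl * (#|T|.+1%:R * Cb) <= _); last by lra.
  by rewrite ler_wpM2l ?mulr_ge0 ?(ltW dl0)// ler_wpM2r ?ler_nat ?(ltW Cb0).
have [a [N [r0 [K [a0 Nk /andP[r00 r01] K0 H]]]]] := HS dl dl0.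
pose T_ i r := a i * g r ^+ N i.
have T0 i r : 0 <= r -> r < 1 -> 0 <= T_ i r.
  by move=> h1 h2; rewrite mulr_ge0 ?exprn_ge0 ?g0// ltW.
have dlX m : dl ^+ m <= 1 by rewrite exprn_ile1 ?(ltW dl0)//; lra.
have Tm i r s : 0 <= r -> r <= s -> s < 1 -> T_ i r <= T_ i s.
  move=> h1; rewrite le_eqVlt => /predU1P[->//|h2 h3].
  rewrite ler_wpM2l ?(ltW (a0 i))// lerXn2r ?nnegrE ?g0 ?(le_trans h1 (ltW h2))//.
    exact: lt_trans h3.
  by rewrite ltW// gm.
have Tb r : 0 <= r -> r < 1 -> exists M, forall k, T_ k r <= M.
  move=> h1 h2; pose s := Num.max r r0.
  have s1 : s < 1 by rewrite gt_max h2.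
  have s0 : r0 <= s by rewrite le_max lexx orbT.
  have [q [_ q2 q3]] := H s s0 s1; exists (T_ q s) => k.
  apply: le_trans (Tm k r s h1 _ s1) _; first by rewrite le_max lexx.
  have [->//|kq] := eqVneq k q; apply: le_trans (q3 k kq) _.
  by rewrite ler_piMl// T0// (le_trans r00).
pose idx (b : bool) k := (b + k.*2)%N.
pose f (tb : T * bool) (x : 'rV[R]_d) := gsum (fun k => a (idx tb.2 k) * P tb.1 (N (idx tb.2 k)) x).
have a0' (b : bool) k : 0 <= a (idx b k) by exact: ltW.
have Nk' (b : bool) k : (k <= N (idx b k))%N.
  by apply: leq_trans (Nk _); rewrite /idx -addnn addnCA leq_addr.
have aN' (b : bool) r : 0 <= r -> r < 1 -> exists M, forall k, a (idx b k) * g r ^+ N (idx b k) <= M.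
  by move=> h1 h2; have [M HM] := Tb r h1 h2; exists M => k; exact: HM.
have hf tb : harmonic_on (@uball R d) (f tb : 'rV[R]_d -> R^o).
  exact: (tame_harmonic g0 gm (a0' tb.2) (Nk' tb.2) (aN' tb.2) (tP tb.1)).
have fgeo tb x : uball x -> exists C r, geo (fun k => a (idx tb.2 k) * P tb.1 (N (idx tb.2 k)) x) C r.
  move=> Bx; have := tame_locally_geo g0 gm (a0' tb.2) (Nk' tb.2) (aN' tb.2) (tP tb.1) Bx.
  by move=> [C [r h]]; exists C, r; exact: h.
have ub tb x k : uball x -> `|a (idx tb.2 k) * P tb.1 (N (idx tb.2 k)) x| <= Cb * T_ (idx tb.2 k) (enorm x).
  move=> Bx; rewrite normrM ger0_norm// mulrCA ler_wpM2l//; exact: Pu.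
(* The radius r may exceed |x|: with r = r0 this also covers the inner ball, where the scale
   sequence provides no dominant term. Neighbours of the dominant index may be as large as it, so
   the rest of the sum is only bounded by a multiple of the dominant term. *)
have upper tb x r : uball x -> enorm x <= r -> r0 <= r -> r < 1 ->
    `|f tb x| <= 6 * Cb * (K * w r).
  move=> Bx xr hr0 hr1; have [q [q1 q2 q3]] := H r hr0 hr1.
  have r0' : 0 <= r by exact: le_trans hr0.
  pose l := q./2.
  have qE : q = idx (odd q) l by rewrite /idx odd_double_half.
  have Tq0 : 0 <= T_ q r by exact: T0.
  have term k : T_ (idx tb.2 k) (enorm x) <= (if k == l then 1 else dl ^+ (adist k l).-1) * T_ q r.
    apply: le_trans (Tm _ _ _ (enorm_ge0 x) xr hr1) _.
    have [e|ne] := eqVneq (idx tb.2 k) q.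
      by rewrite e ler_peMl//; case: eqP => // kl; exfalso; apply: kl; rewrite /l -e /idx half_bit_double.
    apply: le_trans (q3 _ ne) _; rewrite ler_wpM2r//.
    case: eqP => _ //; rewrite ler_wiXn2l ?(ltW dl0)//; first by lra.
    by have := adist_half tb.2 (odd q) k l; rewrite -/(idx _ _) -/(idx _ _) -qE.
  have [C [rr gg]] := fgeo tb x Bx.
  have := gsum_dist gg (X := 4 * (Cb * T_ q r)) (l := l) _.
  rewrite -/(f tb x) => /(_ _) h.
  have h1 : `|f tb x - a (idx tb.2 l) * P tb.1 (N (idx tb.2 l)) x| <= 4 * (Cb * T_ q r).
    apply: h => n ln.
    apply: (@le_trans _ _ (\sum_(k < n | k != l :> nat) (dl ^+ adist k l * (dl^-1 * (Cb * T_ q r))))).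
      apply: ler_sum => k kl; apply: le_trans (ub tb x k Bx) _.
      have := term k; rewrite (negbTE kl) => tk.
      rewrite (_ : dl ^+ adist k l = dl * dl ^+ (adist k l).-1); last first.
        by rewrite -exprS prednK// adist_gt0.
      rewrite (_ : _ * _ * _ = Cb * (dl ^+ (adist k l).-1 * T_ q r)); last by field; rewrite gt_eqF.
      by rewrite ler_wpM2l// ltW.
    rewrite -mulr_suml; apply: (@le_trans _ _ (4 * dl * (dl^-1 * (Cb * T_ q r)))); last first.
      by rewrite le_eqVlt; apply/orP; left; apply/eqP; field; rewrite gt_eqF.
    have c0 : 0 <= dl^-1 * (Cb * T_ q r) by apply: mulr_ge0; [rewrite invr_ge0 ltW|apply: mulr_ge0 => //; exact: ltW].
    apply: (ler_wpM2r c0); apply: sum_adist => //; exact: ltW.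
  have h2 := ub tb x l Bx; have := term l; rewrite eqxx mul1r => h3.
  have h4 : Cb * T_ (idx tb.2 l) (enorm x) <= Cb * T_ q r by rewrite ler_wpM2l// ltW.
  have h5 := ler_normD (f tb x - a (idx tb.2 l) * P tb.1 (N (idx tb.2 l)) x) (a (idx tb.2 l) * P tb.1 (N (idx tb.2 l)) x).
  rewrite subrK in h5.
  have h6 : Cb * T_ q r <= Cb * (K * w r) by rewrite ler_wpM2l ?(ltW Cb0).
  have h7 : 0 <= Cb * T_ q r by rewrite mulr_ge0 ?(ltW Cb0).
  have -> : 6 * Cb * (K * w r) = 6 * (Cb * (K * w r)) by rewrite -[LHS]mulrA.
  by move: h1 h2 h4 h5 h6 h7; lra.
have lower x : uball x -> r0 <= enorm x -> cb / 2 * w (enorm x) <= K * \sum_tb `|f tb x|.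
  move=> Bx xr; have [q [q1 q2 q3]] := H (enorm x) xr Bx.
  pose l := q./2; pose b := odd q.
  have qE : q = idx b l by rewrite /idx odd_double_half.
  have Tq0 : 0 <= T_ q (enorm x) by apply: T0 => //; exact: enorm_ge0.
  (* Only the sums over indices of the parity of q are used: there the nearest other index is at
     distance 2 from q, and all the other terms together have size O(dl) relative to the dominant
     one. *)
  have ft t : a q * `|P t (N q) x| - 4 * dl * (Cb * T_ q (enorm x)) <= `|f (t, b) x|.
    have [C [rr gg]] := fgeo (t, b) x Bx.
    have : `|f (t, b) x - a (idx b l) * P t (N (idx b l)) x| <= 4 * dl * (Cb * T_ q (enorm x)).
      apply: (gsum_dist gg) => n ln.
      apply: (@le_trans _ _ (\sum_(k < n | k != l :> nat) (dl ^+ adist k l * (Cb * T_ q (enorm x))))).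
        apply: ler_sum => k kl; apply: le_trans (ub (t, b) x k Bx) _ => /=.
        rewrite [leRHS]mulrCA; apply: ler_wpM2l; first exact: ltW.
        have kq : idx b k != q by rewrite qE /idx eqn_add2l -!muln2 eqn_mul2r.
        apply: le_trans (q3 _ kq) _; rewrite ler_wpM2r// qE ler_wiXn2l ?(ltW dl0)//; first by lra.
        exact: adist_half_eq.
      have c0 : 0 <= Cb * T_ q (enorm x) by apply: mulr_ge0 => //; exact: ltW.
      rewrite -mulr_suml; apply: (ler_wpM2r c0); apply: sum_adist => //; exact: ltW.
    rewrite -qE => h; have := ler_normB (f (t, b) x) (f (t, b) x - a q * P t (N q) x).
    rewrite opprB addrCA subrr addr0 normrM (ger0_norm (ltW (a0 q))).
    by move: h; lra.
  have sumb : \sum_t `|f (t, b) x| <= \sum_tb `|f tb x|.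
    rewrite (eq_bigr (fun tb => `|f (tb.1, tb.2) x|)) => [|[t b'] _//].
    rewrite -(pair_bigA _ (fun t b => `|f (t, b) x|)) /=; apply: ler_sum => t _.
    by rewrite (bigD1 b)//= lerDl sumr_ge0.
  have : \sum_t (a q * `|P t (N q) x| - 4 * dl * (Cb * T_ q (enorm x))) <= \sum_t `|f (t, b) x|.
    by apply: ler_sum => t _.
  rewrite sumrB sumr_const.
  rewrite -mulr_sumr -[X in _ - X]mulr_natl => h1.
  have h2 : cb * T_ q (enorm x) <= a q * \sum_t `|P t (N q) x|.
    by rewrite /T_ mulrCA ler_wpM2l ?(ltW (a0 q))// Pl.
  have h3 : 4 * dl * (#|T|%:R * Cb) * T_ q (enorm x) <= cb / 2 * T_ q (enorm x) by rewrite ler_wpM2r.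
  have h4 : cb / 2 * T_ q (enorm x) <= \sum_tb `|f tb x|.
    apply: le_trans sumb; apply: le_trans h1.
    rewrite (_ : #|_|%:R * _ = 4 * dl * (#|T|%:R * Cb) * T_ q (enorm x)); last by ring.
    by move: h2 h3; lra.
  have h5 : cb / 2 * w (enorm x) <= cb / 2 * (K * T_ q (enorm x)) by rewrite ler_wpM2l// divr_ge0// ltW.
  have h6 : K * (cb / 2 * T_ q (enorm x)) <= K * \sum_tb `|f tb x| by rewrite ler_wpM2l// ltW.
  by move: h5 h6; lra.
(* The constant 1 joins the family to bound the sum from below for |x| < r0, where [w] stays between
   two positive constants. *)
pose F (o : option (T * bool)) : 'rV[R]_d -> R^o := if o is Some tb then f tb else (fun=> 1).
apply: (@approximable_finType R d w _ F).
  by case=> [tb|]; [exact: hf|exact: harmonic_on_cst].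
have W0 : 0 < w 0 by rewrite w0.
have Wr0 : 0 < w r0 by rewrite w0.
have FE x : \sum_o `|F o x| = 1 + \sum_tb `|f tb x|.
  rewrite (bigD1 None)//= normr1; congr (_ + _).
  rewrite (reindex_omap Some id) => [|[]//]; apply: eq_bigl => tb.
  by rewrite eqxx.
pose m : R := #|{: T * bool}|%:R.
pose U := (w 0)^-1 + m * (6 * Cb * K * (w r0 / w 0)).
have U0 : 0 < U.
  have m0 : 0 <= m by rewrite ler0n.
  have : 0 < 6 * Cb * K * (w r0 / w 0) by rewrite !mulr_gt0 ?invr_gt0.
  have : 0 < (w 0)^-1 by rewrite invr_gt0.
  by rewrite /U => h1 h2; rewrite ltr_pwDl// mulr_ge0// ltW.
pose V := w r0 + 2 * K / cb.
have V0 : 0 < V by rewrite addr_gt0// divr_gt0// mulr_gt0.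
exists U^-1, V; split; rewrite ?invr_gt0// => x Bx; rewrite FE.
have x0 := enorm_ge0 x.
have wx : 0 < w (enorm x) by rewrite w0.
have w0x : w 0 <= w (enorm x) by rewrite wm.
have S0 : 0 <= \sum_tb `|f tb x| by rewrite sumr_ge0.
split.
  rewrite ler_pdivrMl//.
  have one : 1 <= (w 0)^-1 * w (enorm x) by rewrite ler_pdivlMl// mulr1.
  have each tb : `|f tb x| <= 6 * Cb * K * (w r0 / w 0) * w (enorm x).
    have [xr|xr] := leP r0 (enorm x).
      apply: le_trans (upper tb x (enorm x) Bx (lexx _) xr Bx) _.
      rewrite (_ : 6 * Cb * (K * w (enorm x)) = 6 * Cb * K * w (enorm x) * 1); last by ring.
      rewrite (_ : _ * (w r0 / w 0) * _ = 6 * Cb * K * w (enorm x) * (w r0 / w 0)); last by ring.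
      rewrite ler_wpM2l ?mulr_ge0 ?(ltW Cb0) ?(ltW K0) ?(ltW wx)//.
      by rewrite ler_pdivlMr// mul1r wm.
    apply: le_trans (upper tb x r0 Bx (ltW xr) (lexx _) r01) _.
    rewrite (_ : 6 * Cb * (K * w r0) = 6 * Cb * K * w r0 * 1); last by ring.
    rewrite (_ : _ * (w r0 / w 0) * _ = 6 * Cb * K * w r0 * ((w 0)^-1 * w (enorm x))); last by ring.
    by rewrite ler_wpM2l ?mulr_ge0 ?(ltW Cb0) ?(ltW K0) ?(ltW Wr0).
  have : \sum_tb `|f tb x| <= \sum_(tb : T * bool) 6 * Cb * K * (w r0 / w 0) * w (enorm x).
    by apply: ler_sum => tb _.
  rewrite sumr_const -[_ *+ _]mulr_natl => h.
  rewrite /U [leRHS]mulrDl; apply: lerD => //; apply: le_trans h _.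
  by rewrite -[leRHS]mulrA.
have [xr|xr] := leP r0 (enorm x).
  have := lower x Bx xr; rewrite -ler_pdivlMl ?divr_gt0// => h.
  apply: (le_trans h); rewrite /V mulrDl.
  have h1 : 0 <= w r0 * (1 + \sum_tb `|f tb x|) by rewrite mulr_ge0 ?(ltW Wr0)// addr_ge0.
  have h2 : 2 * K / cb * \sum_tb `|f tb x| <= 2 * K / cb * (1 + \sum_tb `|f tb x|).
    by rewrite ler_wpM2l ?divr_ge0 ?mulr_ge0 ?(ltW K0) ?(ltW cb0)// lerDr.
  rewrite invf_div (_ : 2 / cb * (K * _) = 2 * K / cb * \sum_tb `|f tb x|); last by ring.
  by move: h1 h2; lra.
apply: (@le_trans _ _ (w r0)); first by rewrite wm// ltW.
rewrite -[leLHS]mulr1 ler_pM ?(ltW Wr0)//; last by rewrite lerDl.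
by rewrite /V lerDl divr_ge0 ?mulr_ge0 ?(ltW K0) ?(ltW cb0).
Qed.

End assembly.

(** * Weights as envelopes of lines *)

Section lines.
Variables (R : realType) (phi : R -> R) (b tau : nat -> R) (N : nat -> nat) (L K : R).
Let l (i : nat) (t : R) := b i + (N i)%:R * t.
Hypothesis L0 : 0 < L.
Hypothesis tau_le : forall i, tau i <= tau i.+1.
Hypothesis tau_cvg : forall t, t < 0 -> exists i, t < tau i.
Hypothesis left_gap : forall i, L <= l i (tau i) - l i.+1 (tau i).
Hypothesis right_gap : forall i, L <= l i.+1 (tau i.+1) - l i (tau i.+1).
Hypothesis near_phi : forall i t, tau i <= t -> t <= tau i.+1 ->
  [/\ l i t <= phi t + K, l i.+1 t <= phi t + K & phi t <= Num.max (l i t) (l i.+1 t) + K].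

(** Lines i and i + 1 change their order between [tau i] and [tau i.+1], which forces the slope to
    increase. *)
Lemma lines_slope i : (N i < N i.+1)%N.
Proof.
have h1 := left_gap i; have h2 := right_gap i; have h3 := tau_le i.
rewrite ltnNge; apply/negP => h; have : (N i.+1)%:R <= (N i)%:R :> R by rewrite ler_nat.
by rewrite /l in h1 h2; move=> h4; have := L0; nra.
Qed.

Lemma lines_slope_ge i : (i <= N i)%N.
Proof. by elim: i => // i IH; exact: leq_ltn_trans (lines_slope i). Qed.

Lemma lines_left i t : t <= tau i -> l i.+1 t <= l i t - L.
Proof.
move=> ti; have h1 := left_gap i; have h2 : (N i)%:R <= (N i.+1)%:R :> R by rewrite ler_nat ltnW ?lines_slope.
by rewrite /l in h1 *; nra.
Qed.

Lemma lines_right i t : tau i.+1 <= t -> l i t <= l i.+1 t - L.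
Proof.
move=> ti; have h1 := right_gap i; have h2 : (N i)%:R <= (N i.+1)%:R :> R by rewrite ler_nat ltnW ?lines_slope.
by rewrite /l in h1 *; nra.
Qed.

Lemma tau_mono i j : (i <= j)%N -> tau i <= tau j.
Proof. by move=> ij; rewrite -(subnKC ij); elim: (j - i)%N => [|n IH]; rewrite ?addn0 ?addnS// (le_trans IH). Qed.

Lemma lines_up i m t : t <= tau i.+1 -> l (i.+1 + m)%N t <= l i.+1 t - m%:R * L.
Proof.
move=> ti; elim: m => [|m IH]; first by rewrite addn0 mul0r subr0.
rewrite addnS; have := @lines_left (i.+1 + m) t (le_trans ti (tau_mono (leq_addr _ _))).
by rewrite -natr1 addrC; move: IH; rewrite addrC; lra.
Qed.

Lemma lines_down i m t : tau i <= t -> (m <= i)%N -> l (i - m)%N t <= l i t - m%:R * L.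
Proof.
move=> ti; elim: m => [|m IH] mi; first by rewrite subn0 mul0r subr0.
have h := IH (ltnW mi).
have E : (i - m = (i - m.+1).+1)%N by rewrite subnSK.
have := @lines_right (i - m.+1) t; rewrite -E => /(_ (le_trans (tau_mono (leq_subr _ _)) ti)).
by rewrite -natr1; lra.
Qed.

(** Between [tau i] and [tau i.+1] the larger of the lines i and i + 1 dominates. They cross in this
    interval, so no gap separates them there, whence the predecessor of [adist]; every further line
    is beyond its crossing with the preceding one and loses another L. *)
Lemma lines_dominate t : tau 0 <= t -> t < 0 -> exists q, [/\ phi t <= l q t + K, l q t <= phi t + K
   & forall j, j != q -> l j t <= l q t - (adist j q).-1%:R * L].
Proof.
move=> t0 tn; have [n0 hn0] := tau_cvg tn.
have ex : exists n, (t < tau n) by exists n0.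
have [i [ti ti1]] : exists i, tau i <= t /\ t <= tau i.+1.
  case: (ex_minnP ex) => -[|i] h1 h2; first by move: h1; rewrite ltNge t0.
  exists i; split; last exact: ltW.
  by rewrite leNgt; apply/negP => /h2; rewrite ltnn.
have [h1 h2 h3] := near_phi ti ti1.
have [le|gt] := leP (l i.+1 t) (l i t).
  exists i; split => //; first by rewrite max_l in h3.
  move=> j ji; have [jlt|jgt|je] := ltngtP j i; last by rewrite je eqxx in ji.
    have := lines_down ti (leq_subr j i); rewrite subKn ?(ltnW jlt)// => h.
    have : (adist j i).-1%:R * L <= (i - j)%:R * L.
      by rewrite ler_pM2r// ler_nat /adist (eqP (_ : j - i == 0)%N) ?subn_eq0 ?(ltnW jlt)// add0n leq_pred.
    by lra.
  have := @lines_up i (j - i.+1) t ti1; rewrite subnKC// => h.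
  have -> : (adist j i).-1 = (j - i.+1)%N.
    by rewrite /adist (eqP (_ : i - j == 0)%N) ?subn_eq0 ?(ltnW jgt)// addn0 subnS.
  by lra.
exists i.+1; split => //; first by rewrite max_r ?(ltW gt) in h3.
move=> j ji; have [jlt|jgt|je] := ltngtP j i.+1; last by rewrite je eqxx in ji.
  have jle : (j <= i)%N by rewrite -ltnS.
  have := lines_down ti (leq_subr j i); rewrite subKn// => h.
  have -> : (adist j i.+1).-1 = (i - j)%N.
    by rewrite /adist (eqP (_ : j - i.+1 == 0)%N) ?subn_eq0 ?(ltnW jlt)// add0n subSn.
  by lra.
have := @lines_up i (j - i.+1) t ti1; rewrite subnKC ?(ltnW jgt)// => h.
have : (adist j i.+1).-1%:R * L <= (j - i.+1)%:R * L.
  by rewrite ler_pM2r// ler_nat /adist (eqP (_ : i.+1 - j == 0)%N) ?subn_eq0 ?(ltnW jgt)// addn0 leq_pred.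
by lra.
Qed.

Lemma scale_sequence_of_lines (g w : R -> R) (r0 : R) : 0 <= r0 -> r0 < 1 ->
  (forall r, r0 <= r -> r < 1 -> [/\ 0 < g r, g r < 1, tau 0 <= ln (g r), 0 < w r & phi (ln (g r)) = ln (w r)]) ->
  scale_sequence g w (expR (- L)).
Proof.
move=> r00 r01 H.
exists (fun i => expR (b i)), N, r0, (expR K); split.
- by move=> k; exact: expR_gt0.
- exact: lines_slope_ge.
- by rewrite r00.
- exact: expR_gt0.
move=> r hr0 hr1; have [gp g1 gt wp pw] := H r hr0 hr1.
have lg : ln (g r) < 0 by rewrite ln_lt0// gp.
have TE i : expR (b i) * g r ^+ N i = expR (l i (ln (g r))).
  by rewrite /l expRD mulrC -[in LHS](lnK (_ : g r \is Num.pos)) ?posrE// -expRM_natl mulrC.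
have WE : w r = expR (phi (ln (g r))) by rewrite pw lnK.
have [q [h1 h2 h3]] := lines_dominate gt lg.
exists q; rewrite TE; split.
- by rewrite WE -expRD ler_expR addrC.
- by rewrite WE -expRD ler_expR addrC.
move=> j jq; rewrite TE -expRM_natl -expRD ler_expR.
by have := h3 j jq; lra.
Qed.

End lines.

(** * Envelopes for log-convex weights *)

Section convex_lines.
Variables (R : realType) (phi : R -> R) (L m0 : R).
Hypothesis L0 : 0 < L.
Hypothesis cvx : forall x y l, x < 0 -> y < 0 -> 0 <= l -> l <= 1 ->
  phi (l * x + (1 - l) * y) <= l * phi x + (1 - l) * phi y.
Hypothesis mono : forall x y, x <= y -> y < 0 -> phi x <= phi y.
Hypothesis lb : forall t, t < 0 -> m0 <= phi t.
Hypothesis unb : forall M, exists2 t, t < 0 & M <= phi t.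
Hypothesis cphi : forall t, t < 0 -> {for t, continuous phi}.

(* The line of slope n + 1 supporting phi from below touches it at t. *)
Lemma tangent_point (n : nat) : exists t, t < 0 /\
  forall s, s < 0 -> n.+1%:R * s - phi s <= n.+1%:R * t - phi t.
Proof.
have n0 : 0 < n.+1%:R :> R by [].
(* V is the value at -1 of the function to be maximised. To the left of A it falls below V because
   phi >= m0, to the right of B it does not exceed V because phi >= - V, so a maximum over [A, B] is
   global. *)
pose V := - n.+1%:R - phi (-1).
pose A := Num.min (-1) ((V + m0) / n.+1%:R).
have [B0 B00 hB0] := unb (- V).
pose B := Num.max (-1) B0.
have A1 : A <= -1 by rewrite ge_min lexx.
have B1 : -1 <= B by rewrite le_max lexx.
have Bneg : B < 0 by rewrite gt_max B00 ltrN10.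
have hB : - V <= phi B by apply: le_trans hB0 (mono _ Bneg); rewrite le_max lexx orbT.
have AB : A <= B by exact: le_trans B1.
pose f s := n.+1%:R * s - phi s.
have cf : {within `[A, B], continuous f}.
  apply: continuous_in_subspaceT => s; rewrite inE /= in_itv /= => /andP[_ sB].
  apply: continuousB; first by apply: continuousM; [exact: cst_continuous|exact: cvg_id].
  by apply: cphi; exact: le_lt_trans Bneg.
have [c] := EVT_max AB cf; rewrite in_itv /= => /andP[Ac cB] hc.
have fc : V <= f c.
  have := hc (-1); rewrite in_itv /= A1 B1 => /(_ isT); rewrite /f /V mulrN1; exact.
exists c; split; first exact: le_lt_trans Bneg.
move=> s s0; have [sA|As] := ltP s A.
  apply: le_trans fc; have := lb s0.
  have : s < (V + m0) / n.+1%:R by apply: lt_le_trans sA _; rewrite ge_min lexx orbT.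
  by rewrite ltr_pdivlMr// mulrC; lra.
have [Bs|sB] := ltP B s.
  apply: le_trans fc; have := mono (ltW Bs) s0.
  have : n.+1%:R * s <= 0 by rewrite mulr_ge0_le0// ltW.
  by lra.
by apply: hc; rewrite in_itv /= As.
Qed.

(** Supporting lines of all integer slopes follow [phi] closely, but adjacent ones may be too near
    each other; thinning them to a gap L costs a further L in precision. The slopes must be
    integers, being the exponents of g. *)
Lemma convex_lines : exists (b tau : nat -> R) (N : nat -> nat) (K : R),
  [/\ tau 0 < 0, forall i, tau i <= tau i.+1, forall t, t < 0 -> exists i, t < tau i,
   (forall i, L <= (b i + (N i)%:R * tau i) - (b i.+1 + (N i.+1)%:R * tau i)) /\
   (forall i, L <= (b i.+1 + (N i.+1)%:R * tau i.+1) - (b i + (N i)%:R * tau i.+1))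
   & forall i t, tau i <= t -> t <= tau i.+1 ->
     [/\ b i + (N i)%:R * t <= phi t + K, b i.+1 + (N i.+1)%:R * t <= phi t + K
       & phi t <= Num.max (b i + (N i)%:R * t) (b i.+1 + (N i.+1)%:R * t) + K]].
Proof.
have /choice[tau htau] := tangent_point.
have t0 n : tau n < 0 by have [] := htau n.
pose ll n t := phi (tau n) + n.+1%:R * (t - tau n).
have F1 n t : t < 0 -> ll n t <= phi t.
  by move=> tn; have [_ /(_ t tn)] := htau n; rewrite /ll mulrBr; lra.
have F2 n : ll n (tau n) = phi (tau n) by rewrite /ll subrr mulr0 addr0.
have tmono n m : (n <= m)%N -> tau n <= tau m.
  rewrite leq_eqVlt => /predU1P[->//|nm].
  have h1 := F1 n _ (t0 m); have h2 := F1 m _ (t0 n).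
  have h3 : n.+1%:R < m.+1%:R :> R by rewrite ltr_nat.
  by rewrite /ll in h1 h2; nra.
have tcvg s : s < 0 -> exists n0, forall n, (n0 <= n)%N -> s <= tau n.
  move=> s0; pose s' := s / 2; have s'0 : s' < 0 by rewrite /s'; lra.
  have ss' : 0 < s' - s by rewrite /s'; lra.
  pose q := (phi s' - m0) / (s' - s).
  have q0 : 0 <= q by rewrite divr_ge0 ?subr_ge0 ?lb// ltW// -subr_gt0.
  exists (Num.truncn q).+1 => n hn; rewrite leNgt; apply/negP => ts.
  have /andP[_ qt] := truncn_itv q0.
  have qn : q < n.+1%:R by apply: lt_le_trans qt _; rewrite ler_nat leqW.
  rewrite /q ltr_pdivrMr// in qn.
  have h1 := F1 n _ s'0; have h2 := lb (t0 n).
  have h3 : n.+1%:R * (s' - s) <= n.+1%:R * (s' - tau n) by rewrite ler_wpM2l// lerB// ltW.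
  by rewrite /ll in h1; lra.
(* [phi - ll n] is convex with minimum 0 at [tau n], hence decreasing before this point and
   increasing after it. *)
have psi_left n s t : s <= t -> t <= tau n -> phi t - ll n t <= phi s - ll n s.
  rewrite le_eqVlt => /predU1P[->//|st] tt0.
  have s0 : s < 0 by rewrite (lt_trans st)// (le_lt_trans tt0).
  move: tt0; rewrite le_eqVlt => /predU1P[->|tt].
    by rewrite F2 subrr subr_ge0 F1.
  pose l := (tau n - t) / (tau n - s).
  have d0 : 0 < tau n - s by rewrite subr_gt0 (lt_trans st).
  have l0 : 0 <= l by rewrite divr_ge0 ?subr_ge0 ?(ltW tt) ?(ltW d0)// (ltW (lt_trans st tt)).
  have l1 : l <= 1 by rewrite ler_pdivrMr// mul1r lerD2l lerN2 ltW.
  have := cvx s0 (t0 n) l0 l1.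
  have -> : l * s + (1 - l) * tau n = t by rewrite /l; field; rewrite gt_eqF.
  have h : 0 <= phi s - ll n s by rewrite subr_ge0 F1.
  have E : ll n t = l * ll n s + (1 - l) * phi (tau n).
    by rewrite /ll /l; field; rewrite gt_eqF.
  by rewrite E; nra.
have psi_right n s t : tau n <= s -> s <= t -> t < 0 -> phi s - ll n s <= phi t - ll n t.
  rewrite le_eqVlt => /predU1P[<- st tn|ts].
    by rewrite F2 subrr subr_ge0 F1.
  rewrite le_eqVlt => /predU1P[->//|st] tn.
  pose l := (s - tau n) / (t - tau n).
  have d0 : 0 < t - tau n by rewrite subr_gt0 (lt_trans ts).
  have l0 : 0 <= l by rewrite divr_ge0 ?subr_ge0 ?(ltW ts)// (ltW (lt_trans ts st)).
  have l1 : l <= 1 by rewrite ler_pdivrMr// mul1r lerD2r ltW.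
  have := cvx tn (t0 n) l0 l1.
  have -> : l * t + (1 - l) * tau n = s by rewrite /l; field; rewrite gt_eqF.
  have h : 0 <= phi t - ll n t by rewrite subr_ge0 F1.
  have E : ll n s = l * ll n t + (1 - l) * phi (tau n).
    by rewrite /ll /l; field; rewrite gt_eqF.
  by rewrite E; nra.
(* Consecutive lines of the family are chosen greedily: [next n] indexes the first
   supporting line separated by L from line n at both points of contact. *)
pose gap n m := (n < m)%N && (L <= ll n (tau n) - ll m (tau n)) && (L <= ll m (tau m) - ll n (tau m)).
have gex n : exists m, gap n m.
  pose s1 := tau n / 2; have tn := t0 n; have s10 : s1 < 0 by rewrite /s1; lra.
  have ss1 : 0 < s1 - tau n by rewrite /s1; lra.
  pose q := Num.max 0 ((phi s1 - phi (tau n) + L) / (s1 - tau n)).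
  have q0 : 0 <= q by rewrite le_max lexx.
  have [s2 s20 hs2] := unb (L - n.+1%:R * tau n + phi (tau n)).
  have [n2 hn2] := tcvg _ s20.
  exists (maxn n.+1 (maxn n2 (Num.truncn q).+1)); set m := maxn _ _.
  have mn : (n < m)%N by rewrite leq_max leqnn.
  have m2 : (n2 <= m)%N by rewrite !leq_max leqnn orbT.
  have m3 : q < m.+1%:R.
    have /andP[_ qt] := truncn_itv q0; apply: lt_le_trans qt _.
    by rewrite ler_nat leqW// !leq_max leqnn !orbT.
  rewrite /gap mn !F2 /=; apply/andP; split.
    have h1 := F1 m _ s10.
    have : (phi s1 - phi (tau n) + L) / (s1 - tau n) < m.+1%:R.
      by apply: le_lt_trans m3; rewrite le_max lexx orbT.
    rewrite ltr_pdivrMr//; rewrite /ll in h1 *.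
    by lra.
  have h2 := mono (hn2 m m2) (t0 m).
  have h3 : n.+1%:R * tau m <= 0 by rewrite mulr_ge0_le0// ltW.
  by rewrite /ll; lra.
pose next n := ex_minn (gex n).
have nextP n : [/\ (n < next n)%N, L <= ll n (tau n) - ll (next n) (tau n),
    L <= ll (next n) (tau (next n)) - ll n (tau (next n))
    & forall m, gap n m -> (next n <= m)%N].
  by rewrite /next; case: ex_minnP => m /andP[/andP[h1 h2] h3] h4.
pose T := - tau 0.
have T0 : 0 < T by rewrite /T; have := t0 0%N; lra.
have tauT n : - T <= tau n by rewrite /T opprK tmono.
(* At [tau m.-1] the line m lies below [phi] by at most [tau m - tau m.-1], because the slopes of
   the lines m - 1 and m differ by 1; and all [tau n] lie in an interval of length T. *)
have succ_below m t : (0 < m)%N -> t <= tau m -> tau m.-1 <= t -> phi t - ll m t <= T.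
  move=> m1 tm mt; apply: le_trans (psi_left m _ _ mt tm) _.
  have h1 := F1 m.-1 _ (t0 m); rewrite /ll in h1 *; have h2 := tmono _ _ (leq_pred m).
  rewrite prednK// in h1.
  have E : m.+1%:R = m%:R + 1 :> R by rewrite natr1.
  have h3 := tauT m.-1; have h4 := t0 m.
  by rewrite E; nra.
(* To the left of [tau m.-1], minimality of m shows that m - 1 fails the gap test. If it fails at
   [tau n], line m is within L + T of [phi] there and [psi_left] applies; if it fails at [tau m.-1],
   line n is within L of [phi] there and [psi_right] applies. *)
have cover n t : tau n <= t -> t <= tau (next n) ->
    phi t <= Num.max (ll n t) (ll (next n) t) + (L + T).
  move=> nt tm; have [h1 h2 h3 h4] := nextP n; set m := next n in tm h1 h2 h3 h4 *.
  have m1 : (0 < m)%N by exact: leq_ltn_trans h1.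
  have tn : t < 0 by exact: le_lt_trans (t0 m).
  suff : phi t - ll n t <= L + T \/ phi t - ll m t <= L + T.
    move=> [h|h]; rewrite -lerBlDr le_max; apply/orP; [left|right]; lra.
  have [le|lt] := leP (tau m.-1) t.
    by right; apply: le_trans (succ_below m t m1 tm le) _; rewrite lerDr ltW.
  have nm1 : (n < m.-1)%N.
    rewrite ltnNge; apply/negP => h; have : tau m.-1 <= t by apply: le_trans (tmono _ _ h) nt.
    by rewrite leNgt lt.
  have : ~~ gap n m.-1 by apply/negP => /h4; rewrite leqNgt prednK// leqnn.
  rewrite /gap nm1 /= negb_and -!ltNge => /orP[ga|gb].
    right; apply: le_trans (psi_left m _ _ nt tm) _.
    have h5 := F1 m.-1 _ (t0 m); rewrite F2 in ga.
    have E : m.+1%:R = m.-1.+1%:R + 1 :> R by rewrite natr1 prednK.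
    have h6 := tauT n; have h7 := t0 m.
    by rewrite /ll in h5 ga *; rewrite E; nra.
  left; apply: le_trans (psi_right n _ _ nt (ltW lt) (t0 _)) _.
  by rewrite F2 in gb; move: gb T0; lra.
pose idx i := iter i next 0%N.
exists (fun i => phi (tau (idx i)) - (idx i).+1%:R * tau (idx i)), (fun i => tau (idx i)), (fun i => (idx i).+1), (L + T).
have lE i t : phi (tau (idx i)) - (idx i).+1%:R * tau (idx i) + (idx i).+1%:R * t = ll (idx i) t.
  by rewrite /ll; ring.
have ii i : (i <= idx i)%N.
  elim: i => // i IH; apply: leq_ltn_trans IH _; have [h _ _ _] := nextP (idx i); exact: h.
split.
- exact: t0.
- by move=> i; apply: tmono; have [h _ _ _] := nextP (idx i); exact: ltnW.
- move=> t tn; have t2 : t / 2 < 0 by lra.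
  have [n0 hn0] := tcvg _ t2; exists n0; apply: lt_le_trans (hn0 _ (ii n0)); lra.
- by split=> i; rewrite !lE; have [_ h1 h2 _] := nextP (idx i).
- move=> i t ti ti1; rewrite !lE.
  have tn : t < 0 by exact: le_lt_trans ti1 (t0 _).
  have LT : 0 <= L + T by rewrite addr_ge0// ltW.
  have h1 := F1 (idx i) t tn; have h2 := F1 (idx i.+1) t tn.
  by split; [lra|lra|exact: cover].
Qed.

End convex_lines.

Lemma scale_sequence_le (R : realType) (g w : R -> R) (d1 d2 : R) : 0 <= d1 -> d1 <= d2 ->
  (forall r, 0 <= r -> r < 1 -> 0 <= g r) -> scale_sequence g w d1 -> scale_sequence g w d2.
Proof.
move=> d10 d12 g0 [a [N [r0 [K [a0 Nk r01 K0 H]]]]].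
exists a, N, r0, K; split=> // r hr r1; have [q [h1 h2 h3]] := H r hr r1.
exists q; split=> // j jq; apply: le_trans (h3 j jq) _.
have r00 : 0 <= r by apply: le_trans hr; case/andP: r01.
rewrite ler_wpM2r//.
  by rewrite mulr_ge0 ?exprn_ge0 ?g0// ltW.
by rewrite lerXn2r ?nnegrE ?(le_trans d10).
Qed.

Lemma scale_sequence_small (R : realType) (g w : R -> R) :
  (forall r, 0 <= r -> r < 1 -> 0 <= g r) ->
  (forall L : R, 0 < L -> scale_sequence g w (expR (- L))) ->
  forall dl : R, 0 < dl -> scale_sequence g w dl.
Proof.
move=> g0 H dl dl0; pose m := Num.min dl (1 / 2).
have m0 : 0 < m by rewrite lt_min dl0 divr_gt0.
have m1 : m < 1 by rewrite gt_min ltr_pdivrMr// mul1r ltr1n orbT.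
apply: (@scale_sequence_le _ _ _ m) => //; first exact: ltW.
  by rewrite ge_min lexx.
have -> : m = expR (- - ln m) by rewrite opprK lnK.
by apply: H; rewrite oppr_gt0 ln_lt0// m0.
Qed.

Lemma weight_continuous (R : realType) (w : R -> R) (r : R) :
  is_weight w -> 0 < r -> r < 1 -> {for r, continuous w}.
Proof.
move=> [_ _ cw _] r0 r1; apply/cvgrPdist_lt => e e0.
have rin : `[0, 1[%classic r by rewrite /= in_itv /= (ltW r0).
have [dl dl0 H] := (within_continuousP _ _).1 cw r rin e e0.
apply/nbhs_ballP; exists (Num.min dl (Num.min r (1 - r))) => /=.
  by rewrite !lt_min dl0 r0 subr_gt0.
move=> s; rewrite /ball_ /= !lt_min => /andP[h1 /andP[h2 h3]].
have /ltr_normlP[h4 h5] := h3; have /ltr_normlP[h6 h7] := h2.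
by apply: H => //; rewrite /= in_itv /=; apply/andP; split; lra.
Qed.

Lemma weight_unbounded (R : realType) (w : R -> R) (M : R) :
  is_weight w -> exists r, [/\ 0 <= r, r < 1 & M <= w r].
Proof.
move=> [_ _ _ wub]; apply: contrapT => H; apply: wub; exists M => _ [r /= rin <-].
move: rin; rewrite in_itv /= => /andP[r0 r1]; rewrite leNgt; apply/negP => h.
by apply: H; exists r; rewrite r0 r1 ltW.
Qed.

Lemma scale_sequence_log_convex (R : realType) (v : R -> R) :
  is_weight v -> log_convex v -> forall dl : R, 0 < dl -> scale_sequence id v dl.
Proof.
move=> hv cv; apply: scale_sequence_small => // L L0; have [v0 vm _ _] := hv.
pose phi t := ln (v (expR t)).
have e1 (t : R) : t < 0 -> expR t < 1 by move=> t0; rewrite expR_lt1.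
have ve (t : R) : t < 0 -> 0 < v (expR t) by move=> t0; rewrite v0 ?expR_ge0 ?e1.
have [] := @convex_lines R phi L (ln (v 0)) L0.
- move=> x y l x0 y0 l0 l1.
  have := cv (Itv01 l0 l1) x y; rewrite !inE /= !in_itv /=; exact.
- move=> x y xy y0; have x0 := le_lt_trans xy y0.
  by rewrite ler_ln ?posrE ?ve// vm ?expR_ge0 ?ler_expR ?e1.
- by move=> t t0; rewrite ler_ln ?posrE ?ve ?v0// vm ?expR_ge0 ?e1.
- move=> M; have [r [r0 r1 hr]] := weight_unbounded (expR M) hv.
  have s0 : 0 < (r + 1) / 2 by lra.
  have s1 : (r + 1) / 2 < 1 by lra.
  exists (ln ((r + 1) / 2)); first by rewrite ln_lt0// s0.
  rewrite /phi lnK ?posrE// -[leLHS]expRK ler_ln ?posrE ?expR_gt0 ?v0 ?(ltW s0)//.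
  by apply: le_trans hr _; apply: vm => //; lra.
- move=> t t0; apply: (@continuous_comp _ _ _ (fun t => v (expR t)) (@ln R)); last first.
    by apply: continuous_ln; exact: ve.
  apply: (@continuous_comp _ _ _ (@expR R) v); first exact: continuous_expR.
  by apply: weight_continuous => //; rewrite ?expR_gt0 ?e1.
move=> b [tau [N [K [t0 tle tc [lg rg] nr]]]].
apply: (@scale_sequence_of_lines _ phi b tau N L K L0 tle tc lg rg nr _ _ (expR (tau 0%N))).
- exact: expR_ge0.
- exact: e1.
move=> r hr r1; have r0 : 0 < r by apply: lt_le_trans hr; exact: expR_gt0.
split=> //.
- by rewrite -[leLHS]expRK ler_ln ?posrE ?expR_gt0.
- by rewrite v0 // ltW.
- by rewrite /phi lnK.
Qed.

(** * Envelopes for doubling weights *)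

Lemma linear_le_exp2 (R : realType) (a b : R) : 0 <= a -> 0 <= b ->
  exists k : nat, k%:R * a + b <= 2 ^+ k.
Proof.
move=> a0 b0; pose j := (Num.truncn (2 * a + b)).+1.
have /andP[_ hj] : (Num.truncn (2 * a + b))%:R <= 2 * a + b < j%:R.
  by apply: truncn_itv; rewrite addr_ge0 ?mulr_ge0.
exists (j + j)%N; rewrite exprD natrD.
have h : j%:R + 1 <= 2 ^+ j :> R.
  by rewrite natr1 -natrX ler_nat ltn_expl.
have j0 : 1 <= j%:R :> R by rewrite ler1n.
apply: (@le_trans _ _ ((j%:R + 1) * (j%:R + 1))); last by rewrite ler_pM// addr_ge0.
by nra.
Qed.

(** [phi] need not be convex, so the lines are not tangents. To the right of [tau i] line i stays
    within a constant of [phi (tau i)], to the left it falls steeply; between [tau i] and [tau i.+1]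
    it is within D + O(1) of [phi], which grows by D only. *)
Lemma doubling_lines (R : realType) (phi : R -> R) (A' L : R) : 0 < L -> 0 <= A' ->
  (forall x y, - (1 / 2) <= x -> x <= y -> y < 0 -> phi x <= phi y) ->
  (forall x, - (1 / 2) <= x -> x < 0 -> phi (x / 2) <= phi x + A') ->
  (forall c, phi (- (1 / 2)) < c -> exists t, [/\ - (1 / 2) <= t, t < 0 & phi t = c]) ->
  exists (b tau : nat -> R) (N : nat -> nat) (K : R),
  [/\ tau 0 = - (1 / 2), forall i, tau i <= tau i.+1, forall t, t < 0 -> exists i, t < tau i,
   (forall i, L <= (b i + (N i)%:R * tau i) - (b i.+1 + (N i.+1)%:R * tau i)) /\
   (forall i, L <= (b i.+1 + (N i.+1)%:R * tau i.+1) - (b i + (N i)%:R * tau i.+1))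
   & forall i t, tau i <= t -> t <= tau i.+1 ->
     [/\ b i + (N i)%:R * t <= phi t + K, b i.+1 + (N i.+1)%:R * t <= phi t + K
       & phi t <= Num.max (b i + (N i)%:R * t) (b i.+1 + (N i.+1)%:R * t) + K]].
Proof.
move=> L0 A0 mono dbl ivt.
(* D must exceed k A', the growth of [phi] over k halvings of the distance to 0, while 2^k must be
   at least D + L + 2 for the line i + 1 to lie L below line i at [tau i]. As D is affine in k, a
   large k satisfies both. *)
have [k hk] : exists k : nat, k%:R * (A' + 1) + (2 * L + 4) <= 2 ^+ k.
  by apply: linear_le_exp2; lra.
(* phi increases by D from tau i to tau i.+1, which by doubling shrinks the distance
   to 0 by a factor 2 ^ k at least; the line through (tau i, phi (tau i)) has slope
   about 1 / |tau i|. *)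
pose D := k%:R * (A' + 1) + L + 2.
have kA : 0 <= k%:R * A' by rewrite mulr_ge0.
have k0 : 0 <= k%:R :> R by [].
have DL : L + 2 <= D by rewrite /D; nra.
have DkA : k%:R * A' < D by rewrite /D; nra.
have D2k : D + L + 2 <= 2 ^+ k by rewrite /D; nra.
have D0 : 0 < D by lra.
have /choice[tau htau] : forall i : nat, exists t, [/\ - (1 / 2) <= t, t < 0,
    phi t = phi (- (1 / 2)) + i%:R * D & (i = 0%N -> t = - (1 / 2))].
  move=> [|i]; first by exists (- (1 / 2)); split => //; lra.
  have [|t [h1 h2 h3]] := ivt (phi (- (1 / 2)) + i.+1%:R * D).
    by rewrite ltrDl mulr_gt0.
  by exists t.
have t1 i : - (1 / 2) <= tau i by case: (htau i).
have t0 i : tau i < 0 by case: (htau i).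
have tp i : phi (tau i.+1) = phi (tau i) + D.
  by have [_ _ -> _] := htau i.+1; have [_ _ -> _] := htau i; rewrite -natr1; ring.
have tlt i : tau i < tau i.+1.
  rewrite ltNge; apply/negP => h; have := mono _ _ (t1 _) h (t0 _); rewrite tp.
  by move: D0; lra.
have scal i j : (j <= k)%N -> phi (tau i / 2 ^+ j) <= phi (tau i) + j%:R * A'.
  elim: j => [|j IH] jk; first by rewrite expr0 divr1 mul0r addr0.
  have p0 : 0 < 2 ^+ j :> R by rewrite exprn_gt0.
  have p1 : 1 <= 2 ^+ j :> R by rewrite exprn_ege1// ler1n.
  have -> : tau i / 2 ^+ j.+1 = tau i / 2 ^+ j / 2 by rewrite exprSr; field; rewrite gt_eqF.
  apply: le_trans (dbl _ _ _) _.
  - by rewrite ler_pdivlMr//; have := t1 i; nra.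
  - by rewrite pmulr_llt0 ?invr_gt0.
  by have := IH (ltnW jk); rewrite -natr1; lra.
have thin i : tau i / 2 ^+ k <= tau i.+1.
  rewrite leNgt; apply/negP => h.
  have p0 : 0 < 2 ^+ k :> R by rewrite exprn_gt0.
  have := mono _ _ (t1 _) (ltW h) (_ : tau i / 2 ^+ k < 0).
  rewrite pmulr_llt0 ?invr_gt0// => /(_ (t0 i)); have := scal i k (leqnn k); rewrite tp.
  by move: DkA; lra.
(* The least integer above 1 / |tau i|; thus N i |tau i| lies between 1 and 3/2. *)
pose N i := (Num.truncn (- tau i)^-1).+1.
have Nt i : 1 <= (N i)%:R * - tau i /\ (N i)%:R * - tau i <= 1 - tau i.
  have ti : 0 < - tau i by rewrite oppr_gt0.
  have /truncn_itv/andP[h1 h2] : 0 <= (- tau i)^-1 by rewrite invr_ge0 ltW.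
  split.
    by rewrite -ler_pdivrMr// mul1r ltW.
  have -> : 1 - tau i = ((- tau i)^-1 + 1) * - tau i by rewrite mulrDl mulVf ?gt_eqF// mul1r.
  by rewrite ler_pM2r// /N -natr1 lerD2r h1.
exists (fun i => phi (tau i) - (N i)%:R * tau i), tau, N, (D + 2); split.
- by have [_ _ _ ->] := htau 0%N.
- by move=> i; exact: ltW.
- move=> t tn; pose s := Num.max t (- (1 / 2)).
  have s0 : s < 0 by rewrite gt_max tn; lra.
  have s1 : - (1 / 2) <= s by rewrite le_max lexx orbT.
  pose q := (phi s - phi (- (1 / 2))) / D.
  have q0 : 0 <= q by rewrite divr_ge0 ?subr_ge0 ?mono// ltW.
  have /andP[_ hq] := truncn_itv q0.
  exists (Num.truncn q).+1; apply: le_lt_trans (_ : s < _); first by rewrite le_max lexx.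
  rewrite ltNge; apply/negP => h; have := mono _ _ (t1 _) h s0.
  have [_ _ -> _] := htau (Num.truncn q).+1.
  by move: hq; rewrite /q ltr_pdivrMr//; lra.
- split=> i.
    have [h1 _] := Nt i.+1; have h2 := thin i; rewrite tp.
    have p0 : 0 < 2 ^+ k :> R by rewrite exprn_gt0.
    have h3 : 2 ^+ k <= (N i.+1)%:R * - tau i.
      have h4 : 2 ^+ k * - tau i.+1 <= - tau i.
        by rewrite mulrN lerN2 mulrC -ler_pdivrMr.
      apply: le_trans (_ : (N i.+1)%:R * (2 ^+ k * - tau i.+1) <= _); last by rewrite ler_wpM2l.
      by rewrite mulrCA ler_peMr// ltW.
    have h4 : (N i.+1)%:R * - tau i.+1 <= 1 - tau i.+1 by case: (Nt i.+1).
    have h5 := t1 i.+1.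
    by lra.
  have [_ h1] := Nt i; rewrite tp; have h2 := t1 i; have h3 := t0 i.+1.
  have h4 : (N i)%:R * tau i.+1 <= 0 by rewrite mulr_ge0_le0// ltW.
  by lra.
- move=> i t ti ti1.
  have h1 := mono _ _ (t1 i) ti (le_lt_trans ti1 (t0 _)).
  have h2 := mono _ _ (le_trans (t1 i) ti) ti1 (t0 _); rewrite tp in h2.
  have [_ h3] := Nt i; have h4 := t1 i.
  have h5 : (N i)%:R * t <= 0 by rewrite mulr_ge0_le0// ltW// (le_lt_trans ti1).
  have h6 : (N i.+1)%:R * t <= (N i.+1)%:R * tau i.+1 by rewrite ler_wpM2l.
  have h7 : (N i)%:R * tau i <= (N i)%:R * t by rewrite ler_wpM2l.
  split; rewrite ?tp; try lra.
  by rewrite -lerBlDr le_max; apply/orP; left; lra.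
Qed.

(** In the variable t = (r^2 - 1) / 2, which runs over [-1/2, 0[, halving t halves 1 - r^2 and at
    worst divides 1 - r by 4. Two applications of doubling bound the growth of ln w by 2 ln A. *)
Lemma scale_sequence_doubling (R : realType) (w : R -> R) :
  is_weight w -> doubling w ->
  forall dl : R, 0 < dl -> scale_sequence (fun r => expR ((r ^+ 2 - 1) / 2)) w dl.
Proof.
move=> hw [A A1 dbl]; apply: scale_sequence_small => [r _ _|L L0]; first exact: expR_ge0.
have [w0 wm _ _] := hw.
pose rad (t : R) := Num.sqrt (1 + 2 * t).
have r0 t : 0 <= rad t by exact: sqrtr_ge0.
have r1 t : t < 0 -> rad t < 1.
  by move=> t0; rewrite -[ltRHS]sqrtr1 ltr_sqrt//; lra.
have radK r : 0 <= r -> rad ((r ^+ 2 - 1) / 2) = r.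
  move=> hr; rewrite /rad; have -> : 1 + 2 * ((r ^+ 2 - 1) / 2) = r ^+ 2 by field.
  by rewrite sqrtr_sqr ger0_norm.
have sqr_rad t : - (1 / 2) <= t -> rad t ^+ 2 = 1 + 2 * t by move=> h; rewrite sqr_sqrtr//; lra.
pose phi t := ln (w (rad t)).
have mono x y : - (1 / 2) <= x -> x <= y -> y < 0 -> phi x <= phi y.
  move=> hx xy y0; rewrite ler_ln ?posrE ?w0 ?r1 ?(le_lt_trans xy)//.
  by apply: wm => //; [apply: ler_wsqrtr; lra|exact: r1].
have radh : rad (- (1 / 2)) = 0.
  by rewrite /rad (_ : 1 + 2 * - (1 / 2) = 0) ?sqrtr0//; field.
have ivt c : phi (- (1 / 2)) < c -> exists t, [/\ - (1 / 2) <= t, t < 0 & phi t = c].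
  rewrite /phi radh => hc; have [r [hr0 hr1 hr]] := weight_unbounded (expR c) hw.
  have w00 : w 0 <= expR c by rewrite -[leLHS]lnK ?posrE ?w0// ler_expR ltW.
  have cw : {within `[0, r], continuous w}.
    apply: continuous_subspaceW (_ : `[0, r] `<=` `[0, 1[)%classic _; last by case: hw.
    by move=> s; rewrite /= !in_itv /= => /andP[-> sr]; exact: le_lt_trans hr1.
  have [|s] := IVT hr0 cw (v := expR c).
    by rewrite min_l ?(le_trans w00)// max_r ?(le_trans w00)// w00.
  rewrite in_itv /= => /andP[s0 sr] ws; have s1 := le_lt_trans sr hr1.
  exists ((s ^+ 2 - 1) / 2); split; [|have : s ^+ 2 < 1 by rewrite expr_lt1|].
  - by have := sqr_ge0 s; lra.
  - by lra.
  - by rewrite radK// ws expRK.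
have dphi x : - (1 / 2) <= x -> x < 0 -> phi (x / 2) <= phi x + 2 * ln A.
  move=> hx x0; have A0 : 0 < A by rewrite (lt_trans _ A1).
  have x20 : x / 2 < 0 by lra.
  have wx : 0 < w (rad x) by rewrite w0// r1.
  have -> : phi x + 2 * ln A = ln (A * (A * w (rad x))).
    by rewrite !lnM ?posrE ?mulr_gt0// /phi; ring.
  rewrite ler_ln ?posrE ?mulr_gt0// ?w0 ?r1//.
  pose s := 1 - rad x.
  have s0 : 0 < s by rewrite subr_gt0 r1.
  have s1 : s <= 1 by rewrite gerBl.
  have E : rad x = 1 - s by rewrite /s; ring.
  have d1 := dbl s s0 s1; have d2 := dbl (s / 2) ltac:(lra) ltac:(lra).
  rewrite -E in d1.
  apply: (@le_trans _ _ (w (1 - s / 2 / 2))); last first.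
    by apply: le_trans d2 _; rewrite ler_pM2l.
  apply: wm => //; last by lra.
  have p0 : 0 <= 1 - s / 2 / 2 by lra.
  rewrite -(@ler_pXn2r _ 2)// ?nnegrE// sqr_rad; last by lra.
  by have := sqr_rad x hx; rewrite E; nra.
have [|b [tau [N [K [t0 tle tc [lg rg] nr]]]]] := doubling_lines L0 _ mono dphi ivt.
  by rewrite mulr_ge0 ?ln_ge0// ltW.
apply: (@scale_sequence_of_lines _ phi b tau N L K L0 tle tc lg rg nr _ _ 0) => // r hr hr1.
have h : r ^+ 2 < 1 by rewrite expr_lt1.
rewrite t0 expRK; split => //.
- exact: expR_gt0.
- by rewrite expR_lt1; lra.
- by have := sqr_ge0 r; lra.
- by rewrite w0.
- by rewrite /phi radK.
Qed.

Lemma sqrt_nat_le (R : realType) (n : nat) : Num.sqrt n%:R <= n%:R :> R.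
Proof.
have -> : n%:R = Num.sqrt (n%:R ^+ 2) :> R by rewrite sqrtr_sqr ger0_norm.
by rewrite ler_wsqrtr// sqrtr_sqr ger0_norm// -natrX ler_nat; case: n => // n; rewrite expnS leq_pmulr.
Qed.

(** * Gaussian blocks on a lattice *)

Section gauss_block.
Variables (R : realType) (M : nat).
Implicit Types y : 'I_M -> R.

Definition gauss (k : 'I_M -> nat) y : R := expR (- (\sum_i ((k i)%:R - y i) ^+ 2 / 2)).

(* exp(-u^2/2) <= exp(2 - 2|u|); half of the decay is spent on D. *)
Lemma gauss_le (k : 'I_M -> nat) y (D : R) : D <= \sum_i `|(k i)%:R - y i| ->
  gauss k y <= expR 2 ^+ M * expR (- D) * \prod_i expR (- `|(k i)%:R - y i|).
Proof.
move=> hD; rewrite -expR_sum -expRM_natl -!expRD ler_expR sumrN.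
apply: (@le_trans _ _ (\sum_(i < M) (2 - `|(k i)%:R - y i| - `|(k i)%:R - y i|))).
  rewrite -sumrN; apply: ler_sum => i _.
  by rewrite -[_ ^+ 2]real_normK ?num_real//; have := sqr_ge0 (`|(k i)%:R - y i| - 2); nra.
rewrite !big_split /= !sumrN sumr_const card_ord -mulr_natl.
by lra.
Qed.

Lemma expRN1_le_half : expR (- 1) <= 1 / 2 :> R.
Proof.
rewrite expRN mul1r lef_pV2 ?posrE ?expR_gt0//.
by have := expR_ge1Dx (1 : R); lra.
Qed.

(** The factor e pays for replacing y by its integer part; 3 = 1 + 4 / 2 comes from [sum_adist] with
    the ratio 1/e <= 1/2. *)
Definition gauss_cst : R := expR 1 * 3.

Lemma gauss_cst_gt0 : 0 < gauss_cst.
Proof. by rewrite mulr_gt0 ?expR_gt0. Qed.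

Lemma sum_expRN_dist (K : nat) (y : R) : 0 <= y ->
  \sum_(k < K) expR (- `|k%:R - y|) <= gauss_cst.
Proof.
move=> y0; have /andP[f1 f2] := truncn_itv y0; set f := Num.truncn y in f1 f2.
have h (k : nat) : expR (- `|k%:R - y|) <= expR 1 * expR (- 1) ^+ adist k f.
  rewrite -expRM_natl -expRD ler_expR /adist natrD.
  rewrite -natr1 in f2.
  have [kf|fk] := leqP k f.
    have -> : (k - f = 0)%N by apply/eqP.
    rewrite natrB// -normrN opprB; have := ler_norm (y - k%:R).
    by lra.
  have -> : (f - k = 0)%N by apply/eqP; exact: ltnW.
  rewrite natrB ?(ltnW fk)//; have := ler_norm (k%:R - y).
  by lra.
apply: (@le_trans _ _ (\sum_(k < K) expR 1 * expR (- 1) ^+ adist k f)).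
  by apply: ler_sum => k _.
rewrite -mulr_sumr ler_wpM2l ?expR_ge0//.
have hh := expRN1_le_half.
have := @sum_adist R (expR (- 1)) K f (expR_ge0 _) hh.
have : \sum_(k < K | ~~ (k != f :> nat)) expR (- 1) ^+ adist k f <= 1 :> R.
  have [fK|Kf] := ltnP f K; last first.
    rewrite big1 // => i /negPn/eqP e; move: (ltn_ord i); by rewrite e ltnNge Kf.
  rewrite (big_pred1 (Ordinal fK)); first by rewrite /adist /= !subnn expr0.
  by move=> i; rewrite negbK /= -val_eqE.
by rewrite [X in _ -> _ -> X <= _](bigID (fun k : 'I_K => k != f :> nat)) /=; lra.
Qed.

Lemma sum_prod_expRN (K : nat) y : (forall i, 0 <= y i) ->
  \sum_(k : {ffun 'I_M -> 'I_K}) \prod_i expR (- `|(k i)%:R - y i|) <= gauss_cst ^+ M.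
Proof.
move=> y0; rewrite -(bigA_distr_bigA (fun i (j : 'I_K) => expR (- `|j%:R - y i|))) /=.
rewrite -[M in leRHS]card_ord -prodr_const; apply: ler_prod => i _.
by rewrite sumr_ge0 ?sum_expRN_dist// => j _; exact: expR_ge0.
Qed.

Definition block_cst : R := expR 2 ^+ M * gauss_cst ^+ M.

Lemma block_cst_gt0 : 0 < block_cst.
Proof. by rewrite mulr_gt0 ?exprn_gt0 ?expR_gt0 ?gauss_cst_gt0. Qed.

Definition fval K (k : {ffun 'I_M -> 'I_K}) (i : 'I_M) : nat := k i.

Lemma sum_gauss_le (K : nat) y (D : R) (P : pred {ffun 'I_M -> 'I_K}) : (forall i, 0 <= y i) ->
  (forall k, P k -> D <= \sum_i `|(k i)%:R - y i|) ->
  \sum_(k | P k) gauss (fval k) y <= block_cst * expR (- D).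
Proof.
move=> y0 hD.
apply: (@le_trans _ _ (\sum_(k | P k) expR 2 ^+ M * expR (- D) * \prod_i expR (- `|(k i)%:R - y i|))).
  by apply: ler_sum => k /hD; exact: gauss_le.
rewrite -mulr_sumr /block_cst [leRHS]mulrAC ler_wpM2l ?mulr_ge0 ?exprn_ge0 ?expR_ge0//.
apply: le_trans (sum_prod_expRN K y0); rewrite big_mkcond; apply: ler_sum => k _.
have h : 0 <= \prod_i expR (- `|(k i)%:R - y i|) :> R by apply: prodr_ge0 => i _; exact: expR_ge0.
by case: ifP.
Qed.

Lemma block_le (K : nat) y (P : pred {ffun 'I_M -> 'I_K}) (a : ('I_M -> nat) -> R) (G : R) :
  (forall i, 0 <= y i) -> 0 <= G ->
  (forall k : {ffun 'I_M -> 'I_K}, `|a (fval k)| <= G * gauss (fval k) y) ->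
  `|\sum_(k | P k) a (fval k)| <= block_cst * G.
Proof.
move=> y0 G0 ha; apply: le_trans (ler_norm_sum _ _ _) _.
apply: (@le_trans _ _ (\sum_(k | P k) G * gauss (fval k) y)); first by apply: ler_sum.
rewrite -mulr_sumr mulrC ler_wpM2r//.
rewrite -[leRHS]mulr1 -[1 in leRHS](@expR0 R) -[in expR 0]oppr0.
by apply: sum_gauss_le => // k _; apply: sumr_ge0.
Qed.

Definition residue (K B : nat) (c : {ffun 'I_M -> 'I_B}) : pred {ffun 'I_M -> 'I_K} :=
  fun k => [forall i, (k i %% B == c i)%N].

(** c is the residue class of the integer part of y. Any other point of the class differs from it by
    at least B in some coordinate, hence is at distance at least B - 1 from y. The two families a
    and b share c, so they can be the real and imaginary parts of one complex family. *)
Lemma block_ge (K B : nat) y (a b : ('I_M -> nat) -> R) (G c0 : R) : (0 < B)%N ->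
  (forall i, 0 <= y i) -> (forall i, y i < K%:R) -> 0 <= G ->
  (forall k : {ffun 'I_M -> 'I_K}, `|a (fval k)| <= G * gauss (fval k) y) ->
  (forall k : {ffun 'I_M -> 'I_K}, `|b (fval k)| <= G * gauss (fval k) y) ->
  c0 * G <= `|a (fun i => Num.truncn (y i))| + `|b (fun i => Num.truncn (y i))| ->
  exists c : {ffun 'I_M -> 'I_B},
    (c0 - 2 * (block_cst * expR (1 - B%:R))) * G <=
    `|\sum_(k : {ffun 'I_M -> 'I_K} | residue c k) a (fval k)| +
    `|\sum_(k : {ffun 'I_M -> 'I_K} | residue c k) b (fval k)|.
Proof.
move=> B0 y0 yK G0 ha hb hc.
have tr i : (Num.truncn (y i))%:R <= y i < (Num.truncn (y i)).+1%:R by exact: truncn_itv.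
have trK i : (Num.truncn (y i) < K)%N.
  by have /andP[h _] := tr i; rewrite -(ltr_nat R) (le_lt_trans h).
pose ks : {ffun 'I_M -> 'I_K} := [ffun i => Ordinal (trK i)].
have ksE : (fun i => Num.truncn (y i)) = fval ks.
  by apply/funext => i; rewrite /fval ffunE.
pose c : {ffun 'I_M -> 'I_B} := [ffun i => Ordinal (ltn_pmod (ks i) B0)].
have cks : residue c ks by apply/forallP => i; rewrite !ffunE.
have far k : residue c k && (k != ks) -> B%:R - 1 <= \sum_i `|(k i)%:R - y i| :> R.
  move=> /andP[/forallP kc /eqP kks].
  have [i ki] : exists i, k i != ks i.
    apply: contrapT => H; apply: kks; apply/ffunP => i; apply/eqP; apply: contrapT => h.
    by apply: H; exists i; apply/negP.
  apply: (@le_trans _ _ `|(k i)%:R - y i|); last first.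
    by rewrite (bigD1 i)//= lerDl sumr_ge0.
  have E : (k i = ks i %[mod B])%N by have := kc i; rewrite [c i]ffunE => /eqP.
  have ksi : (ks i : nat) = Num.truncn (y i) by rewrite ffunE.
  have /andP[t1 t2] := tr i; rewrite -ksi -natr1 in t1 t2.
  have [lt|gt|eq] := ltngtP (k i) (ks i); last by case/eqP: ki; exact: val_inj.
    have : (k i + B <= ks i)%N.
      have /dvdn_leq : (B %| ks i - k i)%N by rewrite -eqn_mod_dvd ?(ltnW lt)// eq_sym; apply/eqP.
      by rewrite subn_gt0 lt => /(_ isT); rewrite leq_subRL ?(ltnW lt).
    rewrite -(ler_nat R) natrD => h; rewrite -normrN opprB.
    by have := ler_norm (y i - (k i)%:R); lra.
  have : (ks i + B <= k i)%N.
    have /dvdn_leq : (B %| k i - ks i)%N by rewrite -eqn_mod_dvd ?(ltnW gt)//; apply/eqP.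
    by rewrite subn_gt0 gt => /(_ isT); rewrite leq_subRL ?(ltnW gt).
  rewrite -(ler_nat R) natrD => h.
  by have := ler_norm ((k i)%:R - y i); lra.
have one : forall u : ('I_M -> nat) -> R, (forall k : {ffun 'I_M -> 'I_K}, `|u (fval k)| <= G * gauss (fval k) y) ->
    `|u (fval ks)| - block_cst * expR (1 - B%:R) * G <=
    `|\sum_(k : {ffun 'I_M -> 'I_K} | residue c k) u (fval k)|.
  move=> u hu; rewrite (bigD1 ks cks) /=.
  have : `|\sum_(k | residue c k && (k != ks)) u (fval k)| <= block_cst * expR (1 - B%:R) * G.
    apply: le_trans (ler_norm_sum _ _ _) _.
    apply: (@le_trans _ _ (\sum_(k | residue c k && (k != ks)) G * gauss (fval k) y)); first by apply: ler_sum.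
    by rewrite -mulr_sumr mulrC ler_wpM2r// -[1 - B%:R]opprB; exact: sum_gauss_le.
  set s := \sum_(_ | _) _ => hs.
  have h3 : `|u (fval ks)| <= `|u (fval ks) + s| + `|s|.
    by rewrite -{1}[u (fval ks)](addrK s); exact: ler_normB.
  by move: hs h3; lra.
exists c; rewrite ksE in hc; have := one a ha; have := one b hb.
by move: hc; lra.
Qed.

End gauss_block.

Section blocks.
Variables (R : realType) (d M : nat) (g : R -> R) (K : nat -> nat).
Let Bl := @uball R d.
Hypothesis g0 : forall r, 0 <= r -> r < 1 -> 0 <= g r.
Hypothesis gm : forall r s, 0 <= r -> r < s -> s < 1 -> g r < g s.
Hypothesis Kn : forall n, (K n <= 2 * n.+1)%N.

Definition tame_terms (f : nat -> ('I_M -> nat) -> 'rV[R]_d -> R) :=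
  exists df ddf, [/\ forall n k, C1 Bl (f n k) (df n k),
    forall n k i, C1 Bl (df n k i) (ddf n k i),
    forall n k x, Bl x -> \sum_i ddf n k i i x = 0
  & forall rho : R, rho < 1 -> exists (C rho' : R) (L : nat), [/\ 0 <= C, 0 <= rho', rho' < 1
    & forall n (k : {ffun 'I_M -> 'I_(K n)}) x, enorm x <= rho ->
      [/\ `|f n (fval k) x| <= C * n.+1%:R ^+ L * g rho' ^+ n,
       forall i, `|df n (fval k) i x| <= C * n.+1%:R ^+ L * g rho' ^+ n
     & forall i j, `|ddf n (fval k) i j x| <= C * n.+1%:R ^+ L * g rho' ^+ n]]].

(** The box has at most (2 (n + 1))^M points, a polynomial factor that tameness permits. *)
Lemma tame_block f (B : nat) (c : {ffun 'I_M -> 'I_B}) : tame_terms f ->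
  tame g (fun n x => \sum_(k : {ffun 'I_M -> 'I_(K n)} | residue c k) f n (fval k) x).
Proof.
move=> [df [ddf [Cf Cdf tr bd]]].
exists (fun n i x => \sum_(k : {ffun 'I_M -> 'I_(K n)} | residue c k) df n (fval k) i x).
exists (fun n i j x => \sum_(k : {ffun 'I_M -> 'I_(K n)} | residue c k) ddf n (fval k) i j x).
split.
- by move=> n; exact: C1_sum.
- by move=> n i; exact: C1_sum.
- by move=> n x Bx; rewrite exchange_big /= big1// => k _; exact: tr.
move=> rho r1; have [C [rho' [L [C0 r0' r1' H]]]] := bd rho r1.
exists (2 ^+ M * C), rho', (M + L)%N; split => //; first by rewrite mulr_ge0// exprn_ge0.
move=> n x xr.
have b0 : 0 <= C * n.+1%:R ^+ L * g rho' ^+ n by rewrite !mulr_ge0 ?exprn_ge0 ?g0.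
have S (u : {ffun 'I_M -> 'I_(K n)} -> R) : (forall k, `|u k| <= C * n.+1%:R ^+ L * g rho' ^+ n) ->
    `|\sum_(k | residue c k) u k| <= 2 ^+ M * C * n.+1%:R ^+ (M + L) * g rho' ^+ n.
  move=> hu; apply: le_trans (ler_norm_sum _ _ _) _.
  apply: (@le_trans _ _ (\sum_(k : {ffun 'I_M -> 'I_(K n)}) C * n.+1%:R ^+ L * g rho' ^+ n)).
    by rewrite big_mkcond; apply: ler_sum => k _; case: ifP.
  rewrite sumr_const card_ffun !card_ord -[leLHS]mulr_natl.
  have -> : 2 ^+ M * C * n.+1%:R ^+ (M + L) * g rho' ^+ n =
      (2 * n.+1%:R) ^+ M * (C * n.+1%:R ^+ L * g rho' ^+ n) by rewrite exprMn exprD; ring.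
  by rewrite ler_wpM2r// natrX lerXn2r ?nnegrE// -natrM ler_nat.
by split=> [|i|i j]; apply: S => k; have [h1 h2 h3] := H n k x xr.
Qed.

Variables (S : finType) (f : S -> bool -> nat -> ('I_M -> nat) -> 'rV[R]_d -> R).
Variables (w : R -> R) (c0 : R).
Hypothesis hw : is_weight w.
Hypothesis c00 : 0 < c0.
Hypothesis tf : forall s b, tame_terms (f s b).
Hypothesis bf : forall n x, Bl x -> exists2 y : S -> 'I_M -> R,
  forall s, [/\ forall i, 0 <= y s i, forall i, y s i < (K n)%:R
  & forall b (k : {ffun 'I_M -> 'I_(K n)}), `|f s b n (fval k) x| <= g (enorm x) ^+ n * gauss (fval k) (y s)]
  & exists s, let k := fun i => Num.truncn (y s i) in
    c0 * g (enorm x) ^+ n <= `|f s true n k x| + `|f s false n k x|.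

(** The functions are indexed by s, a residue class and a boolean. For each x a single s and a
    single class are bounded from below, and the remaining functions add only nonnegative terms; the
    upper bound holds for all of them. *)
Lemma approximable_of_blocks : (forall dl : R, 0 < dl -> scale_sequence g w dl) ->
  harmonically_approximable d w.
Proof.
set Cb := block_cst R M; have Cb0 : 0 < Cb by exact: block_cst_gt0.
(* Makes the contribution of the far points at most c0 / 2, as e^{B - 1} >= B > 4 Cb / c0. *)
pose B := (Num.truncn (4 * Cb / c0)).+1.
have hB : 2 * (Cb * expR (1 - B%:R)) <= c0 / 2.
  have q0 : 0 <= 4 * Cb / c0 by apply: divr_ge0; [apply: mulr_ge0 => //; exact: ltW|exact: ltW].
  have /andP[_] := truncn_itv q0; rewrite -/B ltr_pdivrMr// => h1.
  have h2 := expR_ge1Dx (B%:R - 1 : R); rewrite addrC subrK in h2.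
  rewrite -opprB expRN -ler_pdivlMl// ler_pdivrMr ?expR_gt0//.
  have : c0 * B%:R <= c0 * expR (B%:R - 1) by rewrite ler_wpM2l// ltW.
  by lra.
pose T : finType := (S * {ffun 'I_M -> 'I_B} * bool)%type.
pose P (t : T) n x := \sum_(k : {ffun 'I_M -> 'I_(K n)} | residue t.1.2 k) f t.1.1 t.2 n (fval k) x.
apply: (@approximable_of_scale R d w g T P Cb (c0 / 2)) => //.
- by move=> t; exact: tame_block.
- by rewrite divr_gt0.
- move=> t n x Bx; have [y hy _] := bf n Bx; have [y0 yK hf] := hy t.1.1.
  apply: (@block_le R M (K n) (y t.1.1) _ (fun k => f t.1.1 t.2 n k x)) => //.
  by rewrite exprn_ge0// g0 ?enorm_ge0.
- move=> n x Bx; have [y hy [s hs]] := bf n Bx; have [y0 yK hf] := hy s.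
  have G0 : 0 <= g (enorm x) ^+ n by rewrite exprn_ge0// g0 ?enorm_ge0.
  have [c hc] := @block_ge R M (K n) B (y s) (fun k => f s true n k x) (fun k => f s false n k x)
    _ _ isT y0 yK G0 (hf true) (hf false) hs.
  apply: le_trans (_ : (c0 - 2 * (Cb * expR (1 - B%:R))) * g (enorm x) ^+ n <= _).
    by rewrite ler_wpM2r//; move: hB; lra.
  apply: le_trans hc _.
  have ne : (true && ((s, c, false) != (s, c, true) :> T)) by rewrite /= xpair_eqE andbF.
  rewrite (bigD1 (s, c, true : bool) isT)/= (bigD1 (s, c, false : bool) ne)/= addrA.
  by rewrite lerDl; exact: sumr_ge0.
Qed.

End blocks.

(** * Blocks of exponentials *)

Section exponential_blocks.
Variables (R : realType) (d : nat).
Hypothesis d2 : (2 <= d)%N.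
Let Bl := @uball R d.
Implicit Types e f : 'I_d -> R.

(** Gives zeta = e + i f with zeta . zeta = 0. The vector f is a quarter turn, rescaled, of the
    projection of e to the plane of the first two coordinates; if that projection is 0, any vector
    of the plane with the right length will do. *)
Lemma perp_exists e : exists f, \sum_i e i * f i = 0 /\ \sum_i f i ^+ 2 = \sum_i e i ^+ 2.
Proof.
pose i0 : 'I_d := Ordinal (ltnW d2); pose i1 : 'I_d := Ordinal d2.
have i10 : i1 != i0 by [].
pose s := \sum_i e i ^+ 2.
have s0 : 0 <= s by apply: sumr_ge0 => i _; exact: sqr_ge0.
have [p [q [h1 h2]]] : exists p q : R, e i0 * p + e i1 * q = 0 /\ p ^+ 2 + q ^+ 2 = s.
  have [z|nz] := eqVneq (e i0 ^+ 2 + e i1 ^+ 2) 0.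
    exists (Num.sqrt s), 0; rewrite mulr0 addr0 expr0n /= addr0 sqr_sqrtr//; split => //.
    suff -> : e i0 = 0 by rewrite mul0r.
    by apply/eqP; rewrite -sqrf_eq0; apply/eqP; have := sqr_ge0 (e i0); have := sqr_ge0 (e i1); lra.
  pose c := Num.sqrt (s / (e i0 ^+ 2 + e i1 ^+ 2)).
  exists (c * - e i1), (c * e i0); split; first by ring.
  rewrite !exprMn -mulrDr sqrrN sqr_sqrtr; last by rewrite divr_ge0 ?addr_ge0 ?sqr_ge0.
  by rewrite [e i1 ^+ 2 + _]addrC divfK.
pose f i := if i == i0 then p else if i == i1 then q else 0.
have sumE (F : 'I_d -> R) : (forall i, i != i0 -> i != i1 -> F i = 0) -> \sum_i F i = F i0 + F i1.
  move=> hF; rewrite (bigD1 i0)//= (bigD1 i1)//= big1 ?addr0// => i /andP[h3 h4].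
  exact: hF.
have f0 : f i0 = p by rewrite /f eqxx.
have f1 : f i1 = q by rewrite /f (negbTE i10) eqxx.
have fz i : i != i0 -> i != i1 -> f i = 0 by rewrite /f => /negbTE -> /negbTE ->.
exists f; split.
  by rewrite sumE ?f0 ?f1// => i h3 h4; rewrite fz// mulr0.
by rewrite sumE ?f0 ?f1// => i h3 h4; rewrite fz// expr0n.
Qed.

Definition dotf e (x : 'rV[R]_d) : R := \sum_i e i * x 0 i.

Lemma C1_dotf U e : C1 U (dotf e) (fun i _ => e i).
Proof.
have S := C1_sum xpredT (fun i => C1Z (e i) (@C1_coord R d U i)).
apply: C1_ext S => // i x.
rewrite (bigD1 i)//= eqxx mulr1 big1 ?addr0// => j ji.
by rewrite (negbTE ji) mulr0.
Qed.

(* The real part of (a - ib) exp(c + (e + if).x). *)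
Definition plane_wave e f (c a b : R) (x : 'rV[R]_d) : R :=
  expR (c + dotf e x) * (a * cos (dotf f x) + b * sin (dotf f x)).

(** Differentiation multiplies the amplitude a - i b by e_i + i f_i, so that plane waves are closed
    under it. *)
Lemma C1_plane_wave U e f (c a b : R) : C1 U (plane_wave e f c a b)
  (fun i => plane_wave e f c (e i * a + f i * b) (e i * b - f i * a)).
Proof.
have CE := C1_comp (C1D (C1_cst c) (C1_dotf (U := U) e)) (@is_derive_expR R) (@continuous_expR R).
have Cc := C1_comp (C1_dotf (U := U) f) (@is_derive_cos R) (fun t => continuousN (@continuous_sin R t)).
have Cs := C1_comp (C1_dotf (U := U) f) (@is_derive_sin R) (@continuous_cos R).
apply: C1_ext (C1M CE (C1D (C1Z a Cc) (C1Z b Cs))) => // i x.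
rewrite /plane_wave /=; ring.
Qed.

Lemma plane_wave_le e f (c a b : R) x :
  `|plane_wave e f c a b x| <= expR (c + dotf e x) * (`|a| + `|b|).
Proof.
rewrite normrM ger0_norm ?expR_ge0// ler_wpM2l ?expR_ge0//.
apply: le_trans (ler_normD _ _) _; rewrite !normrM.
have c1 : `|cos (dotf f x)| <= 1 by rewrite ler_norml cos_geN1 cos_le1.
have s1 : `|sin (dotf f x)| <= 1 by rewrite ler_norml sin_geN1 sin_le1.
by rewrite lerD// ler_piMr.
Qed.

Lemma plane_wave_laplacian e f (c a b : R) x :
  \sum_i e i * f i = 0 -> \sum_i f i ^+ 2 = \sum_i e i ^+ 2 ->
  \sum_i plane_wave e f c (e i * (e i * a + f i * b) + f i * (e i * b - f i * a))
    (e i * (e i * b - f i * a) - f i * (e i * a + f i * b)) x = 0.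
Proof.
move=> h1 h2; rewrite /plane_wave -mulr_sumr.
set C := cos _; set S := sin _.
transitivity (expR (c + dotf e x) * ((\sum_i e i ^+ 2 - \sum_i f i ^+ 2) * (a * C + b * S)
   + (\sum_i e i * f i) * (2 * b * C - 2 * a * S))).
  congr (_ * _); rewrite -sumrB !mulr_suml -big_split /=; apply: eq_bigr => i _; ring.
by rewrite h1 h2 subrr; ring.
Qed.

(** The shift by n + 1 lets natural numbers k_i < 2 (n + 1) enumerate a box of integer vectors that
    contains sqrt(n) x for every x in the ball. *)
Let shift_freq (n : nat) (k : 'I_d -> nat) i : R := (k i)%:R - n.+1%:R.

Lemma shift_perp : exists F : nat -> ('I_d -> nat) -> 'I_d -> R, forall n k,
  \sum_i shift_freq n k i * F n k i = 0 /\ \sum_i F n k i ^+ 2 = \sum_i shift_freq n k i ^+ 2.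
Proof.
have /choice[F HF] := perp_exists.
by exists (fun n k => F (shift_freq n k)) => n k; exact: HF.
Qed.

Let K (n : nat) := (2 * n.+1)%N.
Let g (r : R) := expR ((r ^+ 2 - 1) / 2).

(** Completing the square, with kappa = [shift_freq n k]: - n/2 - |kappa|^2 / 2 + sqrt(n) kappa . x
    = n (|x|^2 - 1) / 2 - |kappa - sqrt(n) x|^2 / 2. This is the origin of g and of the factor
    sqrt(n) in the frequencies. *)
Lemma exp_modulus n k x :
  expR (- (n%:R / 2) - (\sum_i shift_freq n k i ^+ 2) / 2 +
    dotf (fun i => Num.sqrt n%:R * shift_freq n k i) x) =
  g (enorm x) ^+ n * gauss k (fun i => Num.sqrt n%:R * x 0 i + n.+1%:R).
Proof.
rewrite /g /gauss -expRM_natl -expRD sqr_enorm; congr expR.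
have E i : ((k i)%:R - (Num.sqrt n%:R * x 0 i + n.+1%:R)) ^+ 2 / 2 =
   shift_freq n k i ^+ 2 / 2 + n%:R * (x 0 i ^+ 2) / 2 - Num.sqrt n%:R * shift_freq n k i * x 0 i.
  have {2}-> : n%:R = Num.sqrt n%:R ^+ 2 :> R by rewrite sqr_sqrtr.
  by rewrite /shift_freq; field.
rewrite (eq_bigr _ (fun i _ => E i)) sumrB big_split /= -!mulr_suml -mulr_sumr /dotf.
by field.
Qed.

Let g_le (r s : R) : 0 <= r -> r <= s -> g r <= g s.
Proof.
move=> r0 rs; rewrite /g ler_expR ler_pM2r// lerD2r lerXn2r ?nnegrE//.
exact: le_trans rs.
Qed.

Let cstb (b : bool) : R := b%:R.

Lemma exp_terms_tame F : (forall n k,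
    \sum_i shift_freq n k i * F n k i = 0 /\ \sum_i F n k i ^+ 2 = \sum_i shift_freq n k i ^+ 2) ->
  forall b, tame_terms g K (fun n k => plane_wave (fun i => Num.sqrt n%:R * shift_freq n k i)
    (fun i => Num.sqrt n%:R * F n k i) (- (n%:R / 2) - (\sum_i shift_freq n k i ^+ 2) / 2)
    (cstb b) (cstb (~~ b))).
Proof.
move=> HF b.
pose e n k i := Num.sqrt n%:R * shift_freq n k i.
pose f n k i := Num.sqrt n%:R * F n k i.
pose c n k := - (n%:R / 2) - (\sum_i shift_freq n k i ^+ 2) / 2.
pose a1 n k i := e n k i * cstb b + f n k i * cstb (~~ b).
pose b1 n k i := e n k i * cstb (~~ b) - f n k i * cstb b.
pose a2 n k i j := e n k j * a1 n k i + f n k j * b1 n k i.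
pose b2 n k i j := e n k j * b1 n k i - f n k j * a1 n k i.
exists (fun n k i => plane_wave (e n k) (f n k) (c n k) (a1 n k i) (b1 n k i)).
exists (fun n k i j => plane_wave (e n k) (f n k) (c n k) (a2 n k i j) (b2 n k i j)).
split.
- by move=> n k; exact: C1_plane_wave.
- by move=> n k i; exact: C1_plane_wave.
- move=> n k x _; have [h1 h2] := HF n k.
  apply: plane_wave_laplacian; rewrite /e /f.
    rewrite (eq_bigr (fun i => Num.sqrt n%:R ^+ 2 * (shift_freq n k i * F n k i))).
      by rewrite -mulr_sumr h1 mulr0.
    by move=> i _; ring.
  rewrite (eq_bigr (fun i => Num.sqrt n%:R ^+ 2 * (F n k i ^+ 2))); last by move=> i _; ring.
  rewrite [RHS](eq_bigr (fun i => Num.sqrt n%:R ^+ 2 * (shift_freq n k i ^+ 2))); last by move=> i _; ring.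
  by rewrite -!mulr_sumr h2.
move=> rho r1; pose rho' := Num.max rho 0.
have r0' : 0 <= rho' by rewrite le_max lexx orbT.
(* Frequencies are at most h = d (n + 1)^2, and a derivative multiplies the bound on each amplitude
   by 2h; the two amplitudes after two derivatives add up to 8 h^2. *)
exists (8 * d%:R ^+ 2), rho', 4%N; split => //.
  by rewrite /rho' gt_max r1 ltr01.
move=> n k x xr.
have xr' : enorm x <= rho' by rewrite le_max xr.
have d1 : 1 <= d%:R :> R by rewrite ler1n; exact: ltnW.
have n1 : 1 <= n.+1%:R :> R by rewrite ler1n.
have sk i : `|shift_freq n (fval k) i| <= n.+1%:R.
  rewrite /shift_freq ler_norml; apply/andP; split; first by rewrite lerBrDr addNr.
  rewrite lerBlDr -natrD ler_nat addnn -mul2n; exact: ltnW (ltn_ord (k i)).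
have Fk i : `|F n (fval k) i| <= d%:R * n.+1%:R.
  rewrite -(@ler_pXn2r _ 2)// ?nnegrE ?mulr_ge0// real_normK ?num_real//.
  have [_ h] := HF n (fval k).
  apply: (@le_trans _ _ (\sum_j F n (fval k) j ^+ 2)).
    by rewrite (bigD1 i)//= lerDl; apply: sumr_ge0 => j _; exact: sqr_ge0.
  rewrite h; apply: (@le_trans _ _ (\sum_(j < d) n.+1%:R ^+ 2)).
    apply: ler_sum => j _; rewrite -[_ ^+ 2]real_normK ?num_real//.
    by rewrite lerXn2r ?nnegrE.
  rewrite sumr_const card_ord -[leLHS]mulr_natl exprMn ler_wpM2r ?exprn_ge0//.
  by rewrite expr2 ler_peMl.
pose h : R := d%:R * n.+1%:R ^+ 2.
have h0 : 0 <= h by rewrite mulr_ge0 ?exprn_ge0.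
have sn : Num.sqrt n%:R <= n.+1%:R :> R by apply: le_trans (sqrt_nat_le _ n) _; rewrite ler_nat.
have ek i : `|e n (fval k) i| <= h.
  rewrite /e normrM ger0_norm ?sqrtr_ge0// /h expr2.
  apply: (@le_trans _ _ (n.+1%:R * n.+1%:R)); first by rewrite ler_pM ?sqrtr_ge0.
  by rewrite ler_peMl// mulr_ge0.
have fk i : `|f n (fval k) i| <= h.
  rewrite /f normrM ger0_norm ?sqrtr_ge0// /h expr2 mulrCA.
  by rewrite ler_pM ?sqrtr_ge0.
have step (u v p q s : R) : `|u| <= h -> `|v| <= h -> `|p| <= s -> `|q| <= s ->
    `|u * p + v * q| <= 2 * h * s /\ `|u * q - v * p| <= 2 * h * s.
  move=> hu hv hp hq.
  have up : `|u * p| <= h * s by rewrite normrM ler_pM.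
  have vq : `|v * q| <= h * s by rewrite normrM ler_pM.
  have uq : `|u * q| <= h * s by rewrite normrM ler_pM.
  have vp : `|v * p| <= h * s by rewrite normrM ler_pM.
  by split; [have := ler_normD (u * p) (v * q)|have := ler_normB (u * q) (v * p)]; lra.
have cb1 (t : bool) : `|cstb t| <= 1 by rewrite /cstb; case: t; rewrite ?normr1 ?normr0.
have s1 i := step _ _ _ _ _ (ek i) (fk i) (cb1 b) (cb1 (~~ b)).
have s2 i j := step _ _ _ _ _ (ek j) (fk j) (s1 i).1 (s1 i).2.
have mod_le : expR (c n (fval k) + dotf (e n (fval k)) x) <= g rho' ^+ n.
  rewrite exp_modulus -[leRHS]mulr1 ler_pM ?exprn_ge0 ?expR_ge0//.
    by rewrite lerXn2r ?nnegrE ?expR_ge0// g_le// enorm_ge0.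
  rewrite -expR0 ler_expR oppr_le0; apply: sumr_ge0 => i _.
  by rewrite divr_ge0 ?sqr_ge0.
have bound (p q : R) : `|p| + `|q| <= 8 * h ^+ 2 ->
    `|plane_wave (e n (fval k)) (f n (fval k)) (c n (fval k)) p q x| <= 8 * d%:R ^+ 2 * n.+1%:R ^+ 4 * g rho' ^+ n.
  move=> pq; apply: le_trans (plane_wave_le _ _ _ _ _ _) _.
  rewrite mulrC; apply: ler_pM; rewrite ?addr_ge0 ?expR_ge0//.
  by apply: le_trans pq _; rewrite /h exprMn -exprM mulrA.
have h1 : 1 <= h by rewrite /h -[leLHS]mulr1 ler_pM// exprn_ege1.
split=> [|i|i j]; apply: bound.
- by have := cb1 b; have := cb1 (~~ b); nra.
- by have [] := s1 i; rewrite /a1 /b1; nra.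
- by have [] := s2 i j; rewrite /a2 /b2 /a1 /b1; nra.
Qed.

(** Passing to integer parts costs at most 1 in each coordinate, hence the Gaussian factor e^{-d/2};
    cosine and sine never vanish together, so |cos| + |sin| >= 1. *)
Lemma approximable_of_exp_scale (w : R -> R) : is_weight w ->
  (forall dl : R, 0 < dl -> scale_sequence g w dl) -> harmonically_approximable d w.
Proof.
move=> hw; have [F HF] := shift_perp.
have Bl0 x : Bl x -> enorm x < 1 by [].
apply: (@approximable_of_blocks R d d g K _ _ _ unit (fun _ b n k =>
  plane_wave (fun i => Num.sqrt n%:R * shift_freq n k i) (fun i => Num.sqrt n%:R * F n k i)
    (- (n%:R / 2) - (\sum_i shift_freq n k i ^+ 2) / 2) (cstb b) (cstb (~~ b))) w (expR (- (d%:R / 2)))) => //.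
- by move=> r _ _; exact: expR_ge0.
- move=> r s r0 rs s1; rewrite /g ltr_expR ltr_pM2r// ltrD2r ltr_pXn2r// ?nnegrE//.
  exact: le_trans (ltW rs).
- by move=> _ b; exact: exp_terms_tame.
move=> n x Bx; pose y i := Num.sqrt n%:R * x 0 i + n.+1%:R.
have yb i : 0 <= y i < (K n)%:R.
  have h1 : `|Num.sqrt n%:R * x 0 i| <= n%:R.
    rewrite normrM ger0_norm ?sqrtr_ge0// -[leRHS]mulr1 ler_pM ?sqrtr_ge0 ?sqrt_nat_le//.
    by apply: le_trans (coord_le_enorm _ _) (ltW _); exact: Bl0.
  rewrite ler_norml in h1; case/andP: h1 => h1 h2.
  by rewrite /y /K mul2n -addnn natrD ltrD2r -natr1; apply/andP; split; lra.
exists (fun _ => y) => [_|].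
  split => [i|i|b k]; [by have /andP[] := yb i|by have /andP[] := yb i|].
  apply: le_trans (plane_wave_le _ _ _ _ _ _) _; rewrite exp_modulus -[leRHS]mulr1.
  rewrite ler_wpM2l ?mulr_ge0 ?exprn_ge0 ?expR_ge0//.
  by rewrite /cstb; case: b; rewrite /= normr1 normr0 ?addr0 ?add0r.
exists tt => /=; pose k i := Num.truncn (y i).
rewrite /plane_wave /cstb /= !mul1r !mul0r addr0 add0r !normrM -mulrDr.
rewrite ger0_norm ?expR_ge0// exp_modulus [leLHS]mulrC -mulrA ler_wpM2l ?exprn_ge0 ?expR_ge0//.
set t := dotf _ x.
have cs : 1 <= `|cos t| + `|sin t|.
  have := cos2Dsin2 t; rewrite -[cos t ^+ 2]real_normK ?num_real// -[sin t ^+ 2]real_normK ?num_real//.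
  by have := normr_ge0 (cos t); have := normr_ge0 (sin t); nra.
apply: (@le_trans _ _ (gauss k y)); last by rewrite ler_peMr ?expR_ge0.
rewrite ler_expR lerN2.
have -> : d%:R / 2 = \sum_(i < d) (1 / 2) :> R by rewrite sumr_const card_ord -[RHS]mulr_natl mul1r.
apply: ler_sum => i _; have /andP[y0 _] := yb i.
have /andP[t1 t2] := truncn_itv y0; rewrite -natr1 in t2.
rewrite ler_pM2r// /k; nra.
Qed.

End exponential_blocks.

(** * Blocks of monomials *)

Section monomial_weights.
Variable R : realType.

Lemma sqrt_sqr_nat k : Num.sqrt (k ^ 2)%:R = k%:R :> R.
Proof. by rewrite natrX sqrtr_sqr ger0_norm. Qed.

Lemma pow_le_exp (y : R) (a : nat) : 0 <= y ->
  (y / Num.sqrt a%:R) ^+ a <= expR ((y ^+ 2 - a%:R) / 2).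
Proof.
move=> y0; case: a => [|a].
  by rewrite expr0 -[leLHS]expR0 ler_expR subr0 divr_ge0// sqr_ge0.
have a0 : 0 < a.+1%:R :> R by [].
rewrite -(@ler_pXn2r _ 2)// ?nnegrE ?expR_ge0 ?exprn_ge0 ?divr_ge0 ?sqrtr_ge0//.
rewrite -exprM mulnC exprM expr_div_n sqr_sqrtr// -[leRHS]expRM_natl.
have -> : 2%:R * ((y ^+ 2 - a.+1%:R) / 2) = a.+1%:R * (y ^+ 2 / a.+1%:R - 1) :> R.
  by field; rewrite gt_eqF.
rewrite expRM_natl lerXn2r ?nnegrE ?expR_ge0 ?divr_ge0 ?sqr_ge0//.
by have := expR_ge1Dx (y ^+ 2 / a.+1%:R - 1 : R); rewrite addrC subrK.
Qed.

(** For a square exponent this bound is sharper than [pow_le_exp]: k y - k^2 = (y^2 - k^2) / 2 - (y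
    - k)^2 / 2, and the last term is the Gaussian. *)
Lemma pow_sqr_le_exp (y : R) (k : nat) : 0 <= y ->
  (y / Num.sqrt (k ^ 2)%:R) ^+ (k ^ 2) <= expR (k%:R * y - k%:R ^+ 2).
Proof.
move=> y0; rewrite sqrt_sqr_nat; case: k => [|k].
  by rewrite expr0 mul0r expr0n /= subr0 expR0.
have k0 : 0 < k.+1%:R :> R by [].
have -> : k.+1%:R * y - k.+1%:R ^+ 2 = (k.+1 ^ 2)%:R * (y / k.+1%:R - 1) :> R.
  by rewrite natrX; field; rewrite gt_eqF.
rewrite expRM_natl lerXn2r ?nnegrE ?expR_ge0 ?divr_ge0//.
by have := expR_ge1Dx (y / k.+1%:R - 1 : R); rewrite addrC subrK.
Qed.

(** From y / k >= exp(1 - k / y). With t = y - k in [0, 1[ the loss in the exponent is at most 3 t^2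
    / 2. *)
Lemma pow_sqr_ge_exp (y : R) (k : nat) : k%:R <= y -> y < k%:R + 1 ->
  expR ((y ^+ 2 - k%:R ^+ 2) / 2 - 3 / 2) <= (y / Num.sqrt (k ^ 2)%:R) ^+ (k ^ 2).
Proof.
move=> ky yk; rewrite sqrt_sqr_nat; case: k ky yk => [|k] ky yk.
  by rewrite expr0 -[leRHS]expR0 ler_expR expr0n /=; nra.
have k0 : 0 < k.+1%:R :> R by [].
have y0 : 0 < y by exact: lt_le_trans ky.
apply: (@le_trans _ _ (expR ((k.+1 ^ 2)%:R * (1 - k.+1%:R / y)))).
  rewrite ler_expR natrX.
  have -> : k.+1%:R ^+ 2 * (1 - k.+1%:R / y) = (k.+1%:R ^+ 2 * (y - k.+1%:R)) / y.
    by field; rewrite gt_eqF.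
  rewrite ler_pdivlMr//; set q := k.+1%:R in ky yk k0 *.
  have -> : y = q + (y - q) by ring.
  have h1 : 0 <= y - q by rewrite subr_ge0.
  have h2 : y - q < 1 by lra.
  set t := y - q in h1 h2 *; have -> : q + t - q = t by ring.
  have h3 : 0 <= q * (1 - t ^+ 2) by rewrite mulr_ge0 ?(ltW k0)//; nra.
  have h4 : 0 <= t * (1 - t ^+ 2) by rewrite mulr_ge0//; nra.
  have -> : ((q + t) ^+ 2 - q ^+ 2) / 2 - 3 / 2 = q * t + t ^+ 2 / 2 - 3 / 2 by field.
  nra.
rewrite expRM_natl lerXn2r ?nnegrE ?expR_ge0 ?divr_ge0 ?(ltW k0) ?(ltW y0)//.
rewrite -[leRHS]invf_div -[leRHS]mul1r ler_pdivlMr ?divr_gt0// -[1 - _]opprB expRN mulrC ler_pdivrMr ?expR_gt0// mul1r.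
by have := expR_ge1Dx (k.+1%:R / y - 1 : R); rewrite addrC subrK.
Qed.

(** Meant for the complementary exponent, which need not be a square. The same inequality, applied
    to y^2 / a, loses (a - y^2)^2 / (2 y^2) in the exponent. *)
Lemma pow_ge_exp (y c : R) (a : nat) : 0 < y -> 0 <= c -> y ^+ 2 <= a%:R -> a%:R - y ^+ 2 <= c * y ->
  expR ((y ^+ 2 - a%:R) / 2 - c ^+ 2 / 2) <= (y / Num.sqrt a%:R) ^+ a.
Proof.
move=> y0 c0 ya ayc.
have y20 : 0 < y ^+ 2 by rewrite exprn_gt0.
have a0 : 0 < a%:R :> R by exact: lt_le_trans ya.
rewrite -(@ler_pXn2r _ 2)// ?nnegrE ?expR_ge0 ?exprn_ge0 ?divr_ge0 ?sqrtr_ge0 ?(ltW y0)//.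
rewrite -exprM mulnC exprM expr_div_n sqr_sqrtr ?(ltW a0)// -[leLHS]expRM_natl.
apply: (@le_trans _ _ (expR (a%:R * (1 - a%:R / y ^+ 2)))).
  rewrite ler_expR; set b := a%:R in a0 ya ayc *.
  have -> : b * (1 - b / y ^+ 2) = (b * (y ^+ 2 - b)) / y ^+ 2 by field; rewrite gt_eqF.
  rewrite ler_pdivlMr//.
  have h : (b - y ^+ 2) ^+ 2 <= c ^+ 2 * y ^+ 2.
    by rewrite -exprMn lerXn2r ?nnegrE ?subr_ge0 ?mulr_ge0 ?(ltW y0).
  by nra.
rewrite expRM_natl lerXn2r ?nnegrE ?expR_ge0 ?divr_ge0 ?(ltW a0) ?(ltW y20)//.
rewrite -[leRHS]invf_div -[leRHS]mul1r ler_pdivlMr ?divr_gt0// -[1 - _]opprB expRN mulrC ler_pdivrMr ?expR_gt0// mul1r.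
by have := expR_ge1Dx (a%:R / y ^+ 2 - 1 : R); rewrite addrC subrK.
Qed.

Variable m : nat.
Implicit Types (k al : 'I_m -> nat) (l : 'I_m) (y a : 'I_m -> R).

(** The component [k l] carries no information; setting it to 0 makes its Gaussian factor trivial.
    The bound on the sum of squares makes the subtraction in [mexp] exact. *)
Definition admissible l (n : nat) k := (k l == 0%N) && (\sum_(i | i != l) k i ^ 2 <= n)%N.

(* The exponent of z_l is the complement to degree n of the squares k_i^2, i <> l. *)
Definition mexp l (n : nat) k (j : 'I_m) : nat :=
  if j == l then (n - \sum_(i | i != l) k i ^ 2)%N else (k j ^ 2)%N.

Lemma sum_mexp l n k : admissible l n k -> (\sum_j mexp l n k j = n)%N.
Proof.
case/andP => _ h; rewrite (bigD1 l)//= {1}/mexp eqxx.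
rewrite (eq_bigr (fun i => k i ^ 2)%N); last by move=> i /negbTE il; rewrite /mexp il.
by rewrite subnK.
Qed.

Lemma natr_mexp l n k : admissible l n k ->
  (mexp l n k l)%:R + \sum_(i | i != l) (k i)%:R ^+ 2 = n%:R :> R.
Proof.
case/andP => _ h; rewrite /mexp eqxx natrB// natr_sum.
by under [X in _ - X]eq_bigr do rewrite natrX; rewrite subrK.
Qed.

Lemma mexp_neq l n k i : i != l -> mexp l n k i = (k i ^ 2)%N.
Proof. by rewrite /mexp => /negbTE ->. Qed.

(** For y_j = sqrt(n) |z_j| / |x| and n the degree, this is the modulus of z^al at x divided by its
    maximum over the sphere through x, which is attained at y_j^2 = al_j. *)
Definition mweight al y : R := \prod_j (y j / Num.sqrt (al j)%:R) ^+ al j.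

(** The crude bound [pow_le_exp] suffices for the index l: since the y_j^2 and the exponents have
    the same sum n, its exponent is half the sum of k_i^2 - y_i^2 over i <> l, which completes the
    squares of the other factors. *)
Lemma mweight_le l n k y : admissible l n k -> (forall j, 0 <= y j) ->
  \sum_j y j ^+ 2 = n%:R ->
  mweight (mexp l n k) y <= gauss k (fun i => if i == l then 0 else y i).
Proof.
move=> adm y0 yn; have al_n := natr_mexp adm.
have yl : y l ^+ 2 - (mexp l n k l)%:R = \sum_(i | i != l) (k i)%:R ^+ 2 - \sum_(i | i != l) y i ^+ 2 :> R.
  by move: yn; rewrite -al_n (bigD1 l)//=; lra.
rewrite /mweight (bigD1 l)//=.
apply: (@le_trans _ _ (expR ((y l ^+ 2 - (mexp l n k l)%:R) / 2) *
    expR (\sum_(i | i != l) ((k i)%:R * y i - (k i)%:R ^+ 2)))).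
  apply: ler_pM; last 1 first.
  - rewrite expR_sum; apply: ler_prod => i il.
    by rewrite exprn_ge0 ?divr_ge0 ?sqrtr_ge0//= mexp_neq// pow_sqr_le_exp.
  - by rewrite exprn_ge0 ?divr_ge0 ?sqrtr_ge0.
  - by apply: prodr_ge0 => i _; rewrite exprn_ge0 ?divr_ge0 ?sqrtr_ge0.
  - exact: pow_le_exp.
rewrite -expRD ler_expR yl [X in _ <= - X](bigD1 l)//= eqxx.
have /andP[/eqP -> _] := adm; rewrite subr0 expr0n /= mul0r add0r.
rewrite le_eqVlt; apply/orP; left; apply/eqP.
rewrite -sumrB mulr_suml -big_split /= -sumrN; apply: eq_bigr => i /negbTE ->.
by field.
Qed.

(** Here l must be the largest coordinate. Replacing y_i by its integer part changes y_i^2 by at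
    most 2 y_i <= 2 y_l, so the exponent of z_l exceeds y_l^2 by at most 2 m y_l, and [pow_ge_exp]
    with c = 2m loses 2 m^2 only. *)
Lemma mweight_ge l n k y : (forall j, 0 <= y j) -> \sum_j y j ^+ 2 = n%:R ->
  (forall j, y j <= y l) -> k l = 0%N ->
  (forall i, i != l -> (k i)%:R <= y i < (k i).+1%:R) ->
  expR (- (3 / 2 * m%:R) - 2 * m%:R ^+ 2) <= mweight (mexp l n k) y /\ admissible l n k.
Proof.
move=> y0 yn ymax kl ky.
have ksum : \sum_(i | i != l) (k i)%:R ^+ 2 <= \sum_(i | i != l) y i ^+ 2 :> R.
  by apply: ler_sum => i il; have /andP[h _] := ky i il; rewrite lerXn2r ?nnegrE.
have adm : admissible l n k.
  rewrite /admissible kl eqxx /= -(ler_nat R) natr_sum -yn [leRHS](bigD1 l)//=.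
  under eq_bigr do rewrite natrX.
  by apply: le_trans ksum _; rewrite lerDr sqr_ge0.
split => //; have al_n := natr_mexp adm.
have yl : (mexp l n k l)%:R - y l ^+ 2 = \sum_(i | i != l) (y i ^+ 2 - (k i)%:R ^+ 2) :> R.
  by move: yn; rewrite -al_n (bigD1 l)//= sumrB; lra.
have yl0 : y l ^+ 2 <= (mexp l n k l)%:R.
  rewrite -subr_ge0 yl; apply: sumr_ge0 => i il; have /andP[h _] := ky i il.
  by rewrite subr_ge0 lerXn2r ?nnegrE.
have yl1 : (mexp l n k l)%:R - y l ^+ 2 <= 2 * m%:R * y l.
  rewrite yl; apply: (@le_trans _ _ (\sum_(i < m) 2 * y l)).
    rewrite big_mkcond; apply: ler_sum => i _; case: ifP => il; last by rewrite mulr_ge0.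
    have /andP[h1 h2] := ky i il; rewrite -natr1 in h2; have := ymax i; have := y0 i.
    have kk : 0 <= (k i)%:R :> R by [].
    by nra.
  by rewrite sumr_const card_ord -[leLHS]mulr_natl mulrCA mulrA.
have main : expR ((y l ^+ 2 - (mexp l n k l)%:R) / 2 - 2 * m%:R ^+ 2) <=
    (y l / Num.sqrt (mexp l n k l)%:R) ^+ mexp l n k l.
  have [yl00|yln0] := eqVneq (y l) 0.
    have n0 : n = 0%N.
      apply/eqP; rewrite -(eqr_nat R) -yn big1// => i _.
      have -> : y i = 0 by apply/eqP; rewrite eq_le y0 -yl00 ymax.
      by rewrite expr0n.
    have -> : mexp l n k l = 0%N by rewrite /mexp eqxx n0.
    rewrite expr0 -[leRHS]expR0 ler_expR yl00 expr0n /= subrr mul0r add0r oppr_le0.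
    by rewrite mulr_ge0 ?exprn_ge0.
  have -> : 2 * m%:R ^+ 2 = (2 * m%:R) ^+ 2 / 2 :> R by field.
  by apply: pow_ge_exp; rewrite ?mulr_ge0// lt_neqAle eq_sym yln0 y0.
rewrite /mweight (bigD1 l)//=.
apply: (@le_trans _ _ (expR ((y l ^+ 2 - (mexp l n k l)%:R) / 2 - 2 * m%:R ^+ 2) *
    expR (\sum_(i | i != l) ((y i ^+ 2 - (k i)%:R ^+ 2) / 2 - 3 / 2)))).
  rewrite -expRD ler_expR sumrB -mulr_suml -yl.
  have : \sum_(i < m | i != l) (3 / 2) <= 3 / 2 * m%:R :> R.
    apply: (@le_trans _ _ (\sum_(i < m) 3 / 2)); last by rewrite sumr_const card_ord -[leLHS]mulr_natr.
    by rewrite big_mkcond; apply: ler_sum => i _; case: ifP.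
  by lra.
apply: ler_pM; rewrite ?expR_ge0//.
rewrite expR_sum; apply: ler_prod => i il; have /andP[h1 h2] := ky i il.
by rewrite expR_ge0 mexp_neq//= pow_sqr_ge_exp// natr1.
Qed.

End monomial_weights.

Section monomial_size.
Variables (R : realType) (m : nat).
Implicit Types (k al : 'I_m -> nat) (l : 'I_m) (y a : 'I_m -> R).

Definition mcoef l (n : nat) k : R := if admissible l n k then
  Num.sqrt n%:R ^+ n * \prod_j (Num.sqrt (mexp l n k j)%:R)^-1 ^+ mexp l n k j else 0.

Lemma mcoef_ge0 l n k : 0 <= mcoef l n k.
Proof.
rewrite /mcoef; case: ifP => // _; rewrite mulr_ge0 ?exprn_ge0 ?sqrtr_ge0//.
by apply: prodr_ge0 => j _; rewrite exprn_ge0 ?invr_ge0 ?sqrtr_ge0.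
Qed.

Lemma mcoef_mweight l n k y a (r : R) : admissible l n k ->
  (forall j, a j * Num.sqrt n%:R = y j * r) ->
  mcoef l n k * \prod_j a j ^+ mexp l n k j = r ^+ n * mweight (mexp l n k) y.
Proof.
move=> adm ay; rewrite /mcoef adm.
have E (c : R) : c ^+ n = \prod_j c ^+ mexp l n k j by rewrite prodrXr sum_mexp.
rewrite !E -!big_split /=; apply: eq_bigr => j _.
by rewrite -!exprMn mulrAC [Num.sqrt n%:R * _]mulrC ay mulrCA mulrA.
Qed.

Lemma scaled_coord n a (r : R) : 0 <= r -> \sum_j a j ^+ 2 = r ^+ 2 -> (n = 0%N \/ 0 < r) ->
  (forall j, a j * Num.sqrt n%:R = (Num.sqrt n%:R * a j / r) * r) /\
  \sum_j (Num.sqrt n%:R * a j / r) ^+ 2 = n%:R.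
Proof.
move=> r0 ar [->|rp].
  split=> [j|]; first by rewrite sqrtr0 mulr0 !mul0r.
  by rewrite big1// => j _; rewrite sqrtr0 !mul0r expr0n.
split=> [j|]; first by rewrite divfK ?gt_eqF// mulrC.
rewrite (eq_bigr (fun j => n%:R / r ^+ 2 * a j ^+ 2)) => [|j _].
  by rewrite -mulr_sumr ar divfK ?gt_eqF ?exprn_gt0.
by rewrite !exprMn sqr_sqrtr// exprVn mulrAC.
Qed.

Lemma mcoef_le l n k a (r : R) : (forall j, 0 <= a j) -> 0 <= r -> \sum_j a j ^+ 2 = r ^+ 2 ->
  mcoef l n k * \prod_j a j ^+ mexp l n k j <=
  r ^+ n * gauss k (fun i => if i == l then 0 else Num.sqrt n%:R * a i / r).
Proof.
move=> a0 r0 ar; case adm: (admissible l n k); last first.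
  by rewrite /mcoef adm mul0r mulr_ge0 ?exprn_ge0 ?expR_ge0.
have gen : (n = 0%N \/ 0 < r) -> mcoef l n k * \prod_j a j ^+ mexp l n k j <=
    r ^+ n * gauss k (fun i => if i == l then 0 else Num.sqrt n%:R * a i / r).
  move=> /(scaled_coord r0 ar)[h1 h2].
  rewrite (mcoef_mweight adm h1) ler_wpM2l ?exprn_ge0//.
  by apply: mweight_le => // j; rewrite divr_ge0 ?mulr_ge0 ?sqrtr_ge0.
(* At r = 0 the quotient by r is 0 by convention and the scaling argument fails unless n = 0; for n
   > 0 both sides vanish. *)
have [rz|rp] := eqVneq r 0; last by apply: gen; right; rewrite lt_neqAle eq_sym rp.
have [n0|np] := posnP n; first by apply: gen; left.
have az j : a j = 0.
  apply/eqP; rewrite -sqrf_eq0 eq_le sqr_ge0 andbT.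
  have <- : \sum_j a j ^+ 2 = 0 by rewrite ar rz expr0n.
  by rewrite (bigD1 j)//= lerDl; apply: sumr_ge0 => i _; exact: sqr_ge0.
under eq_bigr do rewrite az.
by rewrite prodrXr (sum_mexp adm) rz expr0n gtn_eqF// mulr0 mul0r.
Qed.

Lemma mcoef_lt l n k a (r : R) : (forall j, 0 <= a j) -> 0 <= r -> \sum_j a j ^+ 2 = r ^+ 2 ->
  mcoef l n k * \prod_j a j ^+ mexp l n k j <= r ^+ n.
Proof.
move=> a0 r0 ar; apply: le_trans (mcoef_le l n k a0 r0 ar) _.
rewrite ler_piMr ?exprn_ge0// -expR0 ler_expR oppr_le0; apply: sumr_ge0 => i _.
by rewrite divr_ge0 ?sqr_ge0.
Qed.

Lemma mcoef_ge n a (r : R) : (0 < m)%N -> (forall j, 0 <= a j) -> 0 <= r -> \sum_j a j ^+ 2 = r ^+ 2 ->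
  exists l, let k i := Num.truncn (if i == l then 0 else Num.sqrt n%:R * a i / r) in
  expR (- (3 / 2 * m%:R) - 2 * m%:R ^+ 2) * r ^+ n <= mcoef l n k * \prod_j a j ^+ mexp l n k j.
Proof.
move=> m0 a0 r0 ar; pose j0 := Ordinal m0.
have [l _ lmax] := @Order.TotalTheory.arg_maxP _ _ 'I_m j0 xpredT a isT.
exists l; set k := fun i => _; rewrite /=.
have gen : (n = 0%N \/ 0 < r) -> expR (- (3 / 2 * m%:R) - 2 * m%:R ^+ 2) * r ^+ n <=
    mcoef l n k * \prod_j a j ^+ mexp l n k j.
  move=> /(scaled_coord r0 ar)[h1 h2].
  have y0 j : 0 <= Num.sqrt n%:R * a j / r by rewrite divr_ge0 ?mulr_ge0 ?sqrtr_ge0.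
  have [||i il|h3 adm] := mweight_ge (k := k) (l := l) y0 h2.
  - by move=> j; rewrite ler_wpM2r ?invr_ge0// ler_wpM2l ?sqrtr_ge0//; exact: lmax.
  - by rewrite /k eqxx truncn0.
  - by rewrite /k (negbTE il) truncn_itv.
  by rewrite (mcoef_mweight adm h1) mulrC ler_wpM2l ?exprn_ge0.
have [rz|rp] := eqVneq r 0; last by apply: gen; right; rewrite lt_neqAle eq_sym rp.
have [n0|np] := posnP n; first by apply: gen; left.
rewrite rz expr0n gtn_eqF// mulr0 mulr_ge0 ?mcoef_ge0//.
by apply: prodr_ge0 => j _; rewrite exprn_ge0.
Qed.

End monomial_size.

Section complex_monomials.
Variables (R : realType) (m : nat).
Local Notation V := 'rV[R]_(m + m).
Local Notation Re := (@complex.Re R).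
Local Notation Im := (@complex.Im R).
Implicit Types (al : 'I_m -> nat) (lam : R[i]).

Definition zc (j : 'I_m) (x : V) : R[i] := Complex (x 0 (lshift m j)) (x 0 (rshift m j)).

Lemma ReM (a b : R[i]) : Re (a * b) = Re a * Re b - Im a * Im b.
Proof. by case: a => a1 a2; case: b. Qed.

Lemma ImM (a b : R[i]) : Im (a * b) = Re a * Im b + Im a * Re b.
Proof. by case: a => a1 a2; case: b. Qed.

Lemma ReD (a b : R[i]) : Re (a + b) = Re a + Re b.
Proof. by case: a => a1 a2; case: b. Qed.

Lemma ImD (a b : R[i]) : Im (a + b) = Im a + Im b.
Proof. by case: a => a1 a2; case: b. Qed.

(** The differentiation is along real coordinates; complex multiplication merely gives a compact
    form to the partial derivatives. *)
Definition CC1 U (F : V -> R[i]) (dF : 'I_(m + m) -> V -> R[i]) :=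
  C1 U (fun x => Re (F x)) (fun i x => Re (dF i x)) /\
  C1 U (fun x => Im (F x)) (fun i x => Im (dF i x)).

Lemma CC1_ext U F dF G dG : (forall x, F x = G x) -> (forall i x, dF i x = dG i x) ->
  CC1 U F dF -> CC1 U G dG.
Proof.
move=> h1 h2 [h3 h4]; split.
  by apply: C1_ext h3 => [x|i x]; rewrite ?h1 ?h2.
by apply: C1_ext h4 => [x|i x]; rewrite ?h1 ?h2.
Qed.

Lemma CC1_cst U lam : CC1 U (fun=> lam) (fun _ _ => 0).
Proof. by split; exact: C1_cst. Qed.

Lemma CC1_mul U F dF G dG : CC1 U F dF -> CC1 U G dG ->
  CC1 U (fun x => F x * G x) (fun i x => dF i x * G x + F x * dG i x).
Proof.
move=> [F1 F2] [G1 G2]; split.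
  apply: C1_ext (C1D (C1M F1 G1) (C1N (C1M F2 G2))) => [x|i x]; rewrite ?ReD !ReM//.
  by rewrite opprD addrACA.
apply: C1_ext (C1D (C1M F1 G2) (C1M F2 G1)) => [x|i x]; rewrite ?ImD !ImM//.
by ring.
Qed.

Lemma CC1_exp U F dF n : CC1 U F dF ->
  CC1 U (fun x => F x ^+ n) (fun i x => n%:R * F x ^+ n.-1 * dF i x).
Proof.
move=> CF; elim: n => [|n IH].
  by apply: CC1_ext (CC1_cst U 1) => [x|i x]; rewrite ?expr0// !mul0r.
apply: CC1_ext (CC1_mul CF IH) => [x|i x]; first by rewrite exprS.
case: n {IH} => [|n] /=; first by rewrite !expr0 mulr0n !mul0r mulr0 addr0 !mul1r mulr1.
by rewrite -[n.+2%:R]natr1 exprS; ring.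
Qed.

Lemma CC1_prod U (s : seq 'I_m) (F : 'I_m -> V -> R[i]) dF : uniq s -> (forall j, CC1 U (F j) (dF j)) ->
  CC1 U (fun x => \prod_(j <- s) F j x)
    (fun i x => \sum_(j <- s) dF j i x * \prod_(j' <- s | j' != j) F j' x).
Proof.
move=> us CF; elim: s us => [_|j s IH /= /andP[js us]].
  by apply: CC1_ext (CC1_cst U 1) => [x|i x]; rewrite !big_nil.
apply: CC1_ext (CC1_mul (CF j) (IH us)) => [x|i x]; first by rewrite big_cons.
rewrite !big_cons eqxx; congr (_ * _ + _).
  rewrite big_seq [RHS]big_seq_cond; apply: eq_bigl => j'.
  by case: (boolP (j' \in s)) => //= h; apply/esym; apply: contraNneq js => <-.
rewrite mulr_sumr big_seq [RHS]big_seq; apply: eq_bigr => j' j's.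
rewrite big_cons ifT; first by rewrite mulrCA.
by apply: contraNneq js => ->.
Qed.

(** The real coordinate x_i enters only the complex variable of index [cvar i], whose derivative
    along x_i is [cdir i], that is 1 or i. *)
Definition cvar (i : 'I_(m + m)) : 'I_m := match fintype.split i with inl j => j | inr j => j end.

Definition cdir (i : 'I_(m + m)) : R[i] := match fintype.split i with inl _ => 1 | inr _ => Complex 0 1 end.

Lemma cvar_lshift j : cvar (lshift m j) = j.
Proof. by rewrite /cvar -[lshift m j]/(unsplit (inl j)) unsplitK. Qed.

Lemma cvar_rshift j : cvar (rshift m j) = j.
Proof. by rewrite /cvar -[rshift m j]/(unsplit (inr j)) unsplitK. Qed.

Lemma cdir_lshift j : cdir (lshift m j) = 1.
Proof. by rewrite /cdir -[lshift m j]/(unsplit (inl j)) unsplitK. Qed.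

Lemma cdir_rshift j : cdir (rshift m j) = Complex 0 1.
Proof. by rewrite /cdir -[rshift m j]/(unsplit (inr j)) unsplitK. Qed.

Lemma CC1_zc U j : CC1 U (zc j) (fun i _ => if j == cvar i then cdir i else 0).
Proof.
have [h1 h2] := (@C1_coord R (m + m) U (lshift m j), @C1_coord R (m + m) U (rshift m j)).
split.
  apply: C1_ext h1 => // i x; case: (split_ordP i) => j' ->.
    by rewrite cvar_lshift cdir_lshift eq_lshift; case: eqP.
  by rewrite cvar_rshift cdir_rshift eq_lrshift; case: eqP.
apply: C1_ext h2 => // i x; case: (split_ordP i) => j' ->.
  by rewrite cvar_lshift cdir_lshift eq_rlshift; case: eqP.
by rewrite cvar_rshift cdir_rshift eq_rshift; case: eqP.
Qed.

Definition cmon lam al (x : V) : R[i] := lam * \prod_j zc j x ^+ al j.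

(** Truncated subtraction does no harm: an exponent 0 comes with the factor [(al j)%:R = 0]. *)
Definition dec (j : 'I_m) al (j' : 'I_m) : nat := (al j' - (j' == j))%N.

Lemma CC1_cmon U lam al : CC1 U (cmon lam al)
  (fun i => cmon (lam * (al (cvar i))%:R * cdir i) (dec (cvar i) al)).
Proof.
have H := CC1_mul (CC1_cst U lam)
  (CC1_prod (index_enum_uniq 'I_m) (fun j => CC1_exp (al j) (CC1_zc U j))).
apply: CC1_ext H => // i x; rewrite mul0r add0r.
rewrite (bigD1_seq (cvar i)) ?mem_index_enum ?index_enum_uniq//= eqxx.
rewrite [X in _ + X]big1_seq ?addr0 => [|j /andP[/negbTE ->]]; last by rewrite mulr0 mul0r.
rewrite /cmon [in RHS](bigD1 (cvar i))//= /dec eqxx subn1.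
rewrite [in RHS](eq_bigr (fun j => zc j x ^+ al j)) => [|j /negbTE ->]; last by rewrite subn0.
by ring.
Qed.

(** The second derivatives along the real and imaginary parts of z_j differ by the factor i^2 = -1
    and cancel in pairs. *)
Lemma cmon_laplacian lam al x :
  \sum_i Re (cmon (lam * (al (cvar i))%:R * cdir i * (dec (cvar i) al (cvar i))%:R * cdir i)
    (dec (cvar i) (dec (cvar i) al)) x) = 0.
Proof.
rewrite big_split_ord /= -big_split /= big1// => j _.
rewrite cvar_lshift cvar_rshift cdir_lshift cdir_rshift -ReD /cmon -mulrDl.
set A := lam * _; have ii : Complex 0 1 * Complex 0 1 = -1 :> R[i].
  by rewrite -expr2 (@complex.sqr_i R).
have -> : A * 1 * (dec j al j)%:R * 1 + A * Complex 0 1 * (dec j al j)%:R * Complex 0 1 = 0.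
  have -> : A * Complex 0 1 * (dec j al j)%:R * Complex 0 1 = A * (dec j al j)%:R * (Complex 0 1 * Complex 0 1) by ring.
  by rewrite ii; ring.
by rewrite mul0r.
Qed.

Local Notation normc := (@Normc.normc R).

Lemma normc_ge0 (z : R[i]) : 0 <= normc z.
Proof. by case: z => a b; exact: sqrtr_ge0. Qed.

Lemma normc_Re_le (z : R[i]) : `|Re z| <= normc z.
Proof. by case: z => a b /=; rewrite -sqrtr_sqr ler_wsqrtr// lerDl sqr_ge0. Qed.

Lemma normc_le (z : R[i]) : normc z <= `|Re z| + `|Im z|.
Proof.
case: z => a b /=; rewrite -(@ler_pXn2r _ 2)// ?nnegrE ?sqrtr_ge0 ?addr_ge0//.
rewrite sqr_sqrtr ?addr_ge0 ?sqr_ge0// sqrrD !real_normK ?num_real//.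
by rewrite lerD2r lerDl mulrn_wge0// mulr_ge0.
Qed.

Lemma normc_prod (F : 'I_m -> R[i]) : normc (\prod_j F j) = \prod_j normc (F j).
Proof. exact: (big_morph normc (@Normc.normcM R) (@Normc.normc1 R)). Qed.

Lemma normcX (z : R[i]) n : normc (z ^+ n) = normc z ^+ n.
Proof. by elim: n => [|n IH]; rewrite ?expr0 ?Normc.normc1// !exprS Normc.normcM IH. Qed.

Lemma normc_real (a : R) : normc (Complex a 0) = `|a|.
Proof. by rewrite /= expr0n /= addr0 sqrtr_sqr. Qed.

Lemma normc_cmon lam al x : normc (cmon lam al x) = normc lam * \prod_j normc (zc j x) ^+ al j.
Proof. by rewrite /cmon Normc.normcM normc_prod; under eq_bigr do rewrite normcX. Qed.

Lemma sum_normc_zc x : \sum_j normc (zc j x) ^+ 2 = enorm x ^+ 2.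
Proof.
rewrite sqr_enorm big_split_ord /= -big_split /=; apply: eq_bigr => j _.
by rewrite sqr_sqrtr ?addr_ge0 ?sqr_ge0.
Qed.

Lemma normc_cdir i : normc (cdir i) = 1.
Proof.
rewrite /cdir; case: (fintype.split i) => _; first exact: Normc.normc1.
by rewrite /= expr0n expr1n /= add0r sqrtr1.
Qed.

End complex_monomials.

Section monomial_blocks.
Variables (R : realType) (m : nat).
Hypothesis m0 : (0 < m)%N.
Local Notation V := 'rV[R]_(m + m).
Local Notation Re := (@complex.Re R).
Local Notation Im := (@complex.Im R).
Local Notation normc := (@Normc.normc R).
Implicit Types (al k : 'I_m -> nat) (l : 'I_m) (x : V).

Let K (n : nat) := n.+1.

(* Re(-i z) = Im z, so that b selects the real or the imaginary part. *)
Definition mscalar l (b : bool) n k : R[i] :=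
  Complex (mcoef R l n k) 0 * (if b then 1 else Complex 0 (-1)).

Lemma normc_mscalar l b n k : normc (mscalar l b n k) = mcoef R l n k.
Proof.
rewrite /mscalar Normc.normcM normc_real ger0_norm ?mcoef_ge0//; case: b.
  by rewrite Normc.normc1 mulr1.
by rewrite /= expr0n /= add0r sqrrN expr1n sqrtr1 mulr1.
Qed.

Lemma normc_nat (n : nat) : normc n%:R = n%:R.
Proof. by rewrite -(rmorph_nat (real_complex R)) normc_real normr_nat. Qed.

Lemma mexp_le l n k j : admissible l n k -> (mexp l n k j <= n)%N.
Proof. by move=> /sum_mexp {2}<-; rewrite (bigD1 j)//= leq_addr. Qed.

(** Stands in for the Cauchy estimates: once the modulus a_j is at least dl, lowering its exponent
    costs a factor 1/dl, so derivatives are controlled by the monomial itself at enlarged moduli. *)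
Lemma prod_dec_le (a : 'I_m -> R) (dl : R) al (j : 'I_m) : (forall i, 0 <= a i) -> 0 < dl -> dl <= a j ->
  (al j)%:R * \prod_i a i ^+ dec j al i <= (al j)%:R / dl * \prod_i a i ^+ al i.
Proof.
move=> a0 d0 da; have [->|p] := posnP (al j); first by rewrite !mul0r.
rewrite -mulrA ler_wpM2l// ler_pdivlMl//.
rewrite (bigD1 j)//= [in leRHS](bigD1 j)//= {1}/dec eqxx subn1.
rewrite (eq_bigr (fun i => a i ^+ al i)) => [|i /negbTE ij]; last by rewrite /dec ij subn0.
rewrite mulrA; apply: ler_wpM2r; first by apply: prodr_ge0 => i _; rewrite exprn_ge0.
by rewrite -{2}(prednK p) exprS ler_wpM2r ?exprn_ge0.
Qed.

Lemma normc_cmon_le (a : 'I_m -> R) lam al x : (forall j, normc (zc j x) <= a j) ->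
  normc (cmon lam al x) <= normc lam * \prod_j a j ^+ al j.
Proof.
move=> h; rewrite normc_cmon ler_wpM2l ?normc_ge0//; apply: ler_prod => j _.
rewrite exprn_ge0 ?normc_ge0//= lerXn2r ?nnegrE ?normc_ge0//.
  exact: le_trans (normc_ge0 _) (h j).
exact: h.
Qed.

Lemma normc_zc_le x j : normc (zc j x) <= enorm x.
Proof.
rewrite -(@ler_pXn2r _ 2)// ?nnegrE ?normc_ge0 ?enorm_ge0// -sum_normc_zc (bigD1 j)//= lerDl.
by apply: sumr_ge0 => i _; exact: sqr_ge0.
Qed.

Lemma monomial_terms_tame l b :
  tame_terms (d := m + m) id K (fun n k x => Re (cmon (mscalar l b n k) (mexp l n k) x)).
Proof.
pose lam1 n k i := mscalar l b n k * (mexp l n k (cvar i))%:R * cdir R i.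
pose al1 n k i := dec (cvar (m := m) i) (mexp l n k).
pose lam2 n k i j := lam1 n k i * (al1 n k i (cvar j))%:R * cdir R j.
pose al2 n k i j := dec (cvar (m := m) j) (al1 n k i).
exists (fun n k i x => Re (cmon (lam1 n k i) (al1 n k i) x)).
exists (fun n k i j x => Re (cmon (lam2 n k i j) (al2 n k i j) x)).
split.
- by move=> n k; exact: (CC1_cmon _ _ _).1.
- by move=> n k i; exact: (CC1_cmon _ _ _).1.
- by move=> n k x _; exact: cmon_laplacian.
move=> rho r1; pose r0 := Num.max rho 0.
have r00 : 0 <= r0 by rewrite le_max lexx orbT.
have r01 : r0 < 1 by rewrite /r0 gt_max r1 ltr01.
have r02 : r0 ^+ 2 < 1 by rewrite expr_lt1.
have r20 : 0 <= r0 ^+ 2 by exact: sqr_ge0.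
pose rho' := Num.sqrt ((1 + r0 ^+ 2) / 2).
have r'1 : rho' < 1 by rewrite -[ltRHS]sqrtr1 ltr_sqrt//; lra.
(* Enlarging each modulus |z_j| <= 1 by dl <= 1 adds at most 3 dl to its square, hence at most (1 -
   r0^2) / 2 in all, which is the difference between rho'^2 and r0^2. *)
pose dl := (1 - r0 ^+ 2) / (6 * m%:R).
have m1 : 1 <= m%:R :> R by rewrite ler1n.
have m6 : 0 < 6 * m%:R :> R by lra.
have dl0 : 0 < dl by rewrite divr_gt0// subr_gt0.
have dlE : dl * (6 * m%:R) = 1 - r0 ^+ 2 by rewrite divfK// gt_eqF.
have dl1 : dl <= 1 by rewrite ler_pdivrMr// mul1r; lra.
exists (dl^-1 ^+ 2), rho', 2%N; split; rewrite ?exprn_ge0 ?invr_ge0 ?sqrtr_ge0 ?(ltW dl0)//.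
move=> n k' x xr; set k := fval k'.
pose a j := normc (zc j x) + dl.
have za j : normc (zc j x) <= a j by rewrite lerDl ltW.
have a0 j : 0 <= a j by apply: le_trans (za j); exact: normc_ge0.
have dla j : dl <= a j by rewrite lerDr normc_ge0.
have sa : \sum_j a j ^+ 2 <= rho' ^+ 2.
  rewrite sqr_sqrtr; last by lra.
  have xr0 : enorm x <= r0 by rewrite le_max xr.
  apply: (@le_trans _ _ (\sum_j (normc (zc j x) ^+ 2 + 3 * dl))).
    apply: ler_sum => j _; have h1 := normc_ge0 (zc j x).
    have h2 : normc (zc j x) <= 1 by apply: le_trans (normc_zc_le x j) (le_trans xr0 (ltW r01)).
    by rewrite /a; nra.
  rewrite big_split /= sum_normc_zc sumr_const card_ord -[X in _ + X]mulr_natl.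
  have : enorm x ^+ 2 <= r0 ^+ 2 by rewrite lerXn2r ?nnegrE ?enorm_ge0.
  by move: dlE; lra.
have s0 : 0 <= \sum_j a j ^+ 2 by apply: sumr_ge0 => j _; exact: sqr_ge0.
have base : mcoef R l n k * \prod_j a j ^+ mexp l n k j <= rho' ^+ n.
  apply: le_trans (mcoef_lt l n k (r := Num.sqrt (\sum_j a j ^+ 2)) a0 _ _) _ => //.
    by rewrite sqr_sqrtr.
  rewrite lerXn2r ?nnegrE ?sqrtr_ge0//.
  by rewrite -(@ler_pXn2r _ 2)// ?nnegrE ?sqrtr_ge0// sqr_sqrtr.
have mc0 := mcoef_ge0 R l n k.
have [mz|adm] := eqVneq (mcoef R l n k) 0.
  have lz : mscalar l b n k = 0 by rewrite /mscalar mz mul0r.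
  have cz al : cmon 0 al x = 0 by rewrite /cmon mul0r.
  have nn : 0 <= dl^-1 ^+ 2 * n.+1%:R ^+ 2 * rho' ^+ n.
    by rewrite !mulr_ge0 ?exprn_ge0 ?invr_ge0 ?sqrtr_ge0 ?(ltW dl0).
  by rewrite /lam2 /lam1 lz; split=> [|i|i j]; rewrite ?mul0r cz /= normr0.
have {}adm : admissible l n k by move: adm; rewrite /mcoef; case: ifP; rewrite ?eqxx.
have dn : 1 <= dl^-1 * n.+1%:R.
  by rewrite ler_pdivlMl// mulr1 (le_trans dl1)// ler1n.
have step (M0 : R) al j : (al j <= n)%N -> 0 <= M0 ->
    M0 * (al j)%:R * \prod_i a i ^+ dec j al i <= dl^-1 * n.+1%:R * (M0 * \prod_i a i ^+ al i).
  move=> aln M00; have p0 : 0 <= \prod_i a i ^+ al i by apply: prodr_ge0 => i _; rewrite exprn_ge0.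
  rewrite -mulrA; apply: le_trans (ler_wpM2l M00 (prod_dec_le al a0 dl0 (dla j))) _.
  rewrite mulrCA; apply: ler_wpM2r; first by rewrite mulr_ge0.
  rewrite mulrC; apply: ler_wpM2l; first by rewrite invr_ge0 ltW.
  by rewrite ler_nat (leq_trans aln).
have b1 i : mcoef R l n k * (mexp l n k (cvar i))%:R * \prod_j a j ^+ al1 n k i j <=
    dl^-1 * n.+1%:R * rho' ^+ n.
  apply: le_trans (step _ _ _ _ mc0) _; first exact: mexp_le.
  by rewrite ler_wpM2l// mulr_ge0 ?invr_ge0 ?(ltW dl0).
have b2 i j : mcoef R l n k * (mexp l n k (cvar i))%:R * (al1 n k i (cvar j))%:R *
    \prod_j' a j' ^+ al2 n k i j j' <= (dl^-1 * n.+1%:R) ^+ 2 * rho' ^+ n.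
  apply: le_trans (step _ _ _ _ _) _.
  - by rewrite /al1 /dec (leq_trans (leq_subr _ _))// mexp_le.
  - by rewrite mulr_ge0.
  by rewrite expr2 -[leRHS]mulrA ler_wpM2l// mulr_ge0 ?invr_ge0 ?(ltW dl0).
have rn : 0 <= rho' ^+ n by rewrite exprn_ge0 ?sqrtr_ge0.
have fin (z : R[i]) (B : R) : normc z <= B -> B <= (dl^-1 * n.+1%:R) ^+ 2 * rho' ^+ n ->
    `|Re z| <= dl^-1 ^+ 2 * n.+1%:R ^+ 2 * rho' ^+ n.
  by move=> h1 h2; apply: le_trans (normc_Re_le z) (le_trans h1 _); rewrite -exprMn.
have sq1 : 1 <= (dl^-1 * n.+1%:R) ^+ 2 by rewrite exprn_ege1.
split=> [|i|i j]; apply: fin (normc_cmon_le _ _ za) _.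
- by rewrite normc_mscalar; apply: le_trans base _; rewrite ler_peMl.
- rewrite /lam1 2!Normc.normcM normc_mscalar normc_nat normc_cdir mulr1.
  by apply: le_trans (b1 i) _; rewrite ler_wpM2r// expr2 ler_peMr// (le_trans ler01).
- rewrite /lam2 /lam1 4!Normc.normcM normc_mscalar !normc_nat !normc_cdir !mulr1.
  exact: b2.
Qed.

(** The finite index l ranges over the possible positions of the largest |z_j|, because the lower
    bound holds only when that variable carries the complementary exponent. *)
Lemma approximable_of_id_scale (w : R -> R) : is_weight w ->
  (forall dl : R, 0 < dl -> scale_sequence id w dl) -> harmonically_approximable (m + m) w.
Proof.
move=> hw; pose c0 : R := expR (- (3 / 2 * m%:R) - 2 * m%:R ^+ 2).
apply: (@approximable_of_blocks R (m + m) m id K _ _ _ 'I_m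
  (fun l b n k x => Re (cmon (mscalar l b n k) (mexp l n k) x)) w c0) => //.
- by move=> n; rewrite /K mul2n -addnn leq_addr.
- exact: expR_gt0.
- by move=> l b; exact: monomial_terms_tame.
move=> n x Bx; pose a j := normc (zc j x).
have a0 j : 0 <= a j by exact: normc_ge0.
have ar : \sum_j a j ^+ 2 = enorm x ^+ 2 by exact: sum_normc_zc.
exists (fun l i => if i == l then 0 else Num.sqrt n%:R * a i / enorm x) => [l|].
  have yb i : 0 <= (if i == l then 0 else Num.sqrt n%:R * a i / enorm x) < (K n)%:R.
    case: ifP => _; first by rewrite lexx ltr0n.
    rewrite divr_ge0 ?mulr_ge0 ?sqrtr_ge0 ?enorm_ge0//=.
    apply: (@le_lt_trans _ _ n%:R); last by rewrite ltr_nat.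
    apply: le_trans (sqrt_nat_le R n); rewrite -mulrA ler_piMr ?sqrtr_ge0//.
    have [->|e0] := eqVneq (enorm x) 0; first by rewrite invr0 mulr0.
    by rewrite ler_pdivrMr ?mul1r ?normc_zc_le// lt_neqAle eq_sym e0 enorm_ge0.
  split => [i|i|b k]; [by have /andP[] := yb i|by have /andP[] := yb i|].
  apply: le_trans (normc_Re_le _) _; rewrite normc_cmon normc_mscalar.
  by apply: mcoef_le => //; exact: enorm_ge0.
have [l hl] := mcoef_ge n m0 a0 (enorm_ge0 x) ar; exists l => /=.
set k := (fun i => _) in hl *; apply: le_trans hl _.
set z := cmon (mscalar l true n k) (mexp l n k) x.
have -> : Re (cmon (mscalar l false n k) (mexp l n k) x) = Im z.
  rewrite /z /cmon /mscalar; move: (Complex _ 0) (\prod_j _) => [u v] [p q] /=.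
  by ring.
apply: le_trans (normc_le z).
by rewrite /z normc_cmon normc_mscalar.
Qed.

End monomial_blocks.

Lemma approximable_equiv (R : realType) (d : nat) (v w : R -> R) :
  equiv_on `[0, 1[ w v -> harmonically_approximable d v -> harmonically_approximable d w.
Proof.
move=> [C1 [C2 [C10 C20 E]]] [J [f [hf [c1 [c2 [c10 c20 H]]]]]].
exists J, f; split => //; exists (c1 / C2), (c2 / C1); split; rewrite ?divr_gt0// => x Bx.
have [h1 h2] := H x Bx.
have [h3 h4] : C1 * w (enorm x) <= v (enorm x) /\ v (enorm x) <= C2 * w (enorm x).
  by apply: E; rewrite /= in_itv /= enorm_ge0.
split; first by rewrite mulrAC ler_pdivrMr// mulrC -[leRHS]mulrC (le_trans _ h4)// mulrC.
by rewrite mulrAC ler_pdivlMr// mulrC (le_trans h3).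
Qed.

Theorem theorem1p1 (R : realType) (d : nat) (hd : (2 <= d)%N)
    (w : R -> R) (hw : is_weight w) :
  [/\ harmonically_approximable d w -> equiv_log_convex_weight w,
      ~~ odd d -> (harmonically_approximable d w <-> equiv_log_convex_weight w)
    & odd d -> doubling w -> harmonically_approximable d w].
Proof.
have necessary := approximable_log_convex hd hw.
split => // [even_d|_ dw].
  split => // -[v [hv cv wv]]; apply: approximable_equiv wv _.
  have d0 : (0 < d./2)%N by rewrite half_gt0.
  have := approximable_of_id_scale d0 hv (scale_sequence_log_convex hv cv).
  by rewrite addnn even_halfK.
apply: approximable_of_exp_scale => //; exact: scale_sequence_doubling.
Qed.
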